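(* Let $M_1$ and $M_2$ be compact manifolds. Then $$\mathbf{Riem}(M_1\times M_2)\ge\max\{\mathbf{Riem}(M_1),\mathbf{Riem}(M_2)\}.$$
   Context: Throughout, manifolds are smooth, closed (compact without boundary) and connected. For a Riemannian metric $g$ on an $n$-manifold $M$, $R$ denotes the Riemann curvature tensor, viewed as a symmetric bilinear form on $\Lambda^2TM$ (the curvature operator, normalized to be the identity when the sectional curvature is $1$), and $\mathrm{Scal}$ is the scalar curvature (twice the trace of the curvature operator). For $t\in\mathbb{R}$ put $\mathrm{Riem}_t(g):=\mathrm{Scal}\,\frac{g^2}{2}-2tR$, where $g^2$ is the Kulkarni-Nomizu square of $g$ (so $g^2/2$ is the inner product induced by $g$ on $\Lambda^2TM$). $\mathrm{Riem}_t(g)>0$ means that this form is positive definite at every point. If $\mathrm{Scal}(g)>0$ everywhere, the metric invariant is $\mathrm{Riem}(g):=\sup\{t\in(0,n(n-1)/2):\mathrm{Riem}_t(g)>0\}$ (equivalently $\mathrm{Riem}(g)=\inf_M \frac{\mathrm{Scal}}{2\lambda_{\max}}$, with $\lambda_{\max}$ the maximal eigenvalue of the curvature operator at a point); otherwise $\mathrm{Riem}(g):=0$. The smooth invariant is $\mathbf{Riem}(M):=\sup_g\mathrm{Riem}(g)$ over all Riemannian metrics $g$ on $M$; it is $0$ if $M$ has no metric of positive scalar curvature. *)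

(* Defs.v *)
From HB Require Import structures.
From mathcomp Require Import all_boot all_order all_algebra.
From mathcomp Require Import all_classical all_reals all_analysis.

Set Implicit Arguments.
Unset Strict Implicit.
Unset Printing Implicit Defensive.

Import Order.TTheory GRing.Theory Num.Theory.
Import numFieldNormedType.Exports.

Local Open Scope classical_set_scope.
Local Open Scope ring_scope.

(* Points of R^n are row vectors.  Maps between open sets are represented by
   total functions; every condition on such a map is local at the points of
   the open set, so the values outside of it are irrelevant. *)

(* f is C^k on the open set U: for k > 0, f is differentiable on U and all its
   directional derivatives (equivalently its partial derivatives) are C^(k-1). *)
Fixpoint Ck_on (R : realType) (m : nat) (W : normedModType R) (k : nat)
    (U : set 'rV[R]_m) (f : 'rV[R]_m -> W) : Prop :=
  match k with
  | 0 => forall x, U x -> {for x, continuous f}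
  | k'.+1 => (forall x, U x -> differentiable f x) /\
             forall v : 'rV[R]_m, Ck_on k' U (fun x => 'D_v f x)
  end.

Definition smooth_on (R : realType) (m : nat) (W : normedModType R)
    (U : set 'rV[R]_m) (f : 'rV[R]_m -> W) : Prop :=
  forall k, Ck_on k U f.

Record chart (R : realType) (n : nat) (T : topologicalType) := Chart {
  chart_dom : set T;
  chart_map : T -> 'rV[R]_n;
  chart_inv : 'rV[R]_n -> T;
  chart_dom_open : open chart_dom;
  chart_img_open : open (chart_map @` chart_dom);
  chart_mapK : forall p, chart_dom p -> chart_inv (chart_map p) = p;
  chart_map_continuous : forall p, chart_dom p -> {for p, continuous chart_map};
  chart_inv_continuous : forall x, (chart_map @` chart_dom) x ->
    {for x, continuous chart_inv} }.

Definition chart_img (R : realType) (n : nat) (T : topologicalType)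
  (c : chart R n T) : set 'rV[R]_n := chart_map c @` chart_dom c.

(* The coordinate change from c to c', and the set on which it is meaningful. *)
Definition transition (R : realType) (n : nat) (T : topologicalType)
  (c c' : chart R n T) : 'rV[R]_n -> 'rV[R]_n :=
  fun x => chart_map c' (chart_inv c x).

Definition overlap (R : realType) (n : nat) (T : topologicalType)
  (c c' : chart R n T) : set 'rV[R]_n :=
  [set x | chart_img c x /\ chart_dom c' (chart_inv c x)].

(* A smooth, closed (compact without boundary), connected n-manifold, presented
   by an arbitrary smooth atlas.  Second countability need not be required: it
   follows from compactness and the existence of charts. *)
Record closedManifold (R : realType) (n : nat) := ClosedManifold {
  mfd_space :> topologicalType;
  mfd_index : Type;
  mfd_chart : mfd_index -> chart R n mfd_space;
  mfd_cover : forall p : mfd_space, exists i, chart_dom (mfd_chart i) p;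
  mfd_smooth : forall i j, smooth_on (overlap (mfd_chart i) (mfd_chart j))
                             (transition (mfd_chart i) (mfd_chart j));
  mfd_hausdorff : hausdorff_space mfd_space;
  mfd_compact : compact [set: mfd_space];
  mfd_connected : connected [set: mfd_space];
  mfd_nonempty : [set: mfd_space] !=set0 }.

(* A Riemannian metric given by its matrices g_ab = g(d_a, d_b) in the charts.
   As jacobian tau x has (a, c) entry d_a tau^c, the last axiom is
   g_ab = sum_(c, d) (d_a tau^c) (d_b tau^d) g'_cd. *)
Record riemannianMetric (R : realType) (n : nat) (M : closedManifold R n) :=
  RiemannianMetric {
  metric_mx : mfd_index M -> 'rV[R]_n -> 'M[R]_n;
  metric_smooth : forall i, smooth_on (chart_img (mfd_chart i)) (metric_mx i);
  metric_sym : forall i x, chart_img (mfd_chart i) x ->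
    (metric_mx i x)^T = metric_mx i x;
  metric_pos : forall i x, chart_img (mfd_chart i) x ->
    forall v : 'rV[R]_n, v != 0 -> 0 < (v *m metric_mx i x *m v^T) 0 0;
  metric_compat : forall i j x, overlap (mfd_chart i) (mfd_chart j) x ->
    let tau := transition (mfd_chart i) (mfd_chart j) in
    metric_mx i x =
      jacobian tau x *m metric_mx j (tau x) *m (jacobian tau x)^T }.

Section local_curvature.
Variables (R : realType) (n : nat).
Implicit Types (g : 'rV[R]_n -> 'M[R]_n) (x : 'rV[R]_n) (a b c d i j k l : 'I_n).

Definition partial i (f : 'rV[R]_n -> R) : 'rV[R]_n -> R :=
  fun x => 'D_('e_i) f x.

(* Gamma^k_ij *)
Definition christoffel g k i j x : R :=
  2^-1 * \sum_l invmx (g x) k l *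
    (partial i (fun y => g y j l) x + partial j (fun y => g y i l) x
     - partial l (fun y => g y i j) x).

(* The d_l component of R(d_i, d_j) d_k, where
   R(X, Y) Z = nabla_X nabla_Y Z - nabla_Y nabla_X Z - nabla_[X, Y] Z. *)
Definition riemann_endo g i j k l x : R :=
  partial i (christoffel g l j k) x - partial j (christoffel g l i k) x
  + \sum_m (christoffel g l i m x * christoffel g m j k x
            - christoffel g l j m x * christoffel g m i k x).

(* R(d_a /\ d_b, d_c /\ d_d) = g(R(d_a, d_b) d_d, d_c): with this sign the
   curvature operator of the unit sphere is the identity. *)
Definition curvature g x a b c d : R :=
  \sum_l g x l c * riemann_endo g a b d l x.

Definition ricci g x b d : R :=
  \sum_a \sum_c invmx (g x) a c * curvature g x a b c d.

Definition scal g x : R := \sum_b \sum_d invmx (g x) b d * ricci g x b d.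

Definition kulkarni_nomizu (h k : 'M[R]_n) a b c d : R :=
  h a c * k b d + h b d * k a c - h a d * k b c - h b c * k a d.

Definition riem_form (t : R) g x a b c d : R :=
  scal g x * (kulkarni_nomizu (g x) (g x) a b c d / 2)
  - 2 * t * curvature g x a b c d.

(* A skew-symmetric matrix w stands for the bivector
   sum_(a < b) w_ab e_a /\ e_b = 1/2 sum_(a, b) w_ab e_a /\ e_b, and
   A a b c d for the value A(e_a /\ e_b, e_c /\ e_d) of a bilinear form. *)
Definition bivector_eval (A : 'I_n -> 'I_n -> 'I_n -> 'I_n -> R)
    (w w' : 'M[R]_n) : R :=
  4^-1 * \sum_a \sum_b \sum_c \sum_d A a b c d * w a b * w' c d.

Definition bivector_posdef (A : 'I_n -> 'I_n -> 'I_n -> 'I_n -> R) : Prop :=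
  forall w : 'M[R]_n, w^T = - w -> w != 0 -> 0 < bivector_eval A w w.

End local_curvature.

Section invariants.
Variables (R : realType) (n : nat) (M : closedManifold R n).

Definition scal_pos (g : riemannianMetric M) : Prop :=
  forall i x, chart_img (mfd_chart i) x -> 0 < scal (metric_mx g i) x.

Definition riem_t_pos (t : R) (g : riemannianMetric M) : Prop :=
  forall i x, chart_img (mfd_chart i) x ->
    bivector_posdef (riem_form t (metric_mx g i) x).

(* [sup] is a genuine supremum here and in [Riem]: when scal_pos g holds the set
   of t is nonempty by compactness of M, and every riem_metric g lies in
   [0, n(n-1)/2]. *)
Definition riem_metric (g : riemannianMetric M) : R :=
  if `[< scal_pos g >] then
    sup [set t | 0 < t < n%:R * (n%:R - 1) / 2 /\ riem_t_pos t g]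
  else 0.

Definition Riem : R := sup [set riem_metric g | g in [set: riemannianMetric M]].

End invariants.

Section smoothness_facts.
Variable R : realType.

Lemma near_eq_differentiable (V W : normedModType R) (f g : V -> W) (x : V) :
  {near x, f =1 g} -> differentiable f x -> differentiable g x.
Proof.
move=> fg df; have [dfc dfx] := (diff_locallyP _ _).1 df.
have dgx : g \o shift x = cst (g x) + 'd f x +o_ 0 id.
  apply/eqaddoP => _/posnumP[e].
  have /eqaddoP/(_ e%:num)/(_ [gt0 of e%:num]) := dfx.
  have fg0 : \forall h \near 0, f (h + x) = g (h + x).
    by move: fg; rewrite [X in X -> _](near_shift 0 x) subr0.
  apply: filter_app; near=> h.
  have fgh : f (h + x) = g (h + x) by near: h.
  have fgx : f x = g x := nbhs_singleton fg.
  by rewrite /= !fctE /= fgh fgx.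
have dE := diff_unique dfc dgx.
by apply/diff_locallyP; split; rewrite dE.
Unshelve. all: by end_near. Qed.

Lemma derive_comp_diff (U V W : normedModType R) (f : U -> V) (h : V -> W)
    (x v : U) : differentiable f x -> differentiable h (f x) ->
  'D_v (h \o f) x = 'd h (f x) ('D_v f x).
Proof.
move=> df dh; rewrite (deriveE _ df).
transitivity ('d (h \o f) x v).
  by apply: deriveE; exact: differentiable_comp.
exact: (congr1 (@^~ v) (diff_comp df dh)).
Qed.

Lemma Ck_on_ext (m : nat) (W : normedModType R) (k : nat)
    (U : set 'rV[R]_m) (f g : 'rV[R]_m -> W) :
  open U -> (forall x, U x -> f x = g x) -> Ck_on k U f -> Ck_on k U g.
Proof.
move=> oU; elim: k f g => [|k IHk] f g fg /=.
  move=> fC x Ux; rewrite /prop_for /continuous_at -(fg x)//.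
  apply: cvg_trans (fC x Ux); apply: (@near_eq_cvg _ _ (nbhs x)).
  by near=> y; apply: fg; near: y; exact: open_nbhs_nbhs.
have nfg x : U x -> {near x, f =1 g}.
  by move=> Ux; near=> y; apply: fg; near: y; exact: open_nbhs_nbhs.
move=> [fD fC]; split=> [x Ux|v].
  exact: near_eq_differentiable (nfg x Ux) (fD x Ux).
apply: IHk (fC v) => x Ux; exact: near_eq_derive (nfg x Ux).
Unshelve. all: by end_near. Qed.

Variables n1 n2 : nat.

Lemma continuous_row_mx (T : topologicalType) (f : T -> 'rV[R]_n1)
    (g : T -> 'rV[R]_n2) (x : T) :
  {for x, continuous f} -> {for x, continuous g} ->
  {for x, continuous (fun y => row_mx (f y) (g y))}.
Proof.
move=> fx gx A /nbhs_ballP[e /= e0 eA].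
have := fx _ (nbhsx_ballx (f x) e e0); have := gx _ (nbhsx_ballx (g x) e e0).
rewrite /= /nbhs /=; apply: filterS2 => y [_ gy] [_ fy]; apply: eA; split=> // i j.
by rewrite !mxE; case: split_ordP.
Qed.

Lemma open_rowset (m1 m2 : nat) (U1 : set 'rV[R]_m1) (U2 : set 'rV[R]_m2) :
  open U1 -> open U2 ->
  open [set z : 'rV[R]_(m1 + m2) | U1 (lsubmx z) /\ U2 (rsubmx z)].
Proof.
move=> o1 o2; apply: (@openI _ (lsubmx @^-1` U1) (rsubmx @^-1` U2)).
  by apply: open_comp o1 => z _; exact: continuous_lsubmx.
by apply: open_comp o2 => z _; exact: continuous_rsubmx.
Qed.

Lemma differentiable_row_mx (V : normedModType R) (f : V -> 'rV[R]_n1)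
    (g : V -> 'rV[R]_n2) (x : V) :
  differentiable f x -> differentiable g x ->
  differentiable (fun y => row_mx (f y) (g y)) x /\
  forall v, 'D_v (fun y => row_mx (f y) (g y)) x = row_mx ('D_v f x) ('D_v g x).
Proof.
move=> df dg.
pose L1 : {linear 'rV[R]_n1 -> 'rV[R]_(n1 + n2)} :=
  [the {linear _ -> _} of mulmxr (row_mx 1%:M 0)].
pose L2 : {linear 'rV[R]_n2 -> 'rV[R]_(n1 + n2)} :=
  [the {linear _ -> _} of mulmxr (row_mx 0 1%:M)].
have L1E u : L1 u = row_mx u 0 by rewrite /L1 /= mul_mx_row mulmx1 mulmx0.
have L2E u : L2 u = row_mx 0 u by rewrite /L2 /= mul_mx_row mulmx1 mulmx0.
have L1c : continuous L1.
  move=> u; rewrite (_ : (L1 : _ -> _) = fun y => row_mx (id y) (cst 0 y)).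
    apply: continuous_row_mx; [exact: cvg_id|exact: cst_continuous].
  by apply/funext => y; rewrite L1E.
have L2c : continuous L2.
  move=> u; rewrite (_ : (L2 : _ -> _) = fun y => row_mx (cst 0 y) (id y)).
    apply: continuous_row_mx; [exact: cst_continuous|exact: cvg_id].
  by apply/funext => y; rewrite L2E.
have -> : (fun y => row_mx (f y) (g y)) = (L1 \o f) + (L2 \o g).
  by apply/funext => y; transitivity (L1 (f y) + L2 (g y)) => //; rewrite L1E L2E add_row_mx addr0 add0r.
have dL1 u : differentiable L1 u by apply: linear_differentiable.
have dL2 u : differentiable L2 u by apply: linear_differentiable.
have dLf : differentiable (L1 \o f) x by apply: differentiable_comp.
have dLg : differentiable (L2 \o g) x by apply: differentiable_comp.
split=> [|v]; first exact: differentiableD.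
have D1 : 'D_v (L1 \o f) x = L1 ('D_v f x).
  rewrite (derive_comp_diff v df (dL1 (f x))).
  by rewrite (diff_lin _ L1c).
have D2 : 'D_v (L2 \o g) x = L2 ('D_v g x).
  rewrite (derive_comp_diff v dg (dL2 (g x))).
  by rewrite (diff_lin _ L2c).
transitivity ('D_v (L1 \o f) x + 'D_v (L2 \o g) x).
  by apply: deriveD; exact: diff_derivable.
by rewrite D1 D2 L1E L2E add_row_mx addr0 add0r.
Qed.

Lemma derive_lsubmx (m1 m2 : nat) (x v : 'rV[R]_(m1 + m2)) : 'D_v lsubmx x = lsubmx v.
Proof.
rewrite deriveE; last exact: differentiable_lsubmx.
by rewrite (diff_lin _ (@continuous_lsubmx _ _ _ _)).
Qed.

Lemma derive_rsubmx (m1 m2 : nat) (x v : 'rV[R]_(m1 + m2)) : 'D_v rsubmx x = rsubmx v.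
Proof.
rewrite deriveE; last exact: differentiable_rsubmx.
by rewrite (diff_lin _ (@continuous_rsubmx _ _ _ _)).
Qed.

Lemma Ck_on_row_mx (m1 m2 k : nat) (U1 : set 'rV[R]_m1) (U2 : set 'rV[R]_m2)
    (f1 : 'rV[R]_m1 -> 'rV[R]_n1) (f2 : 'rV[R]_m2 -> 'rV[R]_n2) :
  open U1 -> open U2 -> Ck_on k U1 f1 -> Ck_on k U2 f2 ->
  Ck_on k [set z : 'rV[R]_(m1 + m2) | U1 (lsubmx z) /\ U2 (rsubmx z)]
    (fun z => row_mx (f1 (lsubmx z)) (f2 (rsubmx z))).
Proof.
move=> o1 o2; elim: k f1 f2 => [|k IHk] f1 f2 /=.
  move=> c1 c2 x [U1x U2x]; apply: continuous_row_mx.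
    exact: continuous_comp (@continuous_lsubmx _ _ _ _ x) (c1 _ U1x).
  exact: continuous_comp (@continuous_rsubmx _ _ _ _ x) (c2 _ U2x).
move=> [d1 c1] [d2 c2].
have dl (x : 'rV[R]_(m1 + m2)) : U1 (lsubmx x) -> differentiable (f1 \o lsubmx) x.
  by move=> U1x; apply: differentiable_comp; [exact: differentiable_lsubmx|exact: d1].
have dr (x : 'rV[R]_(m1 + m2)) : U2 (rsubmx x) -> differentiable (f2 \o rsubmx) x.
  by move=> U2x; apply: differentiable_comp; [exact: differentiable_rsubmx|exact: d2].
split=> [x [U1x U2x]|v]; first exact: (differentiable_row_mx (dl x U1x) (dr x U2x)).1.
apply: Ck_on_ext (IHk _ _ (c1 (lsubmx v)) (c2 (rsubmx v))); first exact: open_rowset.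
move=> x [U1x U2x]; rewrite (differentiable_row_mx (dl x U1x) (dr x U2x)).2.
apply: (f_equal2 (@row_mx R 1 n1 n2)).
  rewrite (derive_comp_diff v (differentiable_lsubmx x) (d1 _ U1x)).
  by rewrite -deriveE ?derive_lsubmx//; exact: d1.
rewrite (derive_comp_diff v (differentiable_rsubmx x) (d2 _ U2x)).
by rewrite -deriveE ?derive_rsubmx//; exact: d2.
Qed.

End smoothness_facts.

Lemma continuous_pair (S T U : topologicalType) (f : S -> T) (g : S -> U) (x : S) :
  {for x, continuous f} -> {for x, continuous g} ->
  {for x, continuous (fun y => (f y, g y))}.
Proof. by move=> fx gx; apply: cvg_pair. Qed.

Lemma continuous_fst (T U : topologicalType) : continuous (@fst T U).
Proof. by move=> p; exact: cvg_fst. Qed.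

Lemma continuous_snd (T U : topologicalType) : continuous (@snd T U).
Proof. by move=> p; exact: cvg_snd. Qed.

Lemma hausdorff_prod (T U : topologicalType) :
  hausdorff_space T -> hausdorff_space U -> hausdorff_space (T * U)%type.
Proof.
move=> hT hU [p1 p2] [q1 q2] pq; congr (_, _).
  apply: hT => A B pA qB.
  have [[z1 z2] [/= Az Bz]] := pq (fst @^-1` A) (fst @^-1` B)
    (@continuous_fst T U (p1, p2) A pA) (@continuous_fst T U (q1, q2) B qB).
  by exists z1.
apply: hU => A B pA qB.
have [[z1 z2] [/= Az Bz]] := pq (snd @^-1` A) (snd @^-1` B)
  (@continuous_snd T U (p1, p2) A pA) (@continuous_snd T U (q1, q2) B qB).
by exists z2.
Qed.

Lemma connected_prod (T U : topologicalType) :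
  connected [set: T] -> connected [set: U] -> connected [set: T * U].
Proof.
move=> cT cU.
have [[[t0 u0] _]|/set0P/negP] := pselect ([set: T * U] !=set0); last first.
  by rewrite negbK => /eqP ->; exact: connected0.
have im (S : topologicalType) (f : S -> (T * U)%type) :
    connected [set: S] -> continuous f -> connected (range f).
  move=> cS cf; apply: connected_continuous_connected => //.
  exact: continuous_subspaceT.
pose cross u := range (fun t : T => (t, u)) `|` range (fun u' : U => (t0, u')).
have -> : [set: T * U] = \bigcup_(u in [set: U]) cross u.
  by apply/seteqP; split=> // -[t u] _; exists u => //; left; exists t.
apply: bigcup_connected.
  by exists (t0, u0) => u _; right; exists u0.
move=> u _; apply: connectedU.
- by exists (t0, u); split; [exists t0|exists u].
- by apply: im => // t; apply: continuous_pair; [exact: cvg_id|exact: cst_continuous].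
- by apply: im => // u'; apply: continuous_pair; [exact: cst_continuous|exact: cvg_id].
Qed.

Section product_manifold.
Variables (R : realType) (n1 n2 : nat).

Section product_chart.
Variables (T1 T2 : topologicalType) (c1 : chart R n1 T1) (c2 : chart R n2 T2).

Let pdom : set (T1 * T2) := chart_dom c1 `*` chart_dom c2.
Let pmap (p : T1 * T2) : 'rV[R]_(n1 + n2) :=
  row_mx (chart_map c1 p.1) (chart_map c2 p.2).
Let pinv (z : 'rV[R]_(n1 + n2)) : T1 * T2 :=
  (chart_inv c1 (lsubmx z), chart_inv c2 (rsubmx z)).

Let pimgE : pmap @` pdom =
  [set z | chart_img c1 (lsubmx z) /\ chart_img c2 (rsubmx z)].
Proof.
apply/seteqP; split=> [_ [[p q] [/= dp dq] <-]|z /= [[p dp pz] [q dq qz]]].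
  by rewrite /= row_mxKl row_mxKr; split; [exists p|exists q].
by exists (p, q) => //; rewrite /pmap /= pz qz hsubmxK.
Qed.

Let pdom_open : open pdom.
Proof.
apply: (@openI _ (fst @^-1` chart_dom c1) (snd @^-1` chart_dom c2)).
  by apply: open_comp => [p _|]; [exact: continuous_fst|exact: chart_dom_open].
by apply: open_comp => [p _|]; [exact: continuous_snd|exact: chart_dom_open].
Qed.

Let pimg_open : open (pmap @` pdom).
Proof.
rewrite pimgE.
by apply: open_rowset; exact: chart_img_open.
Qed.

Let pmapK p : pdom p -> pinv (pmap p) = p.
Proof.
by case: p => p q [/= dp dq]; rewrite /pinv row_mxKl row_mxKr !chart_mapK.
Qed.

Let pmap_continuous p : pdom p -> {for p, continuous pmap}.
Proof.
move=> [dp dq]; apply: continuous_row_mx.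
  exact: continuous_comp (@continuous_fst _ _ p) (chart_map_continuous dp).
exact: continuous_comp (@continuous_snd _ _ p) (chart_map_continuous dq).
Qed.

Let pinv_continuous z : (pmap @` pdom) z -> {for z, continuous pinv}.
Proof.
rewrite pimgE => -[z1 z2]; apply: continuous_pair.
  exact: continuous_comp (@continuous_lsubmx _ _ _ _ z) (chart_inv_continuous z1).
exact: continuous_comp (@continuous_rsubmx _ _ _ _ z) (chart_inv_continuous z2).
Qed.

Definition product_chart : chart R (n1 + n2) (T1 * T2)%type :=
  Chart pdom_open pimg_open pmapK pmap_continuous pinv_continuous.

Lemma product_chart_imgE : chart_img product_chart =
  [set z | chart_img c1 (lsubmx z) /\ chart_img c2 (rsubmx z)].
Proof. exact: pimgE. Qed.

End product_chart.

Lemma overlap_open (n : nat) (T : topologicalType) (c c' : chart R n T) :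
  open (overlap c c').
Proof.
rewrite openE => x [cx c'x].
have ox : nbhs x (chart_img c).
  by apply: open_nbhs_nbhs; split=> //; exact: chart_img_open.
have o'x : nbhs x (chart_inv c @^-1` chart_dom c').
  apply: (chart_inv_continuous cx).
  by apply: open_nbhs_nbhs; split=> //; exact: chart_dom_open.
exact: filterI ox o'x.
Qed.

Lemma product_overlapE (T1 T2 : topologicalType)
    (c1 c1' : chart R n1 T1) (c2 c2' : chart R n2 T2) :
  overlap (product_chart c1 c2) (product_chart c1' c2') =
  [set z | overlap c1 c1' (lsubmx z) /\ overlap c2 c2' (rsubmx z)].
Proof.
rewrite /overlap product_chart_imgE.
by apply/seteqP; split=> z /= [[? ?] [? ?]].
Qed.

Variables (M1 : closedManifold R n1) (M2 : closedManifold R n2).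

Let pchart (i : mfd_index M1 * mfd_index M2) :=
  product_chart (mfd_chart i.1) (mfd_chart i.2).

Let pcover (p : (M1 * M2)%type) : exists i, chart_dom (pchart i) p.
Proof.
have [i di] := mfd_cover p.1; have [j dj] := mfd_cover p.2.
by exists (i, j).
Qed.

Let psmooth i j :
  smooth_on (overlap (pchart i) (pchart j)) (transition (pchart i) (pchart j)).
Proof.
move=> k; rewrite product_overlapE.
apply: (Ck_on_row_mx _ _ (mfd_smooth i.1 j.1 k) (mfd_smooth i.2 j.2 k));
  exact: overlap_open.
Qed.

Let pcompact : compact [set: (M1 * M2)%type].
Proof. by rewrite -setXTT; apply: compact_setX; exact: mfd_compact. Qed.

Let pnonempty : [set: (M1 * M2)%type] !=set0.
Proof.
have [p _] := mfd_nonempty M1; have [q _] := mfd_nonempty M2.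
by exists (p, q).
Qed.

(* The product manifold, with the product topology and the atlas of all products
   of a chart of M1 and a chart of M2. *)
Definition product_manifold : closedManifold R (n1 + n2) :=
  ClosedManifold pcover psmooth
    (hausdorff_prod (mfd_hausdorff (c := M1)) (mfd_hausdorff (c := M2)))
    pcompact
    (connected_prod (mfd_connected (c := M1)) (mfd_connected (c := M2)))
    pnonempty.

End product_manifold.

(* Main.v *)
Require Import Defs.
From mathcomp Require Import all_boot all_order all_algebra.
From mathcomp Require Import all_classical all_reals all_analysis.
From mathcomp Require Import ring lra.
Set Implicit Arguments.
Unset Strict Implicit.
Unset Printing Implicit Defensive.
Import Order.TTheory GRing.Theory Num.Theory.
Import numFieldNormedType.Exports.
Local Open Scope classical_set_scope.
Local Open Scope ring_scope.

(* Let g1 be a metric on M1 with Scal > 0 and Riem_t(g1) > 0, let 0 < t' < t, and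
   let g2 be any metric on M2.  On g1 (+) s g2 the curvature operator is block
   diagonal, vanishes on mixed bivectors, and Scal = Scal(g1) + Scal(g2) / s.  Since
   Riem_t'(g1) = (t'/t) Riem_t(g1) + (1 - t'/t) Scal(g1) g1^2/2, the uniform bounds
   Scal(g1) >= c > 0, |Scal(g2)| <= C and |R(g2)| <= C g2^2/2 given by compactness
   make Riem_t'(g1 (+) s g2) positive as soon as s is large.  Hence Riem of the
   product is at least t'.

   As the charts of an atlas are arbitrary, the uniform bounds need the curvature
   to be a tensor; this is obtained from the transformation rule of the connection
   matrices, itself a consequence of the uniqueness of the Levi-Civita connection.
   The metric g2 is a finite sum of bump functions times pulled back flat metrics. *)

(** * Calculus of C^k functions *)

(** Positivity of Riem_t(g1) is used only pointwise: the uniform gain is the explicit term (1 -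
    t'/t) Scal(g1), so only Scal(g1), Scal(g2) and R(g2) need uniform bounds, and no least
    eigenvalue of Riem_t(g1) has to be controlled. Nothing is lost in passing to t' < t, since Riem
    is a supremum. A large s tames the second factor because, as forms on bivectors, R(s g2) = s
    R(g2) whereas (s g2)^2/2 = s^2 g2^2/2: relative to the norm, the curvature of that factor weighs
    1/s while Scal(g1) stays fixed. Curvature is handled through the matrices of the connection and
    of the endomorphisms R(d_i, d_j). There the metric enters only through torsion-freeness and
    compatibility, so the connections of a pulled back, a product and a rescaled metric are each
    found by checking a guess, without expanding Christoffel symbols. Default values matter as well:
    the supremum of an empty set and the invariant of a metric without Scal > 0 are both 0, so each
    upper bound must be known to be nonnegative. The existence of a metric on the product provides
    this. *)

Section pointwise_calculus.
Variables (R : realType) (V : normedModType R).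
Implicit Types (f g : V -> R) (x v : V).

Lemma deriveD_fun f g x v : differentiable f x -> differentiable g x ->
  'D_v (fun y => f y + g y) x = 'D_v f x + 'D_v g x.
Proof. by move=> df dg; apply: (@deriveD R V R f g); exact: diff_derivable. Qed.

Lemma deriveM_fun f g x v : differentiable f x -> differentiable g x ->
  'D_v (fun y => f y * g y) x = 'D_v f x * g x + f x * 'D_v g x.
Proof.
move=> df dg.
transitivity (f x *: 'D_v g x + g x *: 'D_v f x).
  by apply: (@deriveM R V f g); exact: diff_derivable.
by rewrite addrC mulrC.
Qed.

Lemma deriveV_fun f x v : f x != 0 -> differentiable f x ->
  'D_v (fun y => (f y)^-1) x = - ((f x)^-1 * (f x)^-1 * 'D_v f x).
Proof.
move=> f0 df; rewrite deriveV//; last exact: diff_derivable.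
by rewrite /GRing.scale/= mulNr expr2 invfM.
Qed.

Lemma derive_sum_fun (I : Type) (r : seq I) (F : I -> V -> R) x v :
  (forall i, differentiable (F i) x) ->
  differentiable (fun y => \sum_(i <- r) F i y) x /\
  'D_v (fun y => \sum_(i <- r) F i y) x = \sum_(i <- r) 'D_v (F i) x.
Proof.
move=> dF; elim: r => [|i r [d e]].
  rewrite big_nil (_ : (fun _ => _) = cst 0); last first.
    by apply/funext => y; rewrite big_nil.
  by rewrite derive_cst.
rewrite big_cons (_ : (fun _ => _) = fun y => F i y + \sum_(i <- r) F i y).
  by rewrite deriveD_fun// e; split=> //; apply: differentiableD.
by apply/funext => y; rewrite big_cons.
Qed.

End pointwise_calculus.

Lemma differentiable_mxP (R : realType) (V : normedModType R) m n (F : V -> 'M[R]_(m, n)) x :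
  (forall i j, differentiable (fun y => F y i j) x) -> differentiable F x.
Proof.
move=> dF.
rewrite (_ : F = \sum_i \sum_j fun y => F y i j *: delta_mx i j).
  by apply: differentiable_sum => i; apply: differentiable_sum => j; apply: differentiableZl.
apply/funext => y; rewrite fct_sumE; under eq_bigr do rewrite fct_sumE.
exact: matrix_sum_delta.
Qed.

Lemma differentiable_mx_coord (R : realType) (V : normedModType R) m n
    (F : V -> 'M[R]_(m, n)) x i j :
  differentiable F x -> differentiable (fun y => F y i j) x.
Proof.
move=> dF; apply: (@differentiable_comp _ _ _ _ F (fun N : 'M[R]_(m,n) => N i j : R)) => //.
exact: differentiable_coord.
Qed.

Lemma derive_mx_coord (R : realType) (V : normedModType R) m n (F : V -> 'M[R]_(m, n)) x v i j :
  differentiable F x -> ('D_v F x) i j = 'D_v (fun y => F y i j) x.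
Proof. by move=> dF; rewrite derive_mx ?mxE//; exact: diff_derivable. Qed.

Section Ck.
Variables (R : realType) (m : nat).
Implicit Types (U V : set 'rV[R]_m) (f g : 'rV[R]_m -> R).

Lemma Ck_on_sub (W : normedModType R) k U V (f : 'rV[R]_m -> W) :
  V `<=` U -> Ck_on k U f -> Ck_on k V f.
Proof.
move=> VU; elim: k f => [|k IHk] f /=; first by move=> cf x /VU; exact: cf.
by move=> [df cf]; split=> [x /VU|v]; [exact: df|exact/IHk].
Qed.

(** Every condition in [Ck_on] is local at single points, so it may be checked on singletons. This
    allows a different open neighbourhood, and a different local formula, at each point. *)
Lemma Ck_on_cover (W : normedModType R) k U (f : 'rV[R]_m -> W) :
  (forall x, U x -> Ck_on k [set x] f) -> Ck_on k U f.
Proof.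
elim: k f => [|k IHk] f /= cf; first by move=> x /cf; exact.
split=> [x /cf[+ _]|v]; first exact.
by apply: IHk => x /cf[_].
Qed.

Lemma Ck_onW (W : normedModType R) k U (f : 'rV[R]_m -> W) :
  Ck_on k.+1 U f -> Ck_on k U f.
Proof.
elim: k f => [|k IHk] f /=.
  by move=> [df _] x Ux; apply: differentiable_continuous; exact: df.
by move=> [df cf]; split=> // v; exact/IHk/cf.
Qed.

Lemma Ck_on_cst (W : normedModType R) k U (c : W) :
  Ck_on k U (fun _ : 'rV[R]_m => c).
Proof.
elim: k c => [|k IHk] c /=; first by move=> x Ux; exact: cst_continuous.
split=> [x Ux|v]; first exact: differentiable_cst.
have -> : (fun x => 'D_v (fun=> c) x) = fun=> 0.
  by apply/funext => x; exact: derive_cst.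
exact: IHk.
Qed.

Lemma Ck_onD k U f g : open U -> Ck_on k U f -> Ck_on k U g ->
  Ck_on k U (fun x => f x + g x).
Proof.
move=> oU; elim: k f g => [|k IHk] f g /=.
  move=> cf cg x Ux.
  exact: (@continuousD _ R _ f g x (cf x Ux) (cg x Ux)).
move=> [df cf] [dg cg]; split=> [x Ux|v].
  by apply: differentiableD; [exact: df|exact: dg].
apply: Ck_on_ext oU _ (IHk _ _ (cf v) (cg v)) => x Ux.
by rewrite deriveD_fun//; [exact: df|exact: dg].
Qed.

Lemma Ck_onM k U f g : open U -> Ck_on k U f -> Ck_on k U g ->
  Ck_on k U (fun x => f x * g x).
Proof.
move=> oU; elim: k f g => [|k IHk] f g.
  move=> cf cg x Ux.
  exact: (@continuousM _ _ f g x (cf x Ux) (cg x Ux)).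
move=> cf' cg'; move: (cf') (cg') => /= [df cf] [dg cg]; split=> [x Ux|v].
  by apply: differentiableM; [exact: df|exact: dg].
apply: (@Ck_on_ext _ _ _ _ _ (fun x => 'D_v f x * g x + f x * 'D_v g x)) => // [x Ux|].
  by rewrite deriveM_fun//; [exact: df|exact: dg].
by apply: Ck_onD => //; apply: IHk => //; exact: Ck_onW.
Qed.

Lemma Ck_onN k U f : open U -> Ck_on k U f -> Ck_on k U (fun x => - f x).
Proof.
move=> oU cf; have := Ck_onM oU (Ck_on_cst k U (-1 : R)) cf.
by apply: Ck_on_ext => // x _; rewrite mulN1r.
Qed.

Lemma Ck_onV k U f : open U -> (forall x, U x -> f x != 0) ->
  Ck_on k U f -> Ck_on k U (fun x => (f x)^-1).
Proof.
move=> oU f0; elim: k => [|k IHk].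
  move=> cf x Ux.
  exact: (@continuousV _ _ f x (f0 x Ux) (cf x Ux)).
move=> cf'; move: (cf') => /= [df cf]; split=> [x Ux|v].
  by apply: differentiableV; [exact: df|exact: f0].
apply: (@Ck_on_ext _ _ _ _ _ (fun x => - ((f x)^-1 * (f x)^-1 * 'D_v f x))) => // [x Ux|].
  by rewrite deriveV_fun//; [exact: f0|exact: df].
have ck := IHk (Ck_onW cf').
by apply: Ck_onN => //; do 2?apply: Ck_onM => //.
Qed.

Lemma Ck_on_sum k U (I : Type) (r : seq I) (P : pred I) (F : I -> 'rV[R]_m -> R) :
  open U -> (forall i, P i -> Ck_on k U (F i)) ->
  Ck_on k U (fun x => \sum_(i <- r | P i) F i x).
Proof.
move=> oU cF; elim: r => [|i r IH].
  by apply: Ck_on_ext oU _ (Ck_on_cst _ _ (0 : R)) => x _; rewrite big_nil.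
have [Pi|Pi] := boolP (P i); last first.
  by apply: Ck_on_ext oU _ IH => x _; rewrite big_cons (negbTE Pi).
by apply: Ck_on_ext oU _ (Ck_onD oU (cF _ Pi) IH) => x _; rewrite big_cons Pi.
Qed.

Lemma Ck_on_prod k U (I : Type) (r : seq I) (F : I -> 'rV[R]_m -> R) :
  open U -> (forall i, Ck_on k U (F i)) ->
  Ck_on k U (fun x => \prod_(i <- r) F i x).
Proof.
move=> oU cF; elim: r => [|i r IH].
  by apply: Ck_on_ext oU _ (Ck_on_cst _ _ (1 : R)) => x _; rewrite big_nil.
by apply: Ck_on_ext oU _ (Ck_onM oU (cF _) IH) => x _; rewrite big_cons.
Qed.

Lemma Ck_on_mxP k U p q (F : 'rV[R]_m -> 'M[R]_(p, q)) : open U ->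
  Ck_on k U F <-> forall i j, Ck_on k U (fun x => F x i j).
Proof.
move=> oU; elim: k F => [|k IHk] F /=.
  split=> [cF i j x Ux|cF x Ux].
    have cij : {for F x, continuous (fun N : 'M[R]_(p, q) => N i j)}.
      exact: coord_continuous.
    have h := continuous_comp (cF x Ux) cij.
    exact: h.
  move=> A /nbhs_ballP[e /= e0 eA].
  suff : \forall y \near x, forall i j, ball (F x i j) e (F y i j).
    by apply: filterS => y yb; apply: eA; split.
  have nF : Filter (nbhs x) by exact: nbhs_filter.
  apply: (@filter_forall _ _ (fun i y => forall j, ball (F x i j) e (F y i j)) _ nF) => i.
  apply: (@filter_forall _ _ (fun j y => ball (F x i j) e (F y i j)) _ nF) => j.
  exact: (cF i j x Ux _ (nbhsx_ballx (F x i j) e e0)).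
split=> [[dF cF] i j|cF].
  split=> [x Ux|v]; first exact/differentiable_mx_coord/dF.
  apply: Ck_on_ext oU _ ((IHk _).1 (cF v) i j) => x Ux.
  by rewrite derive_mx_coord//; exact: dF.
have dF x : U x -> differentiable F x.
  by move=> Ux; apply: differentiable_mxP => i j; exact: (cF i j).1.
split=> // v; apply/IHk => i j.
apply: Ck_on_ext oU _ ((cF i j).2 v) => x Ux.
by rewrite derive_mx_coord//; exact: dF.
Qed.

(* A whole family closed under differentiation is composed with f, so that the
   induction on k needs no closed form for the derivatives of h 0. *)
Lemma Ck_on_comp_family k U f (h : nat -> R -> R) (c : nat -> R) : open U ->
  (forall n y, is_derive (y : R) (1 : R) (h n) (h n.+2 y + c n * h n.+1 y)) ->
  Ck_on k U f -> forall n, Ck_on k U (fun x => h n (f x)).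
Proof.
move=> oU dh cf n.
have dh' j y : differentiable (h j : R -> R) y.
  by apply/derivable1_diffP; have [] := dh j y.
elim: k cf n => [|k IHk] cf n.
  move=> x Ux; apply: (@continuous_comp _ _ _ f (h n) x (cf x Ux)).
  exact: differentiable_continuous.
move: (cf) => /= [df cdf]; split=> [x Ux|v].
  exact: (@differentiable_comp _ _ _ _ f (h n) x (df _ Ux) (dh' n _)).
apply: (@Ck_on_ext _ _ _ _ _
  (fun x => (h n.+2 (f x) + c n * h n.+1 (f x)) * 'D_v f x)) => // [x Ux|].
  rewrite [RHS](@derive_comp_diff _ _ _ _ f (h n) x v (df _ Ux) (dh' n _)).
  rewrite diff1E// derive1E.
  by have [_ ->] := dh n (f x); rewrite mulrC.
have ck := IHk (Ck_onW cf).
by do ?[apply: Ck_onM => //|apply: Ck_onD => //]; exact: Ck_on_cst.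
Qed.

End Ck.

(** * Symmetry of second derivatives *)

Section schwarz.
Variables (R : realType) (m : nat).
Implicit Types (f : 'rV[R]_m -> R) (x u v : 'rV[R]_m).

Lemma mean_value_dir f x v h : 0 < h ->
  (forall s, 0 <= s <= h -> differentiable f (s *: v + x)) ->
  exists2 c, 0 <= c <= h & f (h *: v + x) - f x = h * 'D_v f (c *: v + x).
Proof.
move=> h0 df.
pose p (s : R) : R := f (s *: v + x).
have dp s : 0 <= s <= h -> is_derive s (1 : R) p ('D_v f (s *: v + x)).
  move=> sh.
  (* The difference quotients of [p] in t and of [f] in direction [v] are the same function, so the
     derivative of [p] needs no chain rule. *)
  have E : (fun t : R => t^-1 *: ((p \o shift s) (t *: (1 : R)) - p s)) =
    (fun t => t^-1 *: ((f \o shift (s *: v + x)) (t *: v) - f (s *: v + x))).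
    apply/funext => t; rewrite /p /=; congr (_ *: (f _ - _)).
    by rewrite addrA -scalerDl [t *: (1 : R)]mulr1.
  have dv : derivable f (s *: v + x) v by apply: diff_derivable; exact: df.
  by apply: DeriveDef; rewrite /derivable /derive E.
have [|||c ch e] := @MVT_segment R p (fun s => 'D_v f (s *: v + x)) 0 h.
- exact: ltW.
- by move=> s /[!in_itv]/= /andP[s0 sh]; apply: dp; rewrite !ltW.
- apply: (@derivable_within_continuous R R p `[0, h]%R) => s /[!in_itv]/= sh.
  by have [] := dp s sh.
exists c; first by rewrite in_itv in ch.
by move: e; rewrite /p scale0r add0r subr0 mulrC.
Qed.

Lemma derive_translate f x v w :
  'D_v (fun y => f (w + y)) x = 'D_v f (w + x).
Proof.
rewrite /derive.
have -> : (fun t : R => t^-1 *: (((fun y => f (w + y)) \o shift x) (t *: v) - f (w + x)))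
  = (fun t => t^-1 *: ((f \o shift (w + x)) (t *: v) - f (w + x))).
  by apply/funext => t /=; rewrite addrCA.
by [].
Qed.

Lemma differentiable_translate f x w :
  differentiable f (w + x) -> differentiable (fun y => f (w + y)) x.
Proof.
by move=> df; apply: (@differentiable_comp _ _ _ _ (fun y => w + y) f).
Qed.

(** The mean value theorem is applied along u to [p], the increment of f in direction v, and then
    along v to the derivative of f in direction u. The second difference is symmetric in u and v, so
    exchanging them expresses it through the other mixed derivative. *)
Lemma second_difference f x u v h : 0 < h ->
  (forall s t, 0 <= s <= h -> 0 <= t <= h ->
    differentiable f (s *: u + (t *: v + x)) /\
    differentiable ('D_u f) (s *: u + (t *: v + x))) ->
  exists c d, [/\ 0 <= c <= h, 0 <= d <= h &
   f (h *: u + (h *: v + x)) - f (h *: u + x) - f (h *: v + x) + f x =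
   h * (h * 'D_v ('D_u f) (c *: u + (d *: v + x)))].
Proof.
move=> h0 df.
have hh : 0 <= h <= h by rewrite lexx ltW.
have h00 : 0 <= (0 : R) <= h by rewrite lexx ltW.
pose p y := f (h *: v + y) - f y.
have dtr s : 0 <= s <= h -> differentiable (fun y => f (h *: v + y)) (s *: u + x).
  move=> sh; apply: differentiable_translate.
  by rewrite addrCA; exact: (df s h sh hh).1.
have df0 s : 0 <= s <= h -> differentiable f (s *: u + x).
  by move=> sh; have := (df s 0 sh h00).1; rewrite scale0r add0r.
have [c ch pE] : exists2 c, 0 <= c <= h &
    p (h *: u + x) - p x = h * 'D_u p (c *: u + x).
  apply: (@mean_value_dir p x u h h0) => s sh.
  by apply: differentiableB; [exact: dtr|exact: df0].
have [d dh qE] : exists2 d, 0 <= d <= h &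
    'D_u f (h *: v + (c *: u + x)) - 'D_u f (c *: u + x) =
    h * 'D_v ('D_u f) (d *: v + (c *: u + x)).
  apply: (@mean_value_dir ('D_u f) (c *: u + x) v h h0) => t th.
  by rewrite addrCA; exact: (df c t ch th).2.
exists c, d; split=> //.
have -> : f (h *: u + (h *: v + x)) - f (h *: u + x) - f (h *: v + x) + f x =
          p (h *: u + x) - p x.
  by rewrite /p [h *: v + (_ + x)]addrCA; ring.
rewrite pE [c *: u + (_ + _)]addrCA -qE; congr (_ * _).
transitivity ('D_u (fun y => f (h *: v + y)) (c *: u + x) - 'D_u f (c *: u + x)).
  apply: (@deriveB R _ R (fun y => f (h *: v + y)) f); apply: diff_derivable.
    exact: dtr.
  exact: df0.
by rewrite derive_translate.
Qed.

Lemma near_parallelogram (x u v : 'rV[R]_m) (N : set 'rV[R]_m) : nbhs x N ->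
  exists2 h, 0 < h & forall s t, 0 <= s <= h -> 0 <= t <= h ->
    N (s *: u + (t *: v + x)).
Proof.
move=> /nbhs_normP[e /= e0 eN].
(* The summand 1 keeps [K] positive when u = v = 0 and makes the final inequality strict. *)
pose K : R := `|u| + `|v| + 1.
have K0 : 0 < K by rewrite /K ltr_wpDl// addr_ge0.
exists (e / K); first by rewrite divr_gt0.
move=> s t /andP[s0 sh] /andP[t0 th]; apply: eN => /=.
rewrite -normrN opprB addrA addrK (le_lt_trans (ler_normD _ _))//.
rewrite !normrZ !ger0_norm// (@le_lt_trans _ _ (e / K * `|u| + e / K * `|v|))//.
  by apply: lerD; apply: ler_wpM2r.
rewrite -mulrDr -[ltRHS]mulr1 -mulrA ltr_pM2l// ltr_pdivrMl// mulr1.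
by rewrite /K ltrDl.
Qed.

Lemma Ck_on_cvg_dist k U f x e : 0 < e -> Ck_on k U f -> U x ->
  \forall y \near x, `|f x - f y| < e.
Proof.
move=> e0 cf Ux; have {}cf : {for x, continuous f}.
  elim: k cf => [|k IH]; first by move/(_ x Ux).
  by move=> /Ck_onW.
exact: (@cvgrPdist_lt _ _ _ _ _ f (f x)).1 cf e e0.
Qed.

Lemma dist_split (a b c e : R) :
  `|a - c| < e / 2 -> `|b - c| < e / 2 -> `|a - b| < e.
Proof.
by move=> ac bc; apply: (@distm_lt_split _ _ c) => //; rewrite distrC.
Qed.

Lemma schwarz f (U : set 'rV[R]_m) x u v : open U -> Ck_on 2 U f -> U x ->
  'D_v ('D_u f) x = 'D_u ('D_v f) x.
Proof.
move=> oU [df cf] Ux; apply/eqP; rewrite -subr_eq0 -normr_eq0 eq_le normr_ge0 andbT.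
apply/ler_addgt0Pl => e e0; rewrite addr0.
have e20 : 0 < e / 2 by rewrite divr_gt0.
have c1 := @Ck_on_cvg_dist 0 U _ x _ e20 ((cf u).2 v) Ux.
have c2 := @Ck_on_cvg_dist 0 U _ x _ e20 ((cf v).2 u) Ux.
have nU : nbhs x U by apply: open_nbhs_nbhs.
(* On this parallelogram both mixed derivatives stay within e / 2 of their values at x, so the
   unknown position of the mean value points is harmless. *)
have [h h0 hN] := near_parallelogram u v (filterI (filterI c1 c2) nU).
have [c [d [ch dh E1]]] := @second_difference f x u v h h0
  (fun s t sh th => conj (df _ (hN s t sh th).2) ((cf u).1 _ (hN s t sh th).2)).
have hN' s t : 0 <= s <= h -> 0 <= t <= h ->
    differentiable f (s *: v + (t *: u + x)) /\
    differentiable ('D_v f) (s *: v + (t *: u + x)).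
  by move=> sh th; rewrite addrCA; split; [apply: df|apply: (cf v).1]; exact: (hN t s th sh).2.
have [c' [d' [ch' dh' E2]]] := @second_difference f x v u h h0 hN'.
have XY : 'D_v ('D_u f) (c *: u + (d *: v + x)) =
   'D_u ('D_v f) (c' *: v + (d' *: u + x)).
  move: E1 E2; rewrite [h *: v + (h *: u + x)]addrCA.
  move: ('D_v ('D_u f) _) ('D_u ('D_v f) _) => X Y E1 E2.
  apply: (mulfI (lt0r_neq0 h0)); apply: (mulfI (lt0r_neq0 h0)).
  by rewrite -E1 -E2; congr (_ + _); rewrite addrAC.
have [[b1 _] _] := hN c d ch dh; have [[_ b2] _] := hN d' c' dh' ch'.
rewrite /= XY in b1; rewrite /= addrCA in b2.
exact: ltW (dist_split b1 b2).
Qed.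
End schwarz.

(** * Matrix-valued functions *)

Section matrix_calculus.
Variables (R : realType) (V : normedModType R).
Implicit Types (x v : V).

Lemma differentiable_mulmx p q r (A : V -> 'M[R]_(p, q)) (B : V -> 'M[R]_(q, r)) x :
  differentiable A x -> differentiable B x ->
  differentiable (fun y => A y *m B y) x.
Proof.
move=> dA dB; apply: differentiable_mxP => i j.
rewrite (_ : (fun y => (A y *m B y) i j) = fun y => \sum_k A y i k * B y k j); last first.
  by apply/funext => y; rewrite mxE.
apply: (derive_sum_fun (index_enum _) 0 _).1 => k.
by apply: differentiableM; exact: differentiable_mx_coord.
Qed.

Lemma derive_mulmx p q r (A : V -> 'M[R]_(p, q)) (B : V -> 'M[R]_(q, r)) x v :
  differentiable A x -> differentiable B x ->
  'D_v (fun y => A y *m B y) x = 'D_v A x *m B x + A x *m 'D_v B x.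
Proof.
move=> dA dB; apply/matrixP => i j.
rewrite derive_mx_coord; last exact: differentiable_mulmx.
rewrite (_ : (fun y => (A y *m B y) i j) = fun y => \sum_k A y i k * B y k j); last first.
  by apply/funext => y; rewrite mxE.
have dM k : differentiable (fun y => A y i k * B y k j) x.
  by apply: differentiableM; exact: differentiable_mx_coord.
rewrite (derive_sum_fun (index_enum _) v dM).2 !mxE -big_split; apply: eq_bigr => k _.
rewrite deriveM_fun; [|exact: differentiable_mx_coord..].
by rewrite !derive_mx_coord.
Qed.

Lemma differentiable_trmx p q (A : V -> 'M[R]_(p, q)) x :
  differentiable A x -> differentiable (fun y => (A y)^T) x.
Proof.
move=> dA; apply: differentiable_mxP => i j.
rewrite (_ : (fun y => (A y)^T i j) = fun y => A y j i); last first.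
  by apply/funext => y; rewrite mxE.
exact: differentiable_mx_coord.
Qed.

Lemma derive_trmx p q (A : V -> 'M[R]_(p, q)) x v : differentiable A x ->
  'D_v (fun y => (A y)^T) x = ('D_v A x)^T.
Proof.
move=> dA; apply/matrixP => i j.
rewrite derive_mx_coord; last exact: differentiable_trmx.
rewrite mxE derive_mx_coord//; congr ('D_v _ x).
by apply/funext => y; rewrite mxE.
Qed.

Lemma derive_sum_scale p q (I : finType) (c : I -> V -> R) (A : I -> V -> 'M[R]_(p, q)) x v :
  (forall i, differentiable (c i) x) -> (forall i, differentiable (A i) x) ->
  differentiable (fun y => \sum_i c i y *: A i y) x /\
  'D_v (fun y => \sum_i c i y *: A i y) x =
    \sum_i ('D_v (c i) x *: A i x + c i x *: 'D_v (A i) x).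
Proof.
move=> dc dA.
have E a b : (fun y => (\sum_i c i y *: A i y) a b) = fun y => \sum_i c i y * A i y a b.
  by apply/funext => y; rewrite summxE; apply: eq_bigr => i _; rewrite mxE.
have dM a b i : differentiable (fun y => c i y * A i y a b) x.
  by apply: differentiableM => //; exact: differentiable_mx_coord.
have dS : differentiable (fun y => \sum_i c i y *: A i y) x.
  apply: differentiable_mxP => a b; rewrite E.
  exact: (derive_sum_fun (index_enum _) 0 (dM a b)).1.
split=> //; apply/matrixP => a b.
rewrite derive_mx_coord// E (derive_sum_fun (index_enum _) v (dM a b)).2.
rewrite summxE; apply: eq_bigr => i _.
rewrite deriveM_fun//; last exact: differentiable_mx_coord.
by rewrite !mxE derive_mx_coord.
Qed.

End matrix_calculus.

(** * Smooth matrix functions and Jacobians *)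

Section smooth_functions.
Variables (R : realType) (m : nat) (U : set 'rV[R]_m).
Hypothesis oU : open U.

Lemma smooth_on_differentiable (W : normedModType R) (f : 'rV[R]_m -> W) x :
  smooth_on U f -> U x -> differentiable f x.
Proof. by move=> /(_ 1)[df _] /df. Qed.

Lemma smooth_on_derive (W : normedModType R) (f : 'rV[R]_m -> W) v :
  smooth_on U f -> smooth_on U ('D_v f).
Proof. by move=> cf k; exact: (cf k.+1).2. Qed.

Lemma smooth_on_ext (W : normedModType R) (f g : 'rV[R]_m -> W) :
  (forall x, U x -> f x = g x) -> smooth_on U f -> smooth_on U g.
Proof. by move=> fg cf k; exact: Ck_on_ext oU fg (cf k). Qed.

Lemma smooth_on_mxP p q (F : 'rV[R]_m -> 'M[R]_(p, q)) :
  smooth_on U F <-> forall i j, smooth_on U (fun x => F x i j).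
Proof.
split=> [cF i j k|cF k]; first exact: (Ck_on_mxP k F oU).1.
by apply/(Ck_on_mxP k F oU) => i j; exact: cF.
Qed.

Lemma smooth_on_mulmx p q r (A : 'rV[R]_m -> 'M[R]_(p, q)) (B : 'rV[R]_m -> 'M[R]_(q, r)) :
  smooth_on U A -> smooth_on U B -> smooth_on U (fun x => A x *m B x).
Proof.
move=> cA cB; apply/smooth_on_mxP => i j.
apply: (@smooth_on_ext _ (fun x => \sum_k A x i k * B x k j)) => [x _|k].
  by rewrite mxE.
apply: Ck_on_sum => // l _.
by apply: Ck_onM => //; [exact: (smooth_on_mxP A).1|exact: (smooth_on_mxP B).1].
Qed.

Lemma smooth_on_det p (A : 'rV[R]_m -> 'M[R]_p) :
  (forall i j, smooth_on U (fun x => A x i j)) -> smooth_on U (fun x => \det (A x)).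
Proof.
move=> cA k; apply: Ck_on_sum => // s _; apply: Ck_onM => //; first exact: Ck_on_cst.
by apply: Ck_on_prod => // i; exact: cA.
Qed.

Lemma smooth_on_invmx p (A : 'rV[R]_m -> 'M[R]_p) :
  (forall x, U x -> A x \in unitmx) -> smooth_on U A ->
  smooth_on U (fun x => invmx (A x)).
Proof.
move=> uA /smooth_on_mxP cA; apply/smooth_on_mxP => i j.
(* Cramer's rule: the cofactors are polynomials in the entries and the determinant does not vanish
   on [U]. *)
apply: (@smooth_on_ext _ (fun x => (\det (A x))^-1 * ((-1) ^+ (j + i) *
    \det (row' j (col' i (A x)))))).
  by move=> x Ux; rewrite /invmx (uA x Ux) !mxE.
move=> k; apply: Ck_onM => //.
  apply: Ck_onV => // [x Ux|]; last exact: smooth_on_det.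
  by have := uA x Ux; rewrite unitmxE unitfE.
apply: Ck_onM => //; first exact: Ck_on_cst.
apply: smooth_on_det => a b.
by apply: (@smooth_on_ext _ (fun x => A x (lift j a) (lift i b))) => // x _; rewrite !mxE.
Qed.

Lemma jacobianE n (f : 'rV[R]_m -> 'rV[R]_n) x i c : differentiable f x ->
  jacobian f x i c = 'D_('e_i) (fun y => f y 0 c) x.
Proof.
move=> df; by rewrite -derive_mx_coord// deriveE// mxE.
Qed.

Lemma smooth_on_jacobian n (f : 'rV[R]_m -> 'rV[R]_n) :
  smooth_on U f -> smooth_on U (jacobian f).
Proof.
move=> cf; apply/smooth_on_mxP => i c.
apply: (@smooth_on_ext _ (fun x => 'D_('e_i) (fun y => f y 0 c) x)).
  by move=> x Ux; rewrite jacobianE//; exact: smooth_on_differentiable cf Ux.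
by apply: smooth_on_derive; exact: (smooth_on_mxP f).1.
Qed.

(** The rows of the Jacobian are the partial derivatives of f, so this is Schwarz's theorem for each
    component. It is the source of torsion-freeness under coordinate changes. *)
Lemma derive_jacobian_sym n (f : 'rV[R]_m -> 'rV[R]_n) x i j c :
  smooth_on U f -> U x ->
  ('D_('e_i) (jacobian f) x) j c = ('D_('e_j) (jacobian f) x) i c.
Proof.
move=> cf Ux.
have dJ : differentiable (jacobian f) x.
  exact: smooth_on_differentiable (smooth_on_jacobian cf) Ux.
have E a : \near x, jacobian f x a c = 'D_('e_a) (fun y => f y 0 c) x.
  near=> y; apply: jacobianE; apply: smooth_on_differentiable cf _.
  by near: y; exact: open_nbhs_nbhs.
have D a b : ('D_('e_a) (jacobian f) x) b c = 'D_('e_a) ('D_('e_b) (fun y => f y 0 c)) x.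
  by rewrite derive_mx_coord//; exact: near_eq_derive (E b).
apply: etrans (D i j) _; apply: etrans (esym (D j i)).
exact: (schwarz 'e_j 'e_i oU ((smooth_on_mxP f).1 cf 0 c 2) Ux).
Unshelve. all: by end_near. Qed.

Lemma derive_comp_jacobian (W : normedModType R) n (f : 'rV[R]_m -> 'rV[R]_n)
    (h : 'rV[R]_n -> W) x i :
  differentiable f x -> differentiable h (f x) ->
  'D_('e_i) (fun y => h (f y)) x = \sum_a jacobian f x i a *: 'D_('e_a) h (f x).
Proof.
move=> df dh; rewrite [LHS](@derive_comp_diff _ _ _ _ f h x _ df dh).
rewrite deriveEjacobian// -rowE [row i _]row_sum_delta linear_sum.
by apply: eq_bigr => a _; rewrite linearZ/= mxE -deriveE.
Qed.

End smooth_functions.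

(** * The Levi-Civita connection *)

Section levi_civita.
Variables (R : realType) (n : nat).
Implicit Types (g : 'rV[R]_n -> 'M[R]_n) (x : 'rV[R]_n).

(** Row j holds the components of nabla_(d_i) d_j. The matrices thus act on row vectors and compose
    in the order opposite to endomorphisms. *)
Definition connection_mx g i x : 'M[R]_n := \matrix_(j, k) christoffel g k i j x.

Definition curvature_mx g i j x : 'M[R]_n :=
  \matrix_(k, l) riemann_endo g i j k l x.

Lemma partial_mx g x i j l : differentiable g x ->
  partial i (fun y => g y j l) x = ('D_('e_i) g x) j l.
Proof. by move=> dg; rewrite derive_mx_coord. Qed.

(** Lowering the index cancels the inverse metric and leaves the Christoffel symbols of the first
    kind. *)
Lemma connection_mx_lower g x i j l : differentiable g x ->
  g x \in unitmx -> (g x)^T = g x ->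
  (connection_mx g i x *m g x) j l =
  2^-1 * (('D_('e_i) g x) j l + ('D_('e_j) g x) i l - ('D_('e_l) g x) i j).
Proof.
move=> dg ug sg.
have sgE a b : g x a b = g x b a by rewrite -[in LHS]sg mxE.
have cE k : connection_mx g i x j k = \sum_p (2^-1 *
    (('D_('e_i) g x) j p + ('D_('e_j) g x) i p - ('D_('e_p) g x) i j)) * invmx (g x) k p.
  rewrite mxE /christoffel mulr_sumr; apply: eq_bigr => p _.
  by rewrite !partial_mx// -mulrA; congr (_ * _); rewrite mulrC.
rewrite mxE (eq_bigr (fun k => \sum_p (2^-1 *
    (('D_('e_i) g x) j p + ('D_('e_j) g x) i p - ('D_('e_p) g x) i j)) *
      (g x l k * invmx (g x) k p))); last first.
  move=> k _; rewrite cE mulr_suml; apply: eq_bigr => p _.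
  rewrite sgE; move: (2^-1 * _) (invmx _ _ _) (g x l k) => X Y Z.
  by rewrite -mulrA (mulrC Y).
rewrite exchange_big (bigD1 l)//= [X in _ + X]big1 => [|p pl].
  rewrite addr0 -mulr_sumr; have /matrixP/(_ l l) := mulmxV ug.
  by rewrite !mxE eqxx => ->; rewrite mulr1.
rewrite -mulr_sumr; have /matrixP/(_ l p) := mulmxV ug.
by rewrite !mxE eq_sym (negbTE pl) => ->; rewrite mulr0.
Qed.

(* The fundamental theorem of Riemannian geometry: torsion-freeness and metric
   compatibility determine the connection matrices. *)
Lemma connection_mx_unique g x (G : 'I_n -> 'M[R]_n) : differentiable g x ->
  g x \in unitmx -> (g x)^T = g x ->
  (forall i j k, G i j k = G j i k) ->
  (forall i, 'D_('e_i) g x = G i *m g x + (G i *m g x)^T) ->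
  forall i, connection_mx g i x = G i.
Proof.
move=> dg ug sg tG cG i.
have inj A B : A *m g x = B *m g x -> A = B.
  by move=> /(congr1 (mulmx^~ (invmx (g x)))); rewrite !mulmxK.
pose D a := 'D_('e_a) g x.
have L a b c : D a b c = (G a *m g x) b c + (G a *m g x) c b.
  by rewrite /D (cG a) [LHS]mxE; congr (_ + _); rewrite [LHS]mxE.
have T a b c : (G a *m g x) b c = (G b *m g x) a c.
  by rewrite !mxE; apply: eq_bigr => k _; rewrite tG.
have lE j l : (connection_mx g i x *m g x) j l =
    2^-1 * (D i j l + D j i l - D l i j).
  exact: connection_mx_lower.
apply: inj; apply/matrixP => j l; rewrite lE; clearbody D.
rewrite (L i j l) (L j i l) (L l i j) (T j i l) (T l i j) (T l j i).
move: ((G i *m g x) j l) ((G i *m g x) l j) ((G j *m g x) l i) => a b c.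
by lra.
Qed.

Lemma connection_mx_torsion_free g x i j k : (\near x, (g x)^T = g x) ->
  connection_mx g i x j k = connection_mx g j x i k.
Proof.
move=> sg; rewrite !mxE /christoffel; congr (_ * _); apply: eq_bigr => l _.
congr (_ * _); rewrite [X in X - _]addrC; congr (_ - _).
apply: near_eq_derive; near=> y.
have sy : (g y)^T = g y by near: y.
by rewrite -[in LHS]sy mxE.
Unshelve. all: by end_near. Qed.

Lemma derive_sym g x v : (\near x, (g x)^T = g x) -> differentiable g x ->
  ('D_v g x)^T = 'D_v g x.
Proof.
move=> sg dg; apply: etrans (esym (derive_trmx v dg)) _.
exact: near_eq_derive.
Qed.

(** The existence half of the fundamental theorem: adding the symbols of the first kind with j and l
    exchanged cancels everything except D_i g_jl. *)
Lemma connection_mx_compatible g x i : differentiable g x ->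
  g x \in unitmx -> (\near x, (g x)^T = g x) ->
  'D_('e_i) g x = connection_mx g i x *m g x + (connection_mx g i x *m g x)^T.
Proof.
move=> dg ug sg.
pose D a := 'D_('e_a) g x.
have S a b c : D a b c = D a c b.
  have := congr1 (fun A : 'M[R]_n => A c b) (derive_sym 'e_a sg dg).
  by rewrite mxE => <-.
have L j l : (connection_mx g i x *m g x) j l =
    2^-1 * (D i j l + D j i l - D l i j).
  exact: connection_mx_lower dg ug (nbhs_singleton sg).
change (D i = connection_mx g i x *m g x + (connection_mx g i x *m g x)^T).
move: (connection_mx g i x *m g x) L S => C; clearbody D => L S.
apply/matrixP => j l; rewrite [RHS]mxE [X in _ + X]mxE (L j l) (L l j).
rewrite (S i l j).
move: (D i j l) (D j i l) (D l i j) => a b c.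
by lra.
Qed.

Variable U : set 'rV[R]_n.
Hypothesis oU : open U.

Lemma smooth_on_connection_mx g i : smooth_on U g ->
  (forall x, U x -> g x \in unitmx) -> smooth_on U (connection_mx g i).
Proof.
move=> cg ug; apply/(smooth_on_mxP oU) => j k.
apply: (smooth_on_ext oU (f := christoffel g k i j)) => [x _|d]; first by rewrite mxE.
have ci := (smooth_on_mxP oU _).1 (smooth_on_invmx oU ug cg).
have cd a b c : Ck_on d U (partial a (fun y => g y b c)).
  exact: (smooth_on_derive 'e_a ((smooth_on_mxP oU _).1 cg b c) d).
apply: Ck_onM => //; first exact: Ck_on_cst.
apply: Ck_on_sum => // l _; apply: Ck_onM => //; first exact: ci.
by apply: Ck_onD => //; [apply: Ck_onD|apply: Ck_onN].
Qed.

(** Cartan's structure equation; the row convention is why the commutator appears with j before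
    i. *)
Lemma curvature_mxE g i j x : smooth_on U g ->
  (forall x, U x -> g x \in unitmx) -> U x ->
  curvature_mx g i j x =
    'D_('e_i) (connection_mx g j) x - 'D_('e_j) (connection_mx g i) x +
    (connection_mx g j x *m connection_mx g i x -
     connection_mx g i x *m connection_mx g j x).
Proof.
move=> cg ug Ux; have dc a : differentiable (connection_mx g a) x.
  exact: smooth_on_differentiable (smooth_on_connection_mx a cg ug) Ux.
have E a b k l : partial a (christoffel g l b k) x =
    ('D_('e_a) (connection_mx g b) x) k l.
  rewrite derive_mx_coord//; congr ('D_('e_a) _ x).
  by apply/funext => y; rewrite mxE.
apply/matrixP => k l; rewrite mxE /riemann_endo (E i j k l) (E j i k l).
rewrite [RHS]mxE [X in X + _ = _]/= ; congr (_ + _).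
  by rewrite !mxE.
rewrite !mxE -sumrB; apply: eq_bigr => p _; rewrite !mxE.
by congr (_ - _); rewrite mulrC.
Qed.

End levi_civita.

(** * Change of coordinates *)

Lemma sum_scale_mulmx (R : comPzRingType) n (I J : finType) (c : I -> R) (d : J -> R)
    (A : I -> 'M[R]_n) (B : J -> 'M[R]_n) :
  (\sum_a c a *: A a) *m (\sum_b d b *: B b) =
  \sum_a \sum_b (c a * d b) *: (A a *m B b).
Proof.
rewrite mulmx_suml; apply: eq_bigr => a _; rewrite mulmx_sumr.
by apply: eq_bigr => b _; rewrite -scalemxAl -scalemxAr scalerA.
Qed.

(** Applied with [c], [d] two rows of a Jacobian, [G] the connection of the target and [dG a b] the
    derivative of [G b] along a. The left side is the curvature of the pulled back connection,
    stripped of the second derivatives of the coordinate change, which cancel by symmetry. *)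
Lemma curvature_mx_pullback_sum (R : comPzRingType) n (I : finType) (c d : I -> R)
    (G : I -> 'M[R]_n) (dG : I -> I -> 'M[R]_n) :
  \sum_a d a *: (\sum_b c b *: dG b a) - \sum_a c a *: (\sum_b d b *: dG b a)
  + ((\sum_b d b *: G b) *m (\sum_a c a *: G a)
     - (\sum_a c a *: G a) *m (\sum_b d b *: G b)) =
  \sum_a \sum_b (c a * d b) *: (dG a b - dG b a + (G b *m G a - G a *m G b)).
Proof.
rewrite !sum_scale_mulmx.
have -> : \sum_a d a *: (\sum_b c b *: dG b a) =
    \sum_a \sum_b (c a * d b) *: dG a b.
  rewrite exchange_big/=; apply: eq_bigr => a _; rewrite scaler_sumr.
  by apply: eq_bigr => b _; rewrite scalerA mulrC.
have -> : \sum_a c a *: (\sum_b d b *: dG b a) =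
    \sum_a \sum_b (c a * d b) *: dG b a.
  apply: eq_bigr => a _; rewrite scaler_sumr.
  by apply: eq_bigr => b _; rewrite scalerA.
have -> : \sum_a \sum_b (d a * c b) *: (G a *m G b) =
    \sum_a \sum_b (c a * d b) *: (G b *m G a).
  by rewrite exchange_big/=; do 2!apply: eq_bigr => ? _; rewrite mulrC.
rewrite -!sumrB -big_split/=; apply: eq_bigr => a _.
rewrite -!sumrB -big_split/=; apply: eq_bigr => b _.
by rewrite !scalerDr !scalerN.
Qed.

(** Applied with [K] a Jacobian, [D i] its derivatives, [C] the connection of the target and [L] the
    inverse of [K]. Multiplication by [L] touches only the last index, and the symmetry in i, j of
    the rest comes from [D] and [C] separately. *)
Lemma pullback_torsion_free (R : comPzRingType) n (D C : 'I_n -> 'M[R]_n) (K L : 'M[R]_n) :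
  (forall i j l, D i j l = D j i l) -> (forall i j l, C i j l = C j i l) ->
  forall i j l, ((D i + K *m \sum_a K i a *: C a) *m L) j l =
                ((D j + K *m \sum_a K j a *: C a) *m L) i l.
Proof.
move=> sD sC i j l; rewrite [LHS]mxE [RHS]mxE; apply: eq_bigr => k _; congr (_ * _).
rewrite [LHS]mxE [RHS]mxE sD; congr (_ + _); rewrite [LHS]mxE [RHS]mxE.
transitivity (\sum_b \sum_a K j b * (K i a * C a b k)).
  by apply: eq_bigr => b _; rewrite summxE mulr_sumr; apply: eq_bigr => a _; rewrite mxE.
rewrite exchange_big/=; apply: eq_bigr => a _; rewrite summxE mulr_sumr.
by apply: eq_bigr => b _; rewrite mxE mulrCA sC.
Qed.

(* Ji, Jij, dGj, dAj stand for D_i J, D_i D_j J, D_i Gj, D_i Aj, and dGi, dAi for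
   D_j Gi, D_j Ai; the first two hypotheses differentiate the last two. *)
Lemma gauge_curvature (R : comPzRingType) n
    (Ji Jj Jij J Gj Gi dGj dGi Tij Tji S dAj dAi Ai Aj : 'M[R]_n) :
  dGj *m J + Gj *m Ji = Jij + (Ji *m Aj + J *m dAj) ->
  dGi *m J + Gi *m Jj = Jij + (Jj *m Ai + J *m dAi) ->
  dAj = S + Tij -> dAi = S + Tji ->
  Gi *m J = Ji + J *m Ai -> Gj *m J = Jj + J *m Aj ->
  (dGj - dGi + (Gj *m Gi - Gi *m Gj)) *m J = J *m (Tij - Tji + (Aj *m Ai - Ai *m Aj)).
Proof.
move=> Eij Eji EAj EAi Ci Cj; subst dAj dAi.
have {}Eij : dGj *m J = Jij + (Ji *m Aj + J *m (S + Tij)) - Gj *m Ji by rewrite -Eij addrK.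
have {}Eji : dGi *m J = Jij + (Jj *m Ai + J *m (S + Tji)) - Gi *m Jj by rewrite -Eji addrK.
rewrite mulmxDl mulmxBl Eij Eji mulmxBl -!mulmxA Ci Cj !mulmxDr !mulmxA Ci Cj.
rewrite !mulmxDl !mulmxN.
move: (Ji *m Aj) (J *m S) (J *m Tij) (J *m Tji) (Gj *m Ji) (Gi *m Jj) (Jj *m Ai).
rewrite -!mulmxA; move: (J *m (Ai *m Aj)) (J *m (Aj *m Ai)) => *.
by apply/matrixP => a b; rewrite !mxE; ring.
Qed.

Lemma schwarz_mx (R : realType) m p q (U : set 'rV[R]_m) (F : 'rV[R]_m -> 'M[R]_(p, q)) x u v :
  open U -> smooth_on U F -> U x -> 'D_v ('D_u F) x = 'D_u ('D_v F) x.
Proof.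
move=> oU cF Ux; apply/matrixP => i j.
have D w w' : ('D_w ('D_w' F) x) i j = 'D_w ('D_w' (fun y => F y i j)) x.
  have dF := smooth_on_differentiable (smooth_on_derive w' cF) Ux.
  apply: etrans (derive_mx_coord w i j dF) _; apply: near_eq_derive; near=> y.
  apply: derive_mx_coord; apply: (smooth_on_differentiable cF).
  by near: y; exact: open_nbhs_nbhs.
apply: etrans (D v u) _; apply: etrans (esym (D u v)).
exact: (schwarz u v oU ((smooth_on_mxP oU F).1 cF i j 2) Ux).
Unshelve. all: by end_near. Qed.

Section change_of_coordinates.
Variables (R : realType) (n : nat) (U V : set 'rV[R]_n).
Variables (tau : 'rV[R]_n -> 'rV[R]_n) (g h : 'rV[R]_n -> 'M[R]_n).
Hypotheses (oU : open U) (oV : open V).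
Hypotheses (ctau : smooth_on U tau) (tauV : forall x, U x -> V (tau x)).
Hypotheses (cg : smooth_on U g) (ch : smooth_on V h).
Hypotheses (sg : forall x, U x -> (g x)^T = g x) (sh : forall x, V x -> (h x)^T = h x).
Hypotheses (ug : forall x, U x -> g x \in unitmx) (uh : forall x, V x -> h x \in unitmx).
Hypothesis gE : forall x, U x ->
  g x = jacobian tau x *m h (tau x) *m (jacobian tau x)^T.

Local Notation J := (jacobian tau).

(** Read off from the determinant of g = J h J^T, without an inverse of [tau]. *)
Lemma jacobian_unit x : U x -> J x \in unitmx.
Proof. by move=> Ux; have := ug Ux; rewrite gE// !unitmx_mul => /andP[/andP[]]. Qed.

Let cJ : smooth_on U J := smooth_on_jacobian oU ctau.
Let dJ x (Ux : U x) : differentiable J x := smooth_on_differentiable cJ Ux.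
Let dtau x (Ux : U x) : differentiable tau x := smooth_on_differentiable ctau Ux.

Let derive_tau p q (F : 'rV[R]_n -> 'M[R]_(p, q)) x i : U x -> differentiable F (tau x) ->
  'D_('e_i) (fun y => F (tau y)) x = \sum_a J x i a *: 'D_('e_a) F (tau x).
Proof. by move=> Ux dF; exact: derive_comp_jacobian (dtau Ux) dF. Qed.

Let diff_tau p q (F : 'rV[R]_n -> 'M[R]_(p, q)) x : U x -> differentiable F (tau x) ->
  differentiable (fun y => F (tau y)) x.
Proof. by move=> Ux dF; apply: (@differentiable_comp _ _ _ _ tau F) => //; exact: dtau. Qed.

(* The connection h pulled back along tau, in the frame of the target. *)
Definition pullback_connection i y : 'M[R]_n :=
  \sum_a J y i a *: connection_mx h a (tau y).

Local Notation A := pullback_connection.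

(** The gauge transformation law. The candidate (D_i J + J A_i) J^-1 is torsion-free by Schwarz and
    compatible with g by the Leibniz rule on g = J h J^T, so uniqueness identifies it with the
    connection of g. *)
Lemma connection_mx_change i x : U x ->
  connection_mx g i x *m J x = 'D_('e_i) J x + J x *m A i x.
Proof.
move=> Ux; have uJ := jacobian_unit Ux; have Vx := tauV Ux.
have dh : differentiable h (tau x) := smooth_on_differentiable ch Vx.
have nV : \forall y \near tau x, (h y)^T = h y.
  by near=> y; apply: sh; near: y; exact: open_nbhs_nbhs.
pose G i := ('D_('e_i) J x + J x *m A i x) *m invmx (J x).
suff -> : connection_mx g i x = G i by rewrite /G mulmxKV.
apply: connection_mx_unique; [|exact: ug|exact: sg| |].
- exact: smooth_on_differentiable cg Ux.
- move=> a b k; apply: (pullback_torsion_free (D := fun i => 'D_('e_i) J x)).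
    by move=> c d l; have H := derive_jacobian_sym oU c d l ctau Ux; exact: H.
  by move=> c d l; exact: connection_mx_torsion_free.
move=> a.
have gJ : \near x, J x *m h (tau x) *m (J x)^T = g x.
  by near=> y; apply/esym/gE; near: y; exact: open_nbhs_nbhs.
have dht := diff_tau Ux dh.
have := near_eq_derive 'e_a gJ.
have -> := derive_mulmx 'e_a (differentiable_mulmx (dJ Ux) dht)
  (differentiable_trmx (dJ Ux)).
have -> := derive_mulmx 'e_a (dJ Ux) dht.
have -> := derive_trmx 'e_a (dJ Ux).
have -> : 'D_('e_a) (fun y => h (tau y)) x =
    A a x *m h (tau x) + h (tau x) *m (A a x)^T.
  rewrite (derive_tau a Ux dh) /pullback_connection linear_sum mulmx_suml mulmx_sumr -big_split.
  apply: eq_bigr => b _; rewrite /= linearZ/= -scalemxAl -scalemxAr -scalerDr.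
  congr (_ *: _); rewrite (connection_mx_compatible b dh (uh Vx) nV).
  by rewrite trmx_mul (sh Vx).
move=> <-; rewrite trmx_mul (sg Ux) (gE Ux) /G.
move: uJ; move: ('D_('e_a) J x) (J x) (A a x) (h (tau x)) (sh Vx) => D K B H sH uK.
rewrite trmx_mul !mulmxA mulmxKV// !linearD/= trmx_mul.
rewrite -(mulmxA _ K^T (invmx K)^T) -(trmx_mul (invmx K) K) mulVmx// trmx1 mulmx1.
rewrite !(mulmxDl, mulmxDr) !mulmxA !addrA.
exact: addrAC.
Unshelve. all: by end_near. Qed.

Let derive_pullback_connection i j x : U x ->
  differentiable (A i) x /\
  'D_('e_j) (A i) x = \sum_a ('D_('e_j) J x) i a *: connection_mx h a (tau x)
    + \sum_a J x i a *: (\sum_b J x j b *: 'D_('e_b) (connection_mx h a) (tau x)).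
Proof.
move=> Ux; have Vx := tauV Ux.
have dc a : differentiable (connection_mx h a) (tau x).
  exact: smooth_on_differentiable (smooth_on_connection_mx oV a ch uh) Vx.
have [dA E] := derive_sum_scale 'e_j
  (fun a => differentiable_mx_coord i a (dJ Ux)) (fun a => diff_tau Ux (dc a)).
split=> //; apply: etrans E _; rewrite big_split/=; congr (_ + _); apply: eq_bigr => a _.
  by congr (_ *: _); rewrite derive_mx_coord//; exact: dJ.
by congr (_ *: _); exact: derive_tau.
Qed.

(** Differentiating the gauge law once more produces second derivatives of J and second derivatives
    of [tau] contracted with the connection of h. Both are symmetric in i, j and drop out after
    antisymmetrization, which leaves J intertwining the endomorphisms while its rows pull back the
    two form indices. *)
Lemma curvature_mx_change i j x : U x ->
  curvature_mx g i j x *m J x =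
  J x *m \sum_a \sum_b (J x i a * J x j b) *: curvature_mx h a b (tau x).
Proof.
move=> Ux; have Vx := tauV Ux.
have dc a : differentiable (connection_mx g a) x.
  exact: smooth_on_differentiable (smooth_on_connection_mx oU a cg ug) Ux.
have E a b : 'D_('e_b) (connection_mx g a) x *m J x + connection_mx g a x *m 'D_('e_b) J x =
   'D_('e_b) ('D_('e_a) J) x + ('D_('e_b) J x *m A a x + J x *m 'D_('e_b) (A a) x).
  have dA := (derive_pullback_connection a b Ux).1.
  have dDJ := smooth_on_differentiable (smooth_on_derive 'e_a cJ) Ux.
  apply: etrans (esym (derive_mulmx 'e_b (dc a) (dJ Ux))) _.
  have nE : \near x, connection_mx g a x *m J x = 'D_('e_a) J x + J x *m A a x.
    by near=> y; apply: connection_mx_change; near: y; exact: open_nbhs_nbhs.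
  apply: etrans (near_eq_derive 'e_b nE) _.
  rewrite -(derive_mulmx 'e_b (dJ Ux) dA).
  apply: (@deriveD _ _ _ ('D_('e_a) J) (fun y => J y *m A a y)); apply: diff_derivable => //.
  exact: differentiable_mulmx (dJ Ux) dA.
have cE a b : curvature_mx h a b (tau x) = _ := curvature_mxE oV a b ch uh Vx.
have -> : \sum_a \sum_b (J x i a * J x j b) *: curvature_mx h a b (tau x) = _ :=
  eq_bigr _ (fun a _ => eq_bigr _ (fun b _ => congr1 _ (cE a b))).
rewrite -(curvature_mx_pullback_sum (J x i) (J x j) (fun a => connection_mx h a (tau x))
  (fun a b => 'D_('e_a) (connection_mx h b) (tau x))).
rewrite (curvature_mxE oU i j cg ug Ux).
have Eij := E j i; have Eji := E i j.
have dAij := (derive_pullback_connection j i Ux).2.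
have dAji := (derive_pullback_connection i j Ux).2.
(* This symmetric sum is the common term [S] of [gauge_curvature]. *)
have sJ : \sum_a ('D_('e_j) J x) i a *: connection_mx h a (tau x) =
   \sum_a ('D_('e_i) J x) j a *: connection_mx h a (tau x).
  apply: eq_bigr => a _.
  by have H := derive_jacobian_sym oU j i a ctau Ux; congr (_ *: _); exact: H.
have {}dAji := etrans dAji (congr1 (fun M => M + _) sJ).
have sDD := schwarz_mx 'e_i 'e_j oU cJ Ux.
have {}Eji := etrans Eji (congr1 (fun M => M + _) sDD).
move: Eij Eji dAij dAji (connection_mx_change i Ux) (connection_mx_change j Ux).
clear sJ sDD cE E.
rewrite -/(A i x) -/(A j x).
move: ('D_('e_i) (A j) x) ('D_('e_j) (A i) x) (A i x) (A j x).
move: (\sum_a ('D_('e_i) J x) j a *: connection_mx h a (tau x)) => S.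
move: (\sum_a J x j a *: _) (\sum_a J x i a *: _) => Tij Tji.
move: ('D_('e_i) (connection_mx g j) x) ('D_('e_j) (connection_mx g i) x).
move: (connection_mx g j x) (connection_mx g i x).
move: ('D_('e_i) J x) ('D_('e_j) J x) ('D_('e_i) ('D_('e_j) J) x) (J x).
move=> > Eij Eji EAj EAi Ci Cj; exact: (gauge_curvature Eij Eji EAj EAi Ci Cj).
Unshelve. all: by end_near. Qed.
End change_of_coordinates.

(** * Tensoriality of the curvature *)

Section tensor_algebra.
Variables (R : realType).

Lemma mxtrace_trmx_mul m n (P Y : 'M[R]_(m, n)) :
  \tr (P^T *m Y) = \sum_i \sum_j P i j * Y i j.
Proof.
rewrite exchange_big/=; apply: eq_bigr => j _; rewrite mxE.
by apply: eq_bigr => i _; rewrite mxE.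
Qed.

(** With Y the matrix of [X], both sides are the trace of P^T K Y K^T; cyclicity moves K from Y onto
    P. *)
Lemma contract_pullback n (P K : 'M[R]_n) (X : 'I_n -> 'I_n -> R) :
  \sum_i \sum_j P i j * (\sum_a \sum_b K i a * K j b * X a b) =
  \sum_a \sum_b (K^T *m P *m K) a b * X a b.
Proof.
pose Y : 'M[R]_n := \matrix_(a, b) X a b.
transitivity (\tr (P^T *m (K *m Y *m K^T))).
  rewrite mxtrace_trmx_mul; apply: eq_bigr => i _; apply: eq_bigr => j _.
  congr (_ * _); rewrite mxE exchange_big/=; apply: eq_bigr => b _.
  rewrite mxE mulr_suml; apply: eq_bigr => a _; rewrite !mxE.
  by rewrite -!mulrA; congr (_ * _); rewrite mulrC.
transitivity (\tr ((K^T *m P *m K)^T *m Y)).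
  by rewrite mulmxA mxtrace_mulC !trmx_mul trmxK !mulmxA.
rewrite mxtrace_trmx_mul; apply: eq_bigr => i _; apply: eq_bigr => j _.
by rewrite [X in _ * X]mxE.
Qed.

Section bivector.
Variable n : nat.
Implicit Types (T S : 'I_n -> 'I_n -> 'I_n -> 'I_n -> R) (w : 'M[R]_n).

Lemma bivector_evalE T w : bivector_eval T w w =
  4^-1 * \sum_a \sum_b w a b * \sum_c \sum_d w c d * T a b c d.
Proof.
congr (_ * _); apply: eq_bigr => a _; apply: eq_bigr => b _.
rewrite mulr_sumr; apply: eq_bigr => c _; rewrite mulr_sumr.
by apply: eq_bigr => d _; ring.
Qed.

Lemma bivector_eval_lin T S w (s t : R) :
  bivector_eval (fun a b c d => s * T a b c d - t * S a b c d) w w =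
  s * bivector_eval T w w - t * bivector_eval S w w.
Proof.
rewrite /bivector_eval mulrCA [t * _]mulrCA -mulrBr; congr (_ * _).
rewrite !mulr_sumr -sumrB; apply: eq_bigr => a _.
rewrite !mulr_sumr -sumrB; apply: eq_bigr => b _.
rewrite !mulr_sumr -sumrB; apply: eq_bigr => c _.
by rewrite !mulr_sumr -sumrB; apply: eq_bigr => d _; ring.
Qed.

(* The value of g^2/2 on the bivector w, see [bivector_eval_kn]. *)
Definition bivector_norm (g w : 'M[R]_n) : R := 2^-1 * \tr (g *m w *m g^T *m w^T).

Lemma bivector_eval_kn (g w : 'M[R]_n) : w^T = - w ->
  bivector_eval (fun a b c d => kulkarni_nomizu g g a b c d / 2) w w = bivector_norm g w.
Proof.
move=> sw; have wE a b : w a b = - w b a.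
  by have /matrixP/(_ b a) := sw; rewrite !mxE.
pose S := \sum_a \sum_b \sum_c \sum_d g a c * g b d * (w a b * w c d).
have S2 : \sum_a \sum_b \sum_c \sum_d g a d * g b c * (w a b * w c d) = - S.
  rewrite -sumrN; apply: eq_bigr => a _; rewrite -sumrN; apply: eq_bigr => b _.
  rewrite exchange_big -sumrN; apply: eq_bigr => c _; rewrite -sumrN.
  by apply: eq_bigr => d _; rewrite (wE d c); ring.
have -> : bivector_norm g w = 2^-1 * S.
  congr (_ * _).
  rewrite /mxtrace [LHS](eq_bigr (fun a => \sum_d \sum_b \sum_c g a c * w c d * g b d * w a b)).
    apply: eq_bigr => a _; rewrite exchange_big/=; apply: eq_bigr => b _.
    by rewrite exchange_big/=; do 2!apply: eq_bigr => ? _; ring.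
  move=> a _; rewrite exchange_big mxE; apply: eq_bigr => b _; rewrite !mxE mulr_suml.
  by apply: eq_bigr => d _; rewrite !mxE !mulr_suml; apply: eq_bigr.
rewrite /bivector_eval.
transitivity (4^-1 * (S - (- S))); last by lra.
congr (_ * _); rewrite -S2 -sumrB; apply: eq_bigr => a _.
rewrite -sumrB; apply: eq_bigr => b _; rewrite -sumrB; apply: eq_bigr => c _.
by rewrite -sumrB; apply: eq_bigr => d _; rewrite /kulkarni_nomizu; field.
Qed.

End bivector.

(** * Contractions of a (0,4)-tensor under a change of frame *)

Section tensor_pullback.
Variables (n : nat) (K G H : 'M[R]_n).
Variables T T' : 'I_n -> 'I_n -> 'I_n -> 'I_n -> R.
Hypothesis TE : forall a b c d, T a b c d =
  \sum_p \sum_q K a p * K b q * \sum_r \sum_s K c r * K d s * T' p q r s.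
Hypothesis GH : K^T *m G *m K = H.

(** [TE] groups the slots a, b and c, d, whereas Ricci contracts a with c. The sums are regrouped so
    that [contract_pullback] applies to the pair a, c first. *)
Lemma tensor_ricci_pullback b d : \sum_a \sum_c G a c * T a b c d =
  \sum_q \sum_s K b q * K d s * \sum_p \sum_r H p r * T' p q r s.
Proof.
rewrite -GH; under eq_bigr do under eq_bigr do rewrite TE.
transitivity (\sum_a \sum_c G a c * (\sum_p \sum_r K a p * K c r *
   (\sum_q \sum_s K b q * K d s * T' p q r s))).
  apply: eq_bigr => a _; apply: eq_bigr => c _; congr (_ * _); apply: eq_bigr => p _.
  under eq_bigr do rewrite mulr_sumr.
  rewrite exchange_big/=; apply: eq_bigr => r _; rewrite mulr_sumr.
  apply: eq_bigr => q _; rewrite !mulr_sumr; apply: eq_bigr => s _; ring.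
rewrite contract_pullback.
under eq_bigr do under eq_bigr do rewrite mulr_sumr.
under eq_bigr do rewrite exchange_big/=.
rewrite exchange_big/=; apply: eq_bigr => q _.
under eq_bigr do under eq_bigr do rewrite mulr_sumr.
under eq_bigr do rewrite exchange_big/=.
rewrite exchange_big/=; apply: eq_bigr => s _.
rewrite mulr_sumr; apply: eq_bigr => p _; rewrite mulr_sumr; apply: eq_bigr => r _; ring.
Qed.

Lemma tensor_scal_pullback :
  \sum_b \sum_d G b d * (\sum_a \sum_c G a c * T a b c d) =
  \sum_b \sum_d H b d * (\sum_a \sum_c H a c * T' a b c d).
Proof.
under eq_bigr do under eq_bigr do rewrite tensor_ricci_pullback.
by rewrite contract_pullback GH.
Qed.

Lemma tensor_bivector_eval_pullback w :
  bivector_eval T w w = bivector_eval T' (K^T *m w *m K) (K^T *m w *m K).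
Proof.
rewrite !bivector_evalE -contract_pullback; congr (_ * _).
apply: eq_bigr => a _; apply: eq_bigr => b _; congr (_ * _).
under eq_bigr do under eq_bigr do rewrite TE.
rewrite [RHS](_ : _ = \sum_p \sum_q K a p * K b q *
   \sum_c \sum_d w c d * \sum_r \sum_s K c r * K d s * T' p q r s); last first.
  by apply: eq_bigr => p _; apply: eq_bigr => q _; rewrite contract_pullback.
under eq_bigr do under eq_bigr do rewrite mulr_sumr.
under eq_bigr do rewrite exchange_big/=.
rewrite exchange_big/=; apply: eq_bigr => p _.
under eq_bigr do under eq_bigr do rewrite mulr_sumr.
under eq_bigr do rewrite exchange_big/=.
rewrite exchange_big/=; apply: eq_bigr => q _.
rewrite mulr_sumr; apply: eq_bigr => c _; rewrite mulr_sumr; apply: eq_bigr => d _.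
by rewrite mulrCA.
Qed.

End tensor_pullback.
End tensor_algebra.

Section tensoriality.
Variables (R : realType) (n : nat) (g h : 'rV[R]_n -> 'M[R]_n) (x y : 'rV[R]_n) (K : 'M[R]_n).
Hypothesis uK : K \in unitmx.
Hypothesis uh : h y \in unitmx.
Hypothesis gE : g x = K *m h y *m K^T.
Hypothesis cE : forall i j, curvature_mx g i j x *m K =
  K *m \sum_a \sum_b (K i a * K j b) *: curvature_mx h a b y.

Lemma curvature_mx_mul (f : 'rV[R]_n -> 'M[R]_n) z a b c d :
  curvature f z a b c d = (curvature_mx f a b z *m f z) d c.
Proof. by rewrite mxE; apply: eq_bigr => l _; rewrite mxE mulrC. Qed.

Lemma curvature_pullback a b c d : curvature g x a b c d =
  \sum_p \sum_q K a p * K b q * \sum_r \sum_s K c r * K d s * curvature h y p q r s.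
Proof.
rewrite curvature_mx_mul gE !mulmxA cE mulmx_sumr !mulmx_suml summxE.
apply: eq_bigr => p _; rewrite mulmx_sumr !mulmx_suml summxE; apply: eq_bigr => q _.
rewrite -scalemxAr -!scalemxAl mxE; congr (_ * _).
rewrite -(mulmxA K) mxE; apply: eq_bigr => r _; rewrite mxE mulr_suml.
by apply: eq_bigr => s _; rewrite !mxE curvature_mx_mul mxE; ring.
Qed.

Lemma invmx_pullback : K^T *m invmx (g x) *m K = invmx (h y).
Proof.
have uKT : K^T \in unitmx by rewrite unitmx_tr.
have ug : g x \in unitmx by rewrite gE !unitmx_mul uK uh uKT.
have KhE : K *m h y = g x *m invmx K^T by rewrite gE mulmxK.
have E : K^T *m invmx (g x) *m K *m h y = 1%:M.
  by rewrite -mulmxA KhE mulmxA mulmxKV// mulmxV.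
by rewrite -[LHS]mulmx1 -(mulmxV uh) mulmxA E mul1mx.
Qed.

Lemma scal_pullback : scal g x = scal h y.
Proof. exact: (tensor_scal_pullback curvature_pullback invmx_pullback). Qed.

Lemma bivector_eval_curvature_pullback w :
  bivector_eval (curvature g x) w w =
  bivector_eval (curvature h y) (K^T *m w *m K) (K^T *m w *m K).
Proof. exact: (tensor_bivector_eval_pullback curvature_pullback). Qed.

Lemma bivector_norm_pullback w :
  bivector_norm (g x) w = bivector_norm (h y) (K^T *m w *m K).
Proof.
rewrite /bivector_norm gE; congr (_ * _).
by rewrite !trmx_mul !trmxK -![in LHS]mulmxA mxtrace_mulC !mulmxA.
Qed.

End tensoriality.

(** * Products and rescalings *)

Section product_derivatives.
Variables (R : realType) (n1 n2 : nat).
Implicit Types z v : 'rV[R]_(n1 + n2).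

(** Both difference quotients are the same function of t. The identity therefore holds at every
    point, also where F is not smooth, and can be used under [funext]. *)
Lemma derive_comp_lsubmx (W : normedModType R) (F : 'rV[R]_n1 -> W) z v :
  'D_v (fun y : 'rV[R]_(n1 + n2) => F (lsubmx y)) z = 'D_(lsubmx v) F (lsubmx z).
Proof.
rewrite /derive.
have -> : (fun t : R => t^-1 *: (((fun y : 'rV[R]_(n1 + n2) => F (lsubmx y)) \o shift z) (t *: v)
    - F (lsubmx z))) =
  (fun t => t^-1 *: ((F \o shift (lsubmx z)) (t *: lsubmx v) - F (lsubmx z))).
  by apply/funext => t /=; congr (_ *: (F _ - _)); apply/rowP => j; rewrite !mxE.
by [].
Qed.

Lemma derive_comp_rsubmx (W : normedModType R) (F : 'rV[R]_n2 -> W) z v :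
  'D_v (fun y : 'rV[R]_(n1 + n2) => F (rsubmx y)) z = 'D_(rsubmx v) F (rsubmx z).
Proof.
rewrite /derive.
have -> : (fun t : R => t^-1 *: (((fun y : 'rV[R]_(n1 + n2) => F (rsubmx y)) \o shift z) (t *: v)
    - F (rsubmx z))) =
  (fun t => t^-1 *: ((F \o shift (rsubmx z)) (t *: rsubmx v) - F (rsubmx z))).
  by apply/funext => t /=; congr (_ *: (F _ - _)); apply/rowP => j; rewrite !mxE.
by [].
Qed.

Lemma smooth_on_comp_lsubmx (W : normedModType R) (U1 : set 'rV[R]_n1) (U2 : set 'rV[R]_n2)
    (F : 'rV[R]_n1 -> W) : smooth_on U1 F ->
  smooth_on [set z : 'rV[R]_(n1 + n2) | U1 (lsubmx z) /\ U2 (rsubmx z)] (fun z => F (lsubmx z)).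
Proof.
move=> cF k; move: (cF k) => {cF}; elim: k F => [|k IHk] F /=.
  move=> cF x [U1x _]; apply: continuous_comp (cF _ U1x).
  exact: continuous_lsubmx.
move=> [dF cF]; split=> [x [U1x _]|v].
  apply: (@differentiable_comp _ _ _ _ (@lsubmx R 1 n1 n2) F); last exact: dF.
  exact: differentiable_lsubmx.
have -> : (fun x : 'rV[R]_(n1 + n2) => 'D_v (fun z => F (lsubmx z)) x) =
    (fun x => 'D_(lsubmx v) F (lsubmx x)).
  by apply/funext => x; exact: derive_comp_lsubmx.
exact: (IHk _ (cF (lsubmx v))).
Qed.

Lemma smooth_on_comp_rsubmx (W : normedModType R) (U1 : set 'rV[R]_n1) (U2 : set 'rV[R]_n2)
    (F : 'rV[R]_n2 -> W) : smooth_on U2 F ->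
  smooth_on [set z : 'rV[R]_(n1 + n2) | U1 (lsubmx z) /\ U2 (rsubmx z)] (fun z => F (rsubmx z)).
Proof.
move=> cF k; move: (cF k) => {cF}; elim: k F => [|k IHk] F /=.
  move=> cF x [_ U2x]; apply: continuous_comp (cF _ U2x).
  exact: continuous_rsubmx.
move=> [dF cF]; split=> [x [_ U2x]|v].
  apply: (@differentiable_comp _ _ _ _ (@rsubmx R 1 n1 n2) F); last exact: dF.
  exact: differentiable_rsubmx.
have -> : (fun x : 'rV[R]_(n1 + n2) => 'D_v (fun z => F (rsubmx z)) x) =
    (fun x => 'D_(rsubmx v) F (rsubmx x)).
  by apply/funext => x; exact: derive_comp_rsubmx.
exact: (IHk _ (cF (rsubmx v))).
Qed.

Lemma lsubmx_delta_lshift i : lsubmx ('e_(lshift n2 i) : 'rV[R]_(n1 + n2)) = 'e_i.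
Proof. by apply/rowP => j; rewrite !mxE eq_lshift. Qed.

Lemma rsubmx_delta_lshift i : rsubmx ('e_(lshift n2 i) : 'rV[R]_(n1 + n2)) = 0.
Proof. by apply/rowP => j; rewrite !mxE eq_rlshift. Qed.

Lemma lsubmx_delta_rshift i : lsubmx ('e_(rshift n1 i) : 'rV[R]_(n1 + n2)) = 0.
Proof. by apply/rowP => j; rewrite !mxE eq_lrshift. Qed.

Lemma rsubmx_delta_rshift i : rsubmx ('e_(rshift n1 i) : 'rV[R]_(n1 + n2)) = 'e_i.
Proof. by apply/rowP => j; rewrite !mxE eq_rshift. Qed.

Lemma derive_block_diag p q (V : normedModType R) (A : V -> 'M[R]_p) (B : V -> 'M[R]_q) (x v : V) :
  differentiable A x -> differentiable B x ->
  differentiable (fun y => block_mx (A y) 0 0 (B y)) x /\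
  'D_v (fun y => block_mx (A y) 0 0 (B y)) x = block_mx ('D_v A x) 0 0 ('D_v B x).
Proof.
move=> dA dB.
have d0 : differentiable (fun _ : V => (0 : R)) x by exact: differentiable_cst.
have Eul i j : (fun y => block_mx (A y) 0 0 (B y) (lshift q i) (lshift q j)) = fun y => A y i j.
  by apply/funext => y; rewrite block_mxEul.
have Eur i j : (fun y => block_mx (A y) 0 0 (B y) (lshift q i) (rshift p j)) = fun y => 0.
  by apply/funext => y; rewrite block_mxEur mxE.
have Edl i j : (fun y => block_mx (A y) 0 0 (B y) (rshift p i) (lshift q j)) = fun y => 0.
  by apply/funext => y; rewrite block_mxEdl mxE.
have Edr i j : (fun y => block_mx (A y) 0 0 (B y) (rshift p i) (rshift p j)) = fun y => B y i j.
  by apply/funext => y; rewrite block_mxEdr.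
have dF : differentiable (fun y => block_mx (A y) 0 0 (B y)) x.
  apply: differentiable_mxP => i j.
  case: (split_ordP i) => {i}i ->; case: (split_ordP j) => {j}j ->.
  - by rewrite Eul; exact: differentiable_mx_coord.
  - by rewrite Eur.
  - by rewrite Edl.
  - by rewrite Edr; exact: differentiable_mx_coord.
split=> //; apply/matrixP => i j; rewrite derive_mx_coord//.
case: (split_ordP i) => {i}i ->; case: (split_ordP j) => {j}j ->.
- by rewrite Eul block_mxEul derive_mx_coord.
- by rewrite Eur block_mxEur mxE derive_cst.
- by rewrite Edl block_mxEdl mxE derive_cst.
- by rewrite Edr block_mxEdr derive_mx_coord.
Qed.

End product_derivatives.

Lemma unitmx_block_diag (R : comUnitRingType) p q (A : 'M[R]_p) (B : 'M[R]_q) :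
  (block_mx A 0 0 B \in unitmx) = (A \in unitmx) && (B \in unitmx).
Proof. by rewrite !unitmxE det_ublock unitrM. Qed.

Section block_family.
Variables (R : pzRingType) (n1 n2 : nat).
Variables (C1 : 'I_n1 -> 'M[R]_n1) (C2 : 'I_n2 -> 'M[R]_n2).

(** The index is a direction of differentiation: along a coordinate of one factor, only the
    connection of that factor acts. *)
Definition block_family (i : 'I_(n1 + n2)) : 'M[R]_(n1 + n2) :=
  match fintype.split i with
  | inl i => block_mx (C1 i) 0 0 0
  | inr i => block_mx 0 0 0 (C2 i)
  end.

Lemma block_family_lshift i : block_family (lshift n2 i) = block_mx (C1 i) 0 0 0.
Proof. by rewrite /block_family -[lshift n2 i]/(unsplit (inl i)) unsplitK. Qed.

Lemma block_family_rshift i : block_family (rshift n1 i) = block_mx 0 0 0 (C2 i).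
Proof. by rewrite /block_family -[rshift n1 i]/(unsplit (inr i)) unsplitK. Qed.

Lemma block_family_sym :
  (forall i j k, C1 i j k = C1 j i k) -> (forall i j k, C2 i j k = C2 j i k) ->
  forall i j k, block_family i j k = block_family j i k.
Proof.
move=> s1 s2 a b c.
have zE p q (k : 'I_p) (l : 'I_q) : (0 : 'M[R]_(p, q)) k l = 0 by rewrite mxE.
case: (split_ordP a) => {a}a ->; case: (split_ordP b) => {b}b ->;
  case: (split_ordP c) => {c}c ->;
  by rewrite !(block_family_lshift, block_family_rshift)
      !(block_mxEul, block_mxEur, block_mxEdl, block_mxEdr) ?zE.
Qed.

End block_family.

Lemma block_bracket_l (R : pzRingType) p q (A B C D : 'M[R]_p) :
  let L X : 'M[R]_(p + q) := block_mx X 0 0 0 in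
  L A - L B + (L C *m L D - L D *m L C) = L (A - B + (C *m D - D *m C)).
Proof.
rewrite /= !mulmx_block !(mulmx0, mul0mx, addr0).
by rewrite !(opp_block_mx, add_block_mx) !oppr0 !addr0.
Qed.

Lemma block_bracket_r (R : pzRingType) p q (A B C D : 'M[R]_q) :
  let L X : 'M[R]_(p + q) := block_mx 0 0 0 X in
  L A - L B + (L C *m L D - L D *m L C) = L (A - B + (C *m D - D *m C)).
Proof.
rewrite /= !mulmx_block !(mulmx0, mul0mx, add0r).
by rewrite !(opp_block_mx, add_block_mx) !oppr0 !addr0.
Qed.

Section curvature_traces.
Variables (R : realType) (n : nat) (g : 'rV[R]_n -> 'M[R]_n) (x : 'rV[R]_n).

(** Ricci is the trace of the curvature endomorphism: the metric that lowers the index cancels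
    against its inverse. Its behaviour on products and under rescaling then follows from that of the
    curvature matrices. *)
Lemma ricciE b d : g x \in unitmx -> (g x)^T = g x ->
  ricci g x b d = \sum_a curvature_mx g a b x d a.
Proof.
move=> ug sg; rewrite /ricci; apply: eq_bigr => a _.
have -> : curvature_mx g a b x = curvature_mx g a b x *m g x *m invmx (g x).
  by rewrite mulmxK.
rewrite [RHS]mxE; apply: eq_bigr => c _; rewrite curvature_mx_mul mulrC; congr (_ * _).
by rewrite -[in LHS]sg -trmx_inv mxE.
Qed.

Lemma bivector_eval_curvature w : bivector_eval (curvature g x) w w =
  4^-1 * \sum_a \sum_b w a b * \tr (w *m (curvature_mx g a b x *m g x)).
Proof.
rewrite bivector_evalE; congr (_ * _); apply: eq_bigr => a _; apply: eq_bigr => b _.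
congr (_ * _); rewrite /mxtrace; apply: eq_bigr => c _; rewrite [RHS]mxE.
by apply: eq_bigr => d _; rewrite curvature_mx_mul.
Qed.

End curvature_traces.

(** * Curvature of a product metric *)

Section product_curvature.
Variables (R : realType) (n1 n2 : nat).
Variables (U1 : set 'rV[R]_n1) (U2 : set 'rV[R]_n2).
Variables (g1 : 'rV[R]_n1 -> 'M[R]_n1) (g2 : 'rV[R]_n2 -> 'M[R]_n2).
Hypotheses (oU1 : open U1) (oU2 : open U2).
Hypotheses (cg1 : smooth_on U1 g1) (cg2 : smooth_on U2 g2).
Hypotheses (sg1 : forall x, U1 x -> (g1 x)^T = g1 x) (sg2 : forall x, U2 x -> (g2 x)^T = g2 x).
Hypotheses (ug1 : forall x, U1 x -> g1 x \in unitmx) (ug2 : forall x, U2 x -> g2 x \in unitmx).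

Definition block_metric (z : 'rV[R]_(n1 + n2)) : 'M[R]_(n1 + n2) :=
  block_mx (g1 (lsubmx z)) 0 0 (g2 (rsubmx z)).

Local Notation g := block_metric.
Local Notation U := [set z : 'rV[R]_(n1 + n2) | U1 (lsubmx z) /\ U2 (rsubmx z)].

Let oU : open U := open_rowset oU1 oU2.

Let diff_l (W : normedModType R) (F : 'rV[R]_n1 -> W) (z : 'rV[R]_(n1 + n2)) :
  differentiable F (lsubmx z) -> differentiable (fun y : 'rV[R]_(n1 + n2) => F (lsubmx y)) z.
Proof.
move=> dF; apply: (@differentiable_comp _ _ _ _ (@lsubmx R 1 n1 n2) F) => //.
exact: differentiable_lsubmx.
Qed.

Let diff_r (W : normedModType R) (F : 'rV[R]_n2 -> W) (z : 'rV[R]_(n1 + n2)) :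
  differentiable F (rsubmx z) -> differentiable (fun y : 'rV[R]_(n1 + n2) => F (rsubmx y)) z.
Proof.
move=> dF; apply: (@differentiable_comp _ _ _ _ (@rsubmx R 1 n1 n2) F) => //.
exact: differentiable_rsubmx.
Qed.

Let derive_block (F1 : 'rV[R]_n1 -> 'M[R]_n1) (F2 : 'rV[R]_n2 -> 'M[R]_n2) z v :
  differentiable F1 (lsubmx z) -> differentiable F2 (rsubmx z) ->
  'D_v (fun z => block_mx (F1 (lsubmx z)) 0 0 (F2 (rsubmx z))) z =
   block_mx ('D_(lsubmx v) F1 (lsubmx z)) 0 0 ('D_(rsubmx v) F2 (rsubmx z)).
Proof.
move=> d1 d2; apply: etrans (derive_block_diag v (diff_l d1) (diff_r d2)).2 _.
by rewrite derive_comp_lsubmx derive_comp_rsubmx.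
Qed.

Lemma block_metric_sym z : U z -> (g z)^T = g z.
Proof. by move=> [z1 z2]; rewrite /block_metric tr_block_mx !trmx0 sg1// sg2. Qed.

Lemma block_metric_unit z : U z -> g z \in unitmx.
Proof. by move=> [z1 z2]; rewrite unitmx_block_diag ug1// ug2. Qed.

Let dg1 z : U z -> differentiable g1 (lsubmx z).
Proof. by move=> [z1 z2]; exact: smooth_on_differentiable cg1 z1. Qed.
Let dg2 z : U z -> differentiable g2 (rsubmx z).
Proof. by move=> [z1 z2]; exact: smooth_on_differentiable cg2 z2. Qed.

Let near_sym (m : nat) (V : set 'rV[R]_m) (f : 'rV[R]_m -> 'M[R]_m) x : open V ->
  (forall x, V x -> (f x)^T = f x) -> V x -> \forall y \near x, (f y)^T = f y.
Proof.
move=> oV sf Vx; near=> y; apply: sf; near: y; exact: open_nbhs_nbhs.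
Unshelve. all: by end_near. Qed.

Definition block_connection i (z : 'rV[R]_(n1 + n2)) : 'M[R]_(n1 + n2) :=
  block_family (connection_mx g1 ^~ (lsubmx z)) (connection_mx g2 ^~ (rsubmx z)) i.

Let block_connection_l i z :
  block_connection (lshift n2 i) z = block_mx (connection_mx g1 i (lsubmx z)) 0 0 0.
Proof. exact: block_family_lshift. Qed.

Let block_connection_r i z :
  block_connection (rshift n1 i) z = block_mx 0 0 0 (connection_mx g2 i (rsubmx z)).
Proof. exact: block_family_rshift. Qed.

(** By uniqueness: differentiating g along a coordinate of one factor leaves only the block of that
    factor, where compatibility is the one already known. *)
Lemma connection_mx_block i z : U z -> connection_mx g i z = block_connection i z.
Proof.
move=> Uz; apply: (connection_mx_unique (G := fun i => block_connection i z)).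
- exact: (derive_block_diag 0 (diff_l (dg1 Uz)) (diff_r (dg2 Uz))).1.
- exact: block_metric_unit.
- exact: block_metric_sym.
- apply: block_family_sym => a b c.
    exact: connection_mx_torsion_free (near_sym oU1 sg1 Uz.1).
  exact: connection_mx_torsion_free (near_sym oU2 sg2 Uz.2).
move=> a; rewrite [LHS](derive_block _ (dg1 Uz) (dg2 Uz)).
have c1 i := connection_mx_compatible i (dg1 Uz) (ug1 Uz.1) (near_sym oU1 sg1 Uz.1).
have c2 i := connection_mx_compatible i (dg2 Uz) (ug2 Uz.2) (near_sym oU2 sg2 Uz.2).
case: (split_ordP a) => {a}a ->.
  rewrite lsubmx_delta_lshift rsubmx_delta_lshift derive0 (c1 a) block_connection_l.
  by rewrite mulmx_block !mulmx0 !mul0mx !addr0 tr_block_mx !trmx0 add_block_mx !addr0.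
rewrite lsubmx_delta_rshift rsubmx_delta_rshift derive0 (c2 a) block_connection_r.
by rewrite mulmx_block !mulmx0 !mul0mx !add0r tr_block_mx !trmx0 add_block_mx !addr0.
Qed.

Lemma smooth_on_block_metric : smooth_on U g.
Proof.
apply/(smooth_on_mxP oU) => i j; rewrite /block_metric.
case: (split_ordP i) => {i}i ->; case: (split_ordP j) => {j}j ->.
- apply: (smooth_on_ext oU (f := fun z => g1 (lsubmx z) i j)) => [z _|].
    by rewrite block_mxEul.
  have H := (smooth_on_mxP oU1 g1).1 cg1 i j.
  exact: (smooth_on_comp_lsubmx _ H).
- apply: (smooth_on_ext oU (f := fun z => 0)) => [z _|k].
    by rewrite block_mxEur mxE.
  exact: Ck_on_cst.
- apply: (smooth_on_ext oU (f := fun z => 0)) => [z _|k].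
    by rewrite block_mxEdl mxE.
  exact: Ck_on_cst.
apply: (smooth_on_ext oU (f := fun z => g2 (rsubmx z) i j)) => [z _|].
  by rewrite block_mxEdr.
have H := (smooth_on_mxP oU2 g2).1 cg2 i j.
  exact: (smooth_on_comp_rsubmx _ H).
Qed.

Let dc1 i z : U z -> differentiable (connection_mx g1 i) (lsubmx z).
Proof.
by move=> [z1 z2]; exact: smooth_on_differentiable (smooth_on_connection_mx oU1 i cg1 ug1) z1.
Qed.
Let dc2 i z : U z -> differentiable (connection_mx g2 i) (rsubmx z).
Proof.
by move=> [z1 z2]; exact: smooth_on_differentiable (smooth_on_connection_mx oU2 i cg2 ug2) z2.
Qed.

Let derive_connection i v z : U z ->
  'D_v (connection_mx g i) z = 'D_v (block_connection i) z.
Proof.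
move=> Uz; apply: near_eq_derive; near=> y; apply: connection_mx_block.
by near: y; exact: open_nbhs_nbhs.
Unshelve. all: by end_near. Qed.

Let derive_connection_l i v z : U z -> 'D_v (connection_mx g (lshift n2 i)) z =
  block_mx ('D_(lsubmx v) (connection_mx g1 i) (lsubmx z)) 0 0 0.
Proof.
move=> Uz; apply: etrans (derive_connection _ v Uz) _.
have -> : block_connection (lshift n2 i) =
    fun z => block_mx (connection_mx g1 i (lsubmx z)) 0 0 (cst 0 (rsubmx z)).
  by apply/funext => y; rewrite block_connection_l.
apply: etrans (derive_block v (dc1 i Uz) _) _; first exact: differentiable_cst.
by rewrite derive_cst.
Qed.

Let derive_connection_r i v z : U z -> 'D_v (connection_mx g (rshift n1 i)) z =
  block_mx 0 0 0 ('D_(rsubmx v) (connection_mx g2 i) (rsubmx z)).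
Proof.
move=> Uz; apply: etrans (derive_connection _ v Uz) _.
have -> : block_connection (rshift n1 i) =
    fun z => block_mx (cst 0 (lsubmx z)) 0 0 (connection_mx g2 i (rsubmx z)).
  by apply/funext => y; rewrite block_connection_r.
apply: etrans (derive_block v _ (dc2 i Uz)) _; first exact: differentiable_cst.
by rewrite derive_cst.
Qed.

Let curvature_block_mxE i j z (Uz : U z) :=
  curvature_mxE oU i j smooth_on_block_metric block_metric_unit Uz.

Lemma curvature_mx_block_ll i j z : U z ->
  curvature_mx g (lshift n2 i) (lshift n2 j) z =
  block_mx (curvature_mx g1 i j (lsubmx z)) 0 0 0.
Proof.
move=> Uz; apply: etrans (curvature_block_mxE _ _ Uz) _.
rewrite !derive_connection_l// !connection_mx_block// !block_connection_l.
rewrite !lsubmx_delta_lshift (curvature_mxE oU1 i j cg1 ug1 Uz.1).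
exact: block_bracket_l.
Qed.

Lemma curvature_mx_block_rr i j z : U z ->
  curvature_mx g (rshift n1 i) (rshift n1 j) z =
  block_mx 0 0 0 (curvature_mx g2 i j (rsubmx z)).
Proof.
move=> Uz; apply: etrans (curvature_block_mxE _ _ Uz) _.
rewrite !derive_connection_r// !connection_mx_block// !block_connection_r.
rewrite !rsubmx_delta_rshift (curvature_mxE oU2 i j cg2 ug2 Uz.2).
exact: block_bracket_r.
Qed.

(** Each connection is constant along the other factor, so the derivative terms vanish; the two
    block matrices have product zero in either order, so the commutator vanishes too. *)
Lemma curvature_mx_block_lr i j z : U z ->
  curvature_mx g (lshift n2 i) (rshift n1 j) z = 0.
Proof.
move=> Uz; apply: etrans (curvature_block_mxE _ _ Uz) _.
rewrite derive_connection_r// derive_connection_l// !connection_mx_block//.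
rewrite block_connection_r block_connection_l.
rewrite lsubmx_delta_rshift rsubmx_delta_lshift !derive0.
by rewrite !mulmx_block !(mulmx0, mul0mx, addr0) !block_mx0 !subr0 ?addr0.
Qed.

Lemma curvature_mx_block_rl i j z : U z ->
  curvature_mx g (rshift n1 i) (lshift n2 j) z = 0.
Proof.
move=> Uz; apply: etrans (curvature_block_mxE _ _ Uz) _.
rewrite derive_connection_r// derive_connection_l// !connection_mx_block//.
rewrite block_connection_r block_connection_l.
rewrite lsubmx_delta_rshift rsubmx_delta_lshift !derive0.
by rewrite !mulmx_block !(mulmx0, mul0mx, addr0) !block_mx0 !subr0 ?addr0.
Qed.

Lemma scal_block z : U z -> scal g z = scal g1 (lsubmx z) + scal g2 (rsubmx z).
Proof.
move=> Uz; have ug := block_metric_unit Uz; have sg := block_metric_sym Uz.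
have rE b d := ricciE b d ug sg.
have rE1 b d := ricciE b d (ug1 Uz.1) (sg1 Uz.1).
have rE2 b d := ricciE b d (ug2 Uz.2) (sg2 Uz.2).
have iE : invmx (g z) = block_mx (invmx (g1 (lsubmx z))) 0 0 (invmx (g2 (rsubmx z))).
  exact: invmx_block_diag.
rewrite /scal iE big_split_ord; congr (_ + _); apply: eq_bigr => b _.
  rewrite big_split_ord /= [X in _ + X]big1 ?addr0 => [|d _]; last by rewrite block_mxEur mxE mul0r.
  apply: eq_bigr => d _; rewrite block_mxEul; congr (_ * _); apply: etrans (rE _ _) _.
  rewrite big_split_ord /= [X in _ + X]big1 ?addr0 => [|a _].
    by rewrite rE1; apply: eq_bigr => a _; rewrite curvature_mx_block_ll// block_mxEul.
  by rewrite curvature_mx_block_rl// mxE.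
rewrite big_split_ord /= [X in X + _]big1 ?add0r => [|d _]; last by rewrite block_mxEdl mxE mul0r.
apply: eq_bigr => d _; rewrite block_mxEdr; congr (_ * _); apply: etrans (rE _ _) _.
rewrite big_split_ord /= [X in X + _]big1 ?add0r => [|a _].
  by rewrite rE2; apply: eq_bigr => a _; rewrite curvature_mx_block_rr// block_mxEdr.
by rewrite curvature_mx_block_lr// mxE.
Qed.

Lemma bivector_eval_curvature_block w z : U z ->
  bivector_eval (curvature g z) w w =
  bivector_eval (curvature g1 (lsubmx z)) (ulsubmx w) (ulsubmx w) +
  bivector_eval (curvature g2 (rsubmx z)) (drsubmx w) (drsubmx w).
Proof.
move=> Uz; rewrite !bivector_eval_curvature -mulrDr; congr (_ * _).
rewrite big_split_ord; congr (_ + _); apply: eq_bigr => a _.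
  rewrite big_split_ord /= [X in _ + X]big1 ?addr0 => [|b _]; last first.
    by rewrite curvature_mx_block_lr// mul0mx mulmx0 mxtrace0 mulr0.
  apply: eq_bigr => b _; rewrite curvature_mx_block_ll// /block_metric.
  rewrite -{2}[w]submxK !mulmx_block !(mulmx0, mul0mx, addr0) mxtrace_block mxtrace0 addr0.
  by rewrite !mxE.
rewrite big_split_ord /= [X in X + _]big1 ?add0r => [|b _]; last first.
  by rewrite curvature_mx_block_rl// mul0mx mulmx0 mxtrace0 mulr0.
apply: eq_bigr => b _; rewrite curvature_mx_block_rr// /block_metric.
rewrite -{2}[w]submxK !mulmx_block !(mulmx0, mul0mx, add0r) mxtrace_block mxtrace0 add0r.
by rewrite !mxE.
Qed.

End product_curvature.

Lemma bivector_norm_block (R : realType) n1 n2 (A : 'M[R]_n1) (B : 'M[R]_n2) (w : 'M[R]_(n1 + n2)) :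
  bivector_norm (block_mx A 0 0 B) w =
  bivector_norm A (ulsubmx w) + bivector_norm B (drsubmx w) +
  2^-1 * (\tr (A *m ursubmx w *m B^T *m (ursubmx w)^T) +
          \tr (B *m dlsubmx w *m A^T *m (dlsubmx w)^T)).
Proof.
rewrite /bivector_norm -!mulrDr; congr (_ * _); rewrite -{1 2}[w]submxK.
rewrite !tr_block_mx !trmx0 !mulmx_block !(mulmx0, mul0mx, add0r, addr0) mxtrace_block.
by rewrite !mxtraceD; ring.
Qed.

(** * Curvature of a rescaled metric *)

Section scaling.
Variables (R : realType) (n : nat) (U : set 'rV[R]_n) (g : 'rV[R]_n -> 'M[R]_n) (s : R).
Hypotheses (oU : open U) (cg : smooth_on U g) (s0 : 0 < s).
Hypotheses (sg : forall x, U x -> (g x)^T = g x) (ug : forall x, U x -> g x \in unitmx).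

Local Notation sG := (fun x => s *: g x).

Lemma scale_metric_unit x : U x -> s *: g x \in unitmx.
Proof. by move=> Ux; rewrite unitmxZ ?ug// unitfE gt_eqF. Qed.

Lemma scale_metric_sym x : U x -> (s *: g x)^T = s *: g x.
Proof. by move=> Ux; rewrite linearZ/= sg. Qed.

Lemma smooth_on_scale_metric : smooth_on U sG.
Proof.
apply/(smooth_on_mxP oU) => i j.
apply: (smooth_on_ext oU (f := fun x => s * g x i j)) => [x _|k]; first by rewrite mxE.
by apply: Ck_onM => //; [exact: Ck_on_cst|exact: (smooth_on_mxP oU g).1].
Qed.

(** Torsion-freeness does not mention the metric and compatibility is linear in it, so the
    connection of g passes the uniqueness test for s g. *)
Lemma connection_mx_scale i x : U x -> connection_mx sG i x = connection_mx g i x.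
Proof.
move=> Ux; have dg : differentiable g x := smooth_on_differentiable cg Ux.
have nsg : \forall y \near x, (g y)^T = g y.
  by near=> y; apply: sg; near: y; exact: open_nbhs_nbhs.
apply: (connection_mx_unique (G := fun i => connection_mx g i x)).
- exact: smooth_on_differentiable smooth_on_scale_metric Ux.
- exact: scale_metric_unit.
- exact: scale_metric_sym.
- by move=> a b c; exact: connection_mx_torsion_free.
move=> a; transitivity (s *: 'D_('e_a) g x).
  by apply: (@deriveZ _ _ _ g); exact: diff_derivable.
by rewrite (connection_mx_compatible a dg (ug Ux) nsg) -scalemxAr linearZ/= scalerDr.
Unshelve. all: by end_near. Qed.

Lemma curvature_mx_scale i j x : U x -> curvature_mx sG i j x = curvature_mx g i j x.
Proof.
move=> Ux.
have D a v : 'D_v (connection_mx sG a) x = 'D_v (connection_mx g a) x.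
  apply: near_eq_derive; near=> y; apply: connection_mx_scale.
  by near: y; exact: open_nbhs_nbhs.
apply: etrans (curvature_mxE oU i j smooth_on_scale_metric scale_metric_unit Ux) _.
apply: etrans (esym (curvature_mxE oU i j cg ug Ux)).
have Ci := connection_mx_scale i Ux; have Cj := connection_mx_scale j Ux.
apply: f_equal2; apply: f_equal2; first exact: D.
- by apply: congr1; exact: D.
- exact: (f_equal2 mulmx Cj Ci).
- by apply: congr1; exact: (f_equal2 mulmx Ci Cj).
Unshelve. all: by end_near. Qed.

Lemma scal_scale x : U x -> scal sG x = s^-1 * scal g x.
Proof.
move=> Ux; rewrite /scal mulr_sumr; apply: eq_bigr => b _; rewrite mulr_sumr.
apply: eq_bigr => d _; rewrite (ricciE b d (scale_metric_unit Ux) (scale_metric_sym Ux)).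
rewrite (ricciE b d (ug Ux) (sg Ux)) invmxZ ?scale_metric_unit// mxE mulrA.
by congr (_ * _); apply: eq_bigr => a _; rewrite curvature_mx_scale.
Qed.

(** The endomorphisms are unchanged and lowering one index costs a single factor s, against s * s in
    [bivector_norm_scale]; this discrepancy is what a large s exploits. *)
Lemma bivector_eval_curvature_scale x w : U x ->
  bivector_eval (curvature sG x) w w = s * bivector_eval (curvature g x) w w.
Proof.
move=> Ux; rewrite !bivector_eval_curvature mulrCA; congr (_ * _); rewrite mulr_sumr.
apply: eq_bigr => a _; rewrite mulr_sumr; apply: eq_bigr => b _.
by rewrite curvature_mx_scale// -!scalemxAr mxtraceZ mulrCA.
Qed.

End scaling.

Lemma bivector_norm_scale (R : realType) n (s : R) (A w : 'M[R]_n) :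
  bivector_norm (s *: A) w = s * s * bivector_norm A w.
Proof.
rewrite /bivector_norm linearZ/= -!scalemxAl -scalemxAr -scalemxAl scalerA mxtraceZ.
by rewrite mulrCA.
Qed.

(** * Positive definite matrices and bivectors *)

Section positive_matrices.
Variable R : realType.

Definition posdef_mx n (A : 'M[R]_n) := forall v : 'rV[R]_n, v != 0 -> 0 < (v *m A *m v^T) 0 0.

(** Induction on the Schur complement [S] of the corner entry. The factorization turns traces of the
    form tr(A u B u^T) into squared Frobenius norms and so replaces spectral theory in the
    estimates. *)
Lemma cholesky n (A : 'M[R]_n) : A^T = A -> posdef_mx A ->
  exists2 P : 'M[R]_n, P \in unitmx & A = P *m P^T.
Proof.
elim: n A => [|n IHn] A sA pA.
  exists 1%:M; first exact: unitmx1.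
  by apply/matrixP => -[].
rewrite -[n.+1]/(1 + n)%N in A sA pA *.
pose a := A 0 0; pose b := ursubmx A; pose C := drsubmx A.
have ulA : ulsubmx A = a%:M by rewrite [LHS]mx11_scalar !mxE; congr (A _ _)%:M; apply/val_inj.
have dlA : dlsubmx A = b^T by rewrite /b -[in LHS]sA -trmx_ursub.
have AE : A = block_mx a%:M b b^T C by rewrite -[LHS]submxK ulA dlA.
have sC : C^T = C by rewrite /C trmx_drsub sA.
have qE (t : R) (v : 'rV[R]_n) : (row_mx t%:M v *m A *m (row_mx t%:M v)^T) 0 0 =
   t * t * a + 2 * t * (v *m b^T) 0 0 + (v *m C *m v^T) 0 0.
  rewrite AE mul_row_block tr_row_mx mul_row_col !mulmxDl tr_scalar_mx.
  rewrite -!scalar_mxM !mul_scalar_mx -!scalemxAl !mul_mx_scalar.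
  have -> : b *m v^T = (v *m b^T)^T by rewrite trmx_mul trmxK.
  by rewrite !mxE eqxx mulr1n; ring.
have a0 : 0 < a.
  have := pA (row_mx 1%:M 0); rewrite qE !mul0mx !mxE mulr0 !mul1r !addr0; apply.
  rewrite row_mx_eq0 negb_and; apply/orP; left.
  by apply/eqP => /matrixP/(_ 0 0)/eqP; rewrite !mxE eqxx oner_eq0.
have a0' : a != 0 by rewrite gt_eqF.
pose S := C - a^-1 *: (b^T *m b).
have sS : S^T = S by rewrite /S linearB linearZ/= sC trmx_mul trmxK.
have pS : posdef_mx S.
  (* This [t] minimizes the quadratic polynomial of [qE], and the minimum is the value of the Schur
     complement at v. *)
  move=> v v0; pose t := - (a^-1 * (v *m b^T) 0 0).
  have := pA (row_mx t%:M v); rewrite row_mx_eq0 (negbTE v0) andbF => /(_ isT).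
  have qS : (v *m S *m v^T) 0 0 =
      (v *m C *m v^T) 0 0 - a^-1 * ((v *m b^T) 0 0 * (v *m b^T) 0 0).
    have E : v *m (b^T *m b) *m v^T = ((v *m b^T) 0 0 * (v *m b^T) 0 0)%:M.
      have -> : v *m (b^T *m b) *m v^T = (v *m b^T) *m (v *m b^T)^T.
        by rewrite trmx_mul trmxK !mulmxA.
      by rewrite [v *m b^T]mx11_scalar tr_scalar_mx -scalar_mxM !mxE eqxx !mulr1n.
    rewrite /S mulmxBr mulmxBl -scalemxAr -scalemxAl E.
    move: (v *m C *m v^T) ((v *m b^T) 0 0) => X y.
    by rewrite !mxE eqxx mulr1n.
  rewrite qE qS; congr (0 < _); rewrite /t.
  by move: ((v *m b^T) 0 0) ((v *m C *m v^T) 0 0) => c d; field.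
have [Q uQ SE] := IHn S sS pS.
pose r := Num.sqrt a.
have r2 : r * r = a by rewrite -expr2 sqr_sqrtr// ltW.
have r0 : r != 0 by rewrite gt_eqF// sqrtr_gt0.
exists (block_mx r%:M 0 (r^-1 *: b^T) Q).
  by rewrite unitmxE det_lblock unitrM det_scalar1 unitfE r0/= -unitmxE.
rewrite tr_block_mx !trmx0 tr_scalar_mx mulmx_block !mulmx0 !mul0mx !addr0 linearZ/= trmxK.
rewrite AE -scalar_mxM r2 mul_scalar_mx mul_mx_scalar !scalerA divff// !scale1r.
rewrite -SE -scalemxAl -scalemxAr scalerA /S; congr (block_mx _ _ _ _).
by rewrite -invfM r2 addrC subrK.
Qed.

Definition frob2 m n (X : 'M[R]_(m, n)) : R := \tr (X *m X^T).

Lemma frob2E m n (X : 'M[R]_(m, n)) : frob2 X = \sum_i \sum_j X i j ^+ 2.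
Proof.
apply: eq_bigr => i _; rewrite mxE; apply: eq_bigr => j _.
by rewrite mxE expr2.
Qed.

Lemma frob2_ge0 m n (X : 'M[R]_(m, n)) : 0 <= frob2 X.
Proof. by rewrite frob2E; do 2!(apply: sumr_ge0 => ? _); exact: sqr_ge0. Qed.

Lemma frob2_ge_entry m n (X : 'M[R]_(m, n)) i j : X i j ^+ 2 <= frob2 X.
Proof.
rewrite frob2E (bigD1 i)//= (bigD1 j)//= -addrA lerDl addr_ge0//.
  by apply: sumr_ge0 => ? _; exact: sqr_ge0.
by do 2!(apply: sumr_ge0 => ? _); exact: sqr_ge0.
Qed.

Lemma frob2_gt0 m n (X : 'M[R]_(m, n)) : X != 0 -> 0 < frob2 X.
Proof.
move=> X0; rewrite lt_neqAle frob2_ge0 andbT eq_sym; apply: contra X0 => /eqP f0.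
apply/eqP/matrixP => i j; rewrite mxE; apply/eqP; rewrite -sqrf_eq0 eq_le sqr_ge0 andbT.
by rewrite -f0 frob2_ge_entry.
Qed.

(** Lagrange's identity: twice the defect is the double sum of the squares (a_i b_j - a_j b_i)^2. *)
Lemma cauchy_schwarz_sum (I : finType) (a b : I -> R) :
  (\sum_i a i * b i) ^+ 2 <= (\sum_i a i ^+ 2) * (\sum_i b i ^+ 2).
Proof.
have : 0 <= \sum_i \sum_j (a i * b j - a j * b i) ^+ 2.
  by do 2!(apply: sumr_ge0 => ? _); exact: sqr_ge0.
have -> : \sum_i \sum_j (a i * b j - a j * b i) ^+ 2 =
   2 * ((\sum_i a i ^+ 2) * (\sum_i b i ^+ 2)) - 2 * (\sum_i a i * b i) ^+ 2.
  rewrite (eq_bigr (fun i => a i ^+ 2 * (\sum_j b j ^+ 2) + b i ^+ 2 * (\sum_j a j ^+ 2)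
      - 2 * (a i * b i) * \sum_j a j * b j)) => [|i _]; last first.
    rewrite !mulr_sumr -sumrN -!big_split; apply: eq_bigr => j _; rewrite /=; ring.
  rewrite big_split sumrN big_split/= -!mulr_suml -mulr_sumr; ring.
by rewrite -mulrBr pmulr_rge0// subr_ge0.
Qed.

Lemma frob2M m n p (X : 'M[R]_(m, n)) (Y : 'M[R]_(n, p)) :
  frob2 (X *m Y) <= frob2 X * frob2 Y.
Proof.
rewrite !frob2E [X in _ <= _ * X]exchange_big mulr_suml; apply: ler_sum => i _.
rewrite mulr_sumr; apply: ler_sum => j _; rewrite mxE.
exact: cauchy_schwarz_sum.
Qed.

Lemma frob2_trmx m n (X : 'M[R]_(m, n)) : frob2 X^T = frob2 X.
Proof. by rewrite /frob2 trmxK mxtrace_mulC. Qed.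

Lemma mxtrace_congruence m n (A P : 'M[R]_m) (B Q : 'M[R]_n) (u : 'M[R]_(m, n)) :
  A = P *m P^T -> B = Q *m Q^T ->
  \tr (A *m u *m B^T *m u^T) = frob2 (P^T *m u *m Q).
Proof.
move=> -> ->; rewrite /frob2 !trmx_mul !trmxK -!mulmxA mxtrace_mulC.
by rewrite !mulmxA.
Qed.

(** With A = B this is the norm of bivectors of one factor; with different A and B it is the norm of
    the mixed blocks on a product. *)
Lemma mxtrace_congruence_gt0 m n (A : 'M[R]_m) (B : 'M[R]_n) (u : 'M[R]_(m, n)) :
  A^T = A -> posdef_mx A -> B^T = B -> posdef_mx B -> u != 0 ->
  0 < \tr (A *m u *m B^T *m u^T).
Proof.
move=> sA pA sB pB u0.
have [P uP AE] := cholesky sA pA; have [Q uQ BE] := cholesky sB pB.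
rewrite (mxtrace_congruence u AE BE); apply: frob2_gt0; apply: contra u0 => /eqP E.
have uPT : P^T \in unitmx by rewrite unitmx_tr.
by rewrite -[u](mulKmx uPT) -[_ *m u](mulmxK uQ) E mul0mx mulmx0.
Qed.

Lemma mxtrace_congruence_ge0 m n (A : 'M[R]_m) (B : 'M[R]_n) (u : 'M[R]_(m, n)) :
  A^T = A -> posdef_mx A -> B^T = B -> posdef_mx B ->
  0 <= \tr (A *m u *m B^T *m u^T).
Proof.
move=> sA pA sB pB; have [->|u0] := eqVneq u 0; last exact/ltW/mxtrace_congruence_gt0.
by rewrite mulmx0 !mul0mx mxtrace0.
Qed.

Section one_metric.
Variables (n : nat) (A : 'M[R]_n).
Hypotheses (sA : A^T = A) (pA : posdef_mx A).

Lemma posdef_unit : A \in unitmx.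
Proof. by have [P uP ->] := cholesky sA pA; rewrite unitmx_mul uP unitmx_tr. Qed.

Lemma bivector_norm_gt0 w : w != 0 -> 0 < bivector_norm A w.
Proof. by move=> w0; rewrite mulr_gt0// mxtrace_congruence_gt0. Qed.

Lemma bivector_norm_ge0 w : 0 <= bivector_norm A w.
Proof. by rewrite mulr_ge0// mxtrace_congruence_ge0. Qed.

(** Write A = P P^T. Then w = P^-T (P^T w P) P^-1, the middle factor has squared Frobenius norm
    twice the bivector norm, and that of P^-1 is tr(A^-1). This trace depends continuously on A and
    stands in for the inverse of the least eigenvalue. *)
Lemma frob2_le_bivector_norm w :
  frob2 w <= \tr (invmx A) ^+ 2 * (2 * bivector_norm A w).
Proof.
have [P uP AE] := cholesky sA pA.
have uPT : P^T \in unitmx by rewrite unitmx_tr.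
have tE : \tr (invmx A) = frob2 (invmx P).
  rewrite /frob2 mxtrace_mulC; congr (\tr _); rewrite trmx_inv.
  have uA := posdef_unit.
  by rewrite -[RHS]mulmx1 -(mulmxV uA) [X in _ *m (X *m _)]AE -!mulmxA mulKmx// mulKmx.
have -> : 2 * bivector_norm A w = \tr (A *m w *m A^T *m w^T).
  by rewrite /bivector_norm mulrA mulfV ?mul1r// pnatr_eq0.
rewrite (mxtrace_congruence w AE AE).
have {1}-> : w = (invmx P)^T *m (P^T *m w *m P) *m invmx P.
  by rewrite trmx_inv -!mulmxA mulKmx// mulmxV// mulmx1.
apply: le_trans (frob2M _ _) _; rewrite tE expr2 -mulrA [frob2 _ * frob2 (_ *m _)]mulrC.
rewrite mulrA ler_wpM2r ?frob2_ge0//.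
by apply: le_trans (frob2M _ _) _; rewrite frob2_trmx.
Qed.

End one_metric.

Lemma bivector_eval_le_frob2 n (T : 'I_n -> 'I_n -> 'I_n -> 'I_n -> R) w :
  `|bivector_eval T w w| <= 4^-1 * (\sum_a \sum_b \sum_c \sum_d `|T a b c d|) * frob2 w.
Proof.
rewrite /bivector_eval normrM ger0_norm ?invr_ge0// -mulrA ler_pM2l ?invr_gt0//.
rewrite mulr_suml; apply: le_trans (ler_norm_sum _ _ _) _; apply: ler_sum => a _.
rewrite mulr_suml; apply: le_trans (ler_norm_sum _ _ _) _; apply: ler_sum => b _.
rewrite mulr_suml; apply: le_trans (ler_norm_sum _ _ _) _; apply: ler_sum => c _.
rewrite mulr_suml; apply: le_trans (ler_norm_sum _ _ _) _; apply: ler_sum => d _.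
rewrite -mulrA normrM ler_wpM2l//.
have := frob2_ge_entry w a b; have := frob2_ge_entry w c d.
rewrite normrM -[w a b ^+ 2]real_normK ?num_real// -[w c d ^+ 2]real_normK ?num_real//.
move: (frob2 w) `|w a b| `|w c d| => f x y yf xf.
(* From x^2 <= f and y^2 <= f follows 2 x y <= x^2 + y^2 <= 2 f. *)
have := sqr_ge0 (x - y); nra.
Qed.

Lemma bivector_eval_riem_form n (t : R) (g : 'rV[R]_n -> 'M[R]_n) x w : w^T = - w ->
  bivector_eval (riem_form t g x) w w =
  scal g x * bivector_norm (g x) w - 2 * t * bivector_eval (curvature g x) w w.
Proof.
by move=> sw; rewrite -bivector_eval_kn// -bivector_eval_lin.
Qed.

End positive_matrices.

(** * Uniform curvature bounds *)

Section local_bounds.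
Variables (R : realType) (n : nat) (U : set 'rV[R]_n) (g : 'rV[R]_n -> 'M[R]_n).
Hypotheses (oU : open U) (cg : smooth_on U g).
Hypotheses (sg : forall x, U x -> (g x)^T = g x) (pg : forall x, U x -> posdef_mx (g x)).

Let ug x (Ux : U x) : g x \in unitmx := posdef_unit (sg Ux) (pg Ux).

Lemma smooth_on_christoffel k i j : smooth_on U (christoffel g k i j).
Proof.
apply: (smooth_on_ext oU (f := fun x => connection_mx g i x j k)) => [x _|].
  by rewrite mxE.
exact: (smooth_on_mxP oU _).1 (smooth_on_connection_mx oU i cg ug) j k.
Qed.

Lemma smooth_on_curvature a b c d : smooth_on U (fun x => curvature g x a b c d).
Proof.
move=> N; apply: Ck_on_sum => // l _; apply: Ck_onM => //.
  exact: (smooth_on_mxP oU g).1.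
have cG := smooth_on_christoffel.
have dG v k i j : Ck_on N U (partial v (christoffel g k i j)).
  exact: (smooth_on_derive 'e_v (cG k i j) N).
apply: Ck_onD => //; first by apply: Ck_onD => //; exact: Ck_onN.
apply: Ck_on_sum => // m _; apply: Ck_onD => //; first by apply: Ck_onM => //; exact: cG.
by apply: Ck_onN => //; apply: Ck_onM => //; exact: cG.
Qed.

Let smooth_on_inv i j : smooth_on U (fun x => invmx (g x) i j).
Proof. exact: (smooth_on_mxP oU _).1 (smooth_on_invmx oU ug cg) i j. Qed.

Lemma smooth_on_scal : smooth_on U (scal g).
Proof.
move=> N; do 2![apply: Ck_on_sum => // ? _]; apply: Ck_onM => //.
  exact: smooth_on_inv.
do 2![apply: Ck_on_sum => // ? _]; apply: Ck_onM => //; first exact: smooth_on_inv.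
exact: smooth_on_curvature.
Qed.

Lemma smooth_on_near_bounded (f : 'rV[R]_n -> R) x : smooth_on U f -> U x ->
  \forall y \near x, `|f y| <= `|f x| + 1.
Proof.
move=> cf Ux; near=> y.
have H : `|f x - f y| < 1.
  by near: y; exact: (@Ck_on_cvg_dist _ _ 0 U f x 1 ltr01 (cf 0) Ux).
rewrite -[f y](subKr (f x)) (le_trans (ler_normB _ _))// lerD2l ltW//.
Unshelve. all: by end_near. Qed.

(** The curvature is compared with the bivector norm through the Frobenius norm of w, which depends
    on no metric. The entries of the curvature and the trace of the inverse metric exceed their
    values at x by at most 1 nearby, whence [B] and [T]; adding the two resulting bounds gives one
    constant for both claims. *)
Lemma near_curvature_bound x : U x -> exists C, \forall y \near x,
  `|scal g y| <= C /\
  forall w, `|bivector_eval (curvature g y) w w| <= C * bivector_norm (g y) w.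
Proof.
move=> Ux.
pose B a b c d := `|curvature g x a b c d| + 1.
pose S := \sum_a \sum_b \sum_c \sum_d B a b c d.
pose T := `|\tr (invmx (g x)) ^+ 2| + 1.
pose E := 4^-1 * S * (T * 2).
have S0 : 0 <= S by do 4!(apply: sumr_ge0 => ? _); rewrite addr_ge0.
have E0 : 0 <= E by rewrite !mulr_ge0// addr_ge0.
exists (`|scal g x| + 1 + E).
have nF : Filter (nbhs x) by exact: nbhs_filter.
have nB : \forall y \near x, forall a b c d, `|curvature g y a b c d| <= B a b c d.
  apply: (@filter_forall _ _
    (fun a y => forall b c d, `|curvature g y a b c d| <= B a b c d) _ nF) => a.
  apply: (@filter_forall _ _
    (fun b y => forall c d, `|curvature g y a b c d| <= B a b c d) _ nF) => b.
  apply: (@filter_forall _ _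
    (fun c y => forall d, `|curvature g y a b c d| <= B a b c d) _ nF) => c.
  apply: (@filter_forall _ _ (fun d y => `|curvature g y a b c d| <= B a b c d) _ nF) => d.
  by have H := smooth_on_near_bounded (smooth_on_curvature a b c d) Ux; exact: H.
have nT : \forall y \near x, `|\tr (invmx (g y)) ^+ 2| <= T.
  apply: (@smooth_on_near_bounded (fun y => \tr (invmx (g y)) ^+ 2)) => // k.
  have ct : Ck_on k U (fun y => \tr (invmx (g y))).
    by apply: Ck_on_sum => // i _; exact: smooth_on_inv.
  by apply: (@Ck_on_ext _ _ _ _ _ _ _ oU _ (Ck_onM oU ct ct)) => y _; rewrite expr2.
near=> y; have Uy : U y by near: y; exact: open_nbhs_nbhs.
split.
  apply: (@le_trans _ _ (`|scal g x| + 1)); last by rewrite lerDl.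
  by near: y; exact: smooth_on_near_bounded smooth_on_scal Ux.
move=> w; have N0 := bivector_norm_ge0 (sg Uy) (pg Uy) w.
have Ty : `|\tr (invmx (g y)) ^+ 2| <= T by near: y.
have By : forall a b c d, `|curvature g y a b c d| <= B a b c d by near: y.
apply: le_trans (bivector_eval_le_frob2 _ _) _.
apply: (@le_trans _ _ (E * bivector_norm (g y) w)); last first.
  by rewrite ler_wpM2r// lerDr addr_ge0.
apply: (@le_trans _ _ (4^-1 * S * frob2 w)).
  rewrite ler_wpM2r ?frob2_ge0// ler_pM2l ?invr_gt0//.
  by do 4!(apply: ler_sum => ? _).
rewrite /E -[leRHS]mulrA ler_wpM2l ?mulr_ge0//.
apply: le_trans (frob2_le_bivector_norm (sg Uy) (pg Uy) w) _.
rewrite -[leRHS]mulrA; apply: ler_wpM2r; first by apply: mulr_ge0.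
exact: le_trans (ler_norm _) Ty.
Unshelve. all: by end_near. Qed.

End local_bounds.

(** * From local to uniform bounds by compactness *)

Section uniform_bounds.
Variables (R : realType) (n : nat) (M : closedManifold R n).

Lemma overlap_transition i j x : overlap (mfd_chart i) (mfd_chart j) x ->
  chart_img (mfd_chart (c := M) j) (transition (mfd_chart i) (mfd_chart j) x).
Proof. by move=> [_ dx]; exists (chart_inv (mfd_chart i) x). Qed.

(** A point may lie in infinitely many charts, on whose coordinates there is no common control.
    Invariance of P under transitions reduces every chart to the single one chosen near each point,
    and monotonicity in C then lets compactness act. *)
Lemma uniform_on_manifold (P : R -> forall i : mfd_index M, 'rV[R]_n -> Prop) :
  (forall C D i x, C <= D -> chart_img (mfd_chart i) x -> P C i x -> P D i x) ->
  (forall C i j x, overlap (mfd_chart i) (mfd_chart j) x ->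
     P C j (transition (mfd_chart i) (mfd_chart j) x) -> P C i x) ->
  (forall i x, chart_img (mfd_chart i) x -> exists C, \forall y \near x, P C i y) ->
  exists2 C, 0 < C & forall i x, chart_img (mfd_chart i) x -> P C i x.
Proof.
move=> mono inv loc.
pose Q C (q : M) := forall i x, chart_img (mfd_chart i) x ->
  chart_inv (mfd_chart i) x = q -> P C i x.
(* Near-covering compactness, taken along the filter of large constants: what holds near every point
   for all large C holds everywhere for all large C. *)
have cov := (compact_near_coveringP [set: M]).1 (mfd_compact (c := M)).
have [p _|] := cov R +oo%R Q _.
  have [i di] := mfd_cover p.
  have Ix : chart_img (mfd_chart i) (chart_map (mfd_chart i) p) by exists p.
  have [C nC] := loc i _ Ix.
  near=> q D.
  have dq : chart_dom (mfd_chart i) q.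
    by near: q; apply: open_nbhs_nbhs; split=> //; exact: chart_dom_open.
  have Pq : P C i (chart_map (mfd_chart i) q).
    by near: q; exact: (chart_map_continuous di).
  have CD : C <= D by near: D; exact: nbhs_pinfty_ge (num_real C).
  move=> j x Jx qE.
  have ox : overlap (mfd_chart j) (mfd_chart i) x by split=> //; rewrite qE.
  apply: (mono C) => //.
  by apply: (inv C j i x ox); rewrite /transition qE.
move=> C [Creal CP].
(* [CP] requires a constant strictly above C, and the result must be positive. *)
exists (Num.max C 0 + 1).
  by rewrite ltr_pwDr// le_max lexx orbT.
move=> i x Ix; apply: (CP (Num.max C 0 + 1)) => //.
by rewrite ltr_pwDr// le_max lexx.
Unshelve. all: by end_near. Qed.

End uniform_bounds.

Section metric_invariance.
Variables (R : realType) (n : nat) (M : closedManifold R n) (g : riemannianMetric M).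

Lemma metric_unit i x : chart_img (mfd_chart i) x -> metric_mx g i x \in unitmx.
Proof. by move=> Ix; exact: (posdef_unit (Defs.metric_sym g Ix) (Defs.metric_pos g Ix)). Qed.

Lemma sub_overlap i j : overlap (mfd_chart i) (mfd_chart j) `<=` chart_img (mfd_chart (c := M) i).
Proof. by move=> x []. Qed.

Section change.
Variables (i j : mfd_index M) (x : 'rV[R]_n).
Hypothesis ox : overlap (mfd_chart i) (mfd_chart j) x.
Let tau := transition (mfd_chart i) (mfd_chart j).

Let curvE a b := curvature_mx_change (overlap_open (c' := mfd_chart j) (c := mfd_chart i))
  (chart_img_open (c := mfd_chart j)) (mfd_smooth i j) (@overlap_transition _ _ M i j)
  (fun k => Ck_on_sub (@sub_overlap i j) (metric_smooth g i k)) (metric_smooth g j)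
  (fun x o => Defs.metric_sym g (sub_overlap o)) (@Defs.metric_sym _ _ _ g j)
  (fun x o => metric_unit (sub_overlap o)) (@metric_unit j)
  (@metric_compat _ _ _ g i j) a b ox.

Let uJ : jacobian tau x \in unitmx.
Proof.
have := metric_unit (sub_overlap ox); rewrite (metric_compat g ox) !unitmx_mul.
by move=> /andP[/andP[]].
Qed.

Let uj := metric_unit (overlap_transition ox).

Lemma metric_scal_change : scal (metric_mx g i) x = scal (metric_mx g j) (tau x).
Proof. exact: scal_pullback uJ uj (metric_compat g ox) curvE. Qed.

Lemma metric_eval_change w :
  let w' := (jacobian tau x)^T *m w *m jacobian tau x in
  bivector_eval (curvature (metric_mx g i) x) w w =
    bivector_eval (curvature (metric_mx g j) (tau x)) w' w' /\
  bivector_norm (metric_mx g i x) w = bivector_norm (metric_mx g j (tau x)) w'.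
Proof.
split; first exact: bivector_eval_curvature_pullback (metric_compat g ox) curvE w.
exact: bivector_norm_pullback (metric_compat g ox) w.
Qed.

End change.

Lemma curvature_bound : exists2 C, 0 < C & forall i x, chart_img (mfd_chart i) x ->
  `|scal (metric_mx g i) x| <= C /\
  forall w, `|bivector_eval (curvature (metric_mx g i) x) w w| <=
    C * bivector_norm (metric_mx g i x) w.
Proof.
apply: (@uniform_on_manifold _ _ M (fun C i x => `|scal (metric_mx g i) x| <= C /\
  forall w, `|bivector_eval (curvature (metric_mx g i) x) w w| <=
    C * bivector_norm (metric_mx g i x) w)).
- move=> C D i x CD Ix [sC eC]; split; first exact: le_trans CD.
  move=> w; apply: le_trans (eC w) _; rewrite ler_wpM2r//.
  exact: bivector_norm_ge0 (Defs.metric_sym g Ix) (Defs.metric_pos g Ix) w.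
- move=> C i j x ox [sC eC]; rewrite (metric_scal_change ox); split=> // w.
  by have /= [-> ->] := metric_eval_change ox w.
move=> i x Ix; apply: near_curvature_bound Ix.
- exact: chart_img_open.
- exact: metric_smooth.
- by move=> y; exact: Defs.metric_sym.
- by move=> y; exact: Defs.metric_pos.
Qed.

(** The lower bound on Scal is written 1 <= C Scal so that it is monotone in C, as
    [uniform_on_manifold] requires. *)
Lemma scal_pos_bound : scal_pos g -> exists2 C, 0 < C &
  forall i x, chart_img (mfd_chart i) x -> 1 <= C * scal (metric_mx g i) x.
Proof.
move=> sg.
have [C C0 CP] : exists2 C, 0 < C & forall i x, chart_img (mfd_chart i) x ->
    (0 <= C) /\ (1 <= C * scal (metric_mx g i) x); last first.
  by exists C => // i x Ix; have [_] := CP i x Ix.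
apply: (@uniform_on_manifold _ _ M (fun C i x => 0 <= C /\ 1 <= C * scal (metric_mx g i) x)).
- move=> C D i x CD Ix [C0 sC]; split; first exact: le_trans CD.
  by apply: le_trans sC _; rewrite ler_wpM2r// ltW// sg.
- by move=> C i j x ox; rewrite (metric_scal_change ox).
(* Near x the scalar curvature stays above half its value at x. *)
move=> i x Ix; exists (2 / scal (metric_mx g i) x).
have s0 := sg i x Ix.
have cs : smooth_on (chart_img (mfd_chart i)) (scal (metric_mx g i)).
  apply: smooth_on_scal.
  - exact: chart_img_open.
  - exact: metric_smooth.
  - by move=> y; exact: Defs.metric_sym.
  - by move=> y; exact: Defs.metric_pos.
have e0 : 0 < scal (metric_mx g i) x / 2 by rewrite divr_gt0.
near=> y; split; first by rewrite divr_ge0// ltW.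
have : `|scal (metric_mx g i) x - scal (metric_mx g i) y| < scal (metric_mx g i) x / 2.
  near: y; exact: (@Ck_on_cvg_dist _ _ 0 _ _ x _ e0 (cs 0) Ix).
move: (scal _ x) (scal _ y) s0 => s t s0.
rewrite ltr_distl => /andP[_ h].
by rewrite mulrAC ler_pdivlMr// mul1r; lra.
Unshelve. all: by end_near. Qed.

End metric_invariance.

(** * Bump functions and existence of metrics *)

Section flat_functions.
Variable R : realType.

(* x^(-n) exp(-1/x) on x > 0, extended by 0; the family is closed under derivation. *)
Definition flat_fun n (x : R) : R :=
  if 0 < x then x^-1 ^+ n * expR (- x^-1) else 0.

Lemma flat_fun0 n : flat_fun n 0 = 0.
Proof. by rewrite /flat_fun ltxx. Qed.

Lemma flat_fun_ge0 n x : 0 <= flat_fun n x.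
Proof.
rewrite /flat_fun; case: ifP => // x0.
by rewrite mulr_ge0 ?expR_ge0// exprn_ge0// invr_ge0 ltW.
Qed.

Lemma flat_fun_gt0 n x : 0 < x -> 0 < flat_fun n x.
Proof. by move=> x0; rewrite /flat_fun x0 mulr_gt0 ?expR_gt0// exprn_gt0// invr_gt0. Qed.

(** For x > 0 the exponential series gives exp(1/x) >= x^-(n+1) / (n+1)!. The resulting linear bound
    controls the family at the origin. *)
Lemma flat_fun_le n x : `|flat_fun n x| <= (n.+1)`!%:R * `|x|.
Proof.
rewrite ger0_norm ?flat_fun_ge0// /flat_fun; case: ifP => x0; last by rewrite mulr_ge0.
rewrite (gtr0_norm x0) expRN ler_pdivrMr ?expR_gt0// mulrAC -ler_pdivrMr//.
rewrite -[X in X / x]mulr1 -mulrA mul1r -exprSr mulrC.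
have f0 : 0 < (n.+1)`!%:R :> R by rewrite ltr0n fact_gt0.
have z0 : 0 <= x^-1 by rewrite invr_ge0 ltW.
have := expR_ge1Dxn n z0; set z := x^-1 ^+ n.+1 => h.
rewrite -ler_pdivrMr//; apply: le_trans h.
by rewrite lerDr.
Qed.

Lemma is_derive_flat_fun n (x : R) : is_derive x (1 : R) (flat_fun n)
  (flat_fun n.+2 x + - n%:R * flat_fun n.+1 x).
Proof.
have [x0|x0|x0] := ltgtP 0 x.
- have E : \forall y \near x, y^-1 ^+ n * expR (- y^-1) = flat_fun n y.
    near=> y; have y0 : 0 < y by near: y; exact: lt_nbhsr.
    by rewrite /flat_fun y0.
  apply: (near_eq_is_derive E).
  have x0' : x != 0 by rewrite gt_eqF.
  have dv : is_derive x (1 : R) (fun y : R => y^-1) (- (x^-1 ^+ 2)).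
    apply: is_derive_eq (@is_deriveV R id x 1 1 x0' (is_derive_id x 1)) _.
    by rewrite /GRing.scale/= mulr1 exprVn.
  have de : is_derive x (1 : R) (fun y : R => expR (- y^-1)) (expR (- x^-1) * - - (x^-1 ^+ 2)).
    exact: (@is_derive1_comp R expR (fun y => - y^-1) x _ _ (is_derive_expR _) (is_deriveN dv)).
  have dx := is_deriveX n dv.
  have df := is_deriveM dx de.
  rewrite exprfctE in df.
  apply: is_derive_eq df _; rewrite /GRing.scale/= /flat_fun x0 opprK.
  case: n {E dx} => [|n]; first by rewrite !mul0r mulr0; ring.
  by rewrite !exprS /=; ring.
- have E : \forall y \near x, cst 0 y = flat_fun n y.
    near=> y; have y0 : y < 0 by near: y; exact: lt_nbhsl.
    by rewrite /flat_fun ltNge (ltW y0).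
  apply: (near_eq_is_derive E).
  by rewrite /flat_fun ltNge (ltW x0)/= mulr0 addr0; exact: is_derive_cst.
rewrite -{}x0 !flat_fun0 mulr0 addr0.
have C : (fun h : R =>
    h^-1 *: ((flat_fun n \o shift 0) (h *: (1 : R)) - flat_fun n 0)) @ 0^' --> (0 : R).
  apply/cvgrPdist_lt => e e0; pose K : R := (n.+2)`!%:R.
  have K0 : 0 < K by rewrite ltr0n fact_gt0.
  near=> h; rewrite sub0r normrN /= addr0 flat_fun0 subr0 [h *: 1]mulr1.
  have h0 : h != 0 by near: h; exact: nbhs_dnbhs_neq.
  have he : `|h| < e / K by near: h; apply: dnbhs0_lt; rewrite divr_gt0.
  (* At 0 the difference quotient is the next but one-step member of the family, [flat_fun n.+1],
     which tends to 0 by the linear bound. *)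
  have -> : h^-1 *: flat_fun n h = flat_fun n.+1 h.
    rewrite /flat_fun; case: ifP => _; last by rewrite scaler0.
    by rewrite /GRing.scale/= exprS mulrA.
  apply: le_lt_trans (flat_fun_le _ _) _.
  by rewrite mulrC -ltr_pdivlMr.
by apply: DeriveDef; [apply/cvg_ex; exists 0|exact/cvg_lim].
Unshelve. all: by end_near. Qed.

End flat_functions.

Lemma smooth_on_id (R : realType) n (U : set 'rV[R]_n) : smooth_on U (id : 'rV[R]_n -> 'rV[R]_n).
Proof.
case=> [|k] /=; first by move=> x _; exact: cvg_id.
split=> // v.
have -> : (fun x : 'rV[R]_n => 'D_v id x) = fun=> v.
  by apply/funext => x; exact: derive_id.
exact: Ck_on_cst.
Qed.

Section bump.
Variables (R : realType) (n : nat).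
Implicit Types x : 'rV[R]_n.

(** This is exp(-1 / (d^2 - |x - x0|^2)) inside the Euclidean ball and 0 outside. The squared
    Euclidean distance is polynomial, unlike the sup norm carried by row vectors. *)
Definition bump_fun x0 (d : R) x : R :=
  flat_fun 0 (d ^+ 2 - \sum_i (x 0 i - x0 0 i) ^+ 2).

Lemma bump_fun_ge0 x0 d x : 0 <= bump_fun x0 d x.
Proof. exact: flat_fun_ge0. Qed.

Lemma bump_fun_center x0 d : 0 < d -> 0 < bump_fun x0 d x0.
Proof.
move=> d0; apply: flat_fun_gt0; rewrite big1 ?subr0 ?exprn_gt0// => i _.
by rewrite subrr expr0n.
Qed.

(** The ball is enclosed in a cube because a product of segments is readily compact. *)
Lemma bump_fun_support x0 d x : 0 < d -> bump_fun x0 d x != 0 ->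
  forall i, x 0 i \in `[x0 0 i - d, x0 0 i + d].
Proof.
move=> d0; rewrite /bump_fun /flat_fun; case: ifP => [h _ i|_]; last by rewrite eqxx.
have {}h : (x 0 i - x0 0 i) ^+ 2 < d ^+ 2.
  apply: le_lt_trans (_ : _ <= \sum_i (x 0 i - x0 0 i) ^+ 2) _; last by rewrite -subr_gt0.
  by rewrite (bigD1 i)//= lerDl sumr_ge0// => j _; exact: sqr_ge0.
have : `|x 0 i - x0 0 i| < d.
  rewrite -(gtr0_norm d0) -ltr_sqr ?nnegrE// !real_normK ?num_real//.
by rewrite ltr_distl in_itv/= => /andP[a b]; rewrite !ltW.
Qed.

Lemma smooth_on_bump_comp m (U : set 'rV[R]_m) (f : 'rV[R]_m -> 'rV[R]_n) x0 d :
  open U -> smooth_on U f -> smooth_on U (fun y => bump_fun x0 d (f y)).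
Proof.
move=> oU cf k.
apply: (@Ck_on_comp_family R m k U (fun y => d ^+ 2 - \sum_i (f y 0 i - x0 0 i) ^+ 2)
  (@flat_fun R) (fun n => - n%:R)) => //.
  by move=> j y; exact: is_derive_flat_fun.
apply: Ck_onD => //; first exact: Ck_on_cst.
apply: Ck_onN => //; apply: Ck_on_sum => // i _.
have ci : Ck_on k U (fun y => f y 0 i - x0 0 i).
  apply: Ck_onD => //; last exact: Ck_on_cst.
  exact: (smooth_on_mxP oU f).1.
by apply: (Ck_on_ext oU _ (Ck_onM oU ci ci)) => y _; rewrite expr2.
Qed.

Lemma open_cube (U : set 'rV[R]_n) x0 : open U -> U x0 ->
  exists2 d, 0 < d & forall x, (forall i, x 0 i \in `[x0 0 i - d, x0 0 i + d]) -> U x.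
Proof.
move=> oU Ux0; have /nbhs_ballP[e /= e0 eU] : nbhs x0 U by exact: open_nbhs_nbhs.
(* The closed cube has to fit inside the open ball of radius e. *)
exists (e / 2); first by rewrite divr_gt0.
move=> x xd; apply: eU; split=> // i j; rewrite ord1 /ball/=.
have := xd j; rewrite in_itv/= => /andP[a b].
rewrite ltr_distl; apply/andP; split; lra.
Qed.

End bump.

(** * Jacobians of the transition maps *)

Section jacobian_facts.
Variables (R : realType) (n : nat) (M : closedManifold R n).
Local Notation tr i j := (transition (mfd_chart (c := M) i) (mfd_chart j)).
Local Notation ov i j := (overlap (mfd_chart (c := M) i) (mfd_chart j)).

Lemma jacobian_comp (f h : 'rV[R]_n -> 'rV[R]_n) x :
  differentiable f x -> differentiable h (f x) ->
  jacobian (fun y => h (f y)) x = jacobian f x *m jacobian h (f x).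
Proof.
move=> df dh; apply/row_matrixP => i.
have dhf : differentiable (fun y => h (f y)) x.
  exact: (@differentiable_comp _ _ _ _ f h).
apply: etrans (esym (row_mul i (jacobian f x) (jacobian h (f x)))).
apply: etrans (rowE i _) _; apply: etrans (esym (deriveEjacobian _ dhf)) _.
apply: etrans (derive_comp_diff _ df dh) _.
apply: etrans (esym (deriveE _ dh)) _; apply: etrans (deriveEjacobian _ dh) _.
apply: (congr1 (mulmx^~ _)).
exact: etrans (deriveEjacobian _ df) (esym (rowE i _)).
Qed.

Lemma near_eq_jacobian (f h : 'rV[R]_n -> 'rV[R]_n) x :
  {near x, f =1 h} -> differentiable f x -> jacobian f x = jacobian h x.
Proof.
move=> fh df; have dh := near_eq_differentiable fh df.
apply/row_matrixP => i; apply: etrans (rowE i _) _; apply: etrans (esym (deriveEjacobian _ df)) _.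
apply: etrans (esym (rowE i _)); apply: etrans (deriveEjacobian _ dh).
exact: near_eq_derive.
Qed.

Lemma jacobian_id x : jacobian (id : 'rV[R]_n -> 'rV[R]_n) x = 1%:M.
Proof.
apply/row_matrixP => i; rewrite row1 rowE -deriveEjacobian ?derive_id//.
Qed.

Lemma transition_differentiable i j x : ov i j x -> differentiable (tr i j) x.
Proof. exact: smooth_on_differentiable (mfd_smooth i j). Qed.

Lemma transition_inv i j x : ov i j x ->
  chart_inv (mfd_chart j) (tr i j x) = chart_inv (mfd_chart i) x.
Proof. by move=> [_ dx]; rewrite /transition chart_mapK. Qed.

Lemma overlap_comp i j k x : ov i j x -> ov i k x -> ov j k (tr i j x).
Proof.
move=> oij [_ dk]; split; first exact: overlap_transition.
by rewrite transition_inv.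
Qed.

Lemma jacobian_transition i j k x : ov i j x -> ov i k x ->
  jacobian (tr i k) x = jacobian (tr i j) x *m jacobian (tr j k) (tr i j x).
Proof.
move=> oij oik; rewrite -jacobian_comp; last first.
- exact: transition_differentiable (overlap_comp oij oik).
- exact: transition_differentiable.
apply: near_eq_jacobian; last exact: transition_differentiable.
near=> y; have oy : ov i j y by near: y; apply: open_nbhs_nbhs; split=> //; exact: overlap_open.
by rewrite /transition -{1}(transition_inv oy).
Unshelve. all: by end_near. Qed.

Lemma chart_img_inv i x : chart_img (mfd_chart i) x ->
  chart_dom (mfd_chart i) (chart_inv (mfd_chart (c := M) i) x).
Proof. by move=> [p dp <-]; rewrite chart_mapK. Qed.

Lemma overlap_refl i x : chart_img (mfd_chart i) x -> ov i i x.
Proof. by move=> Ix; split=> //; exact: chart_img_inv. Qed.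

Lemma transition_refl i x : chart_img (mfd_chart i) x -> tr i i x = x.
Proof. by move=> [p dp <-]; rewrite /transition chart_mapK. Qed.

(** The cocycle identity for i, j, i exhibits a one-sided inverse, which suffices for square
    matrices. *)
Lemma jacobian_transition_unit i j x : ov i j x -> jacobian (tr i j) x \in unitmx.
Proof.
move=> oij; have Ix := oij.1; have oii := overlap_refl Ix.
have E : jacobian (tr i i) x = 1%:M.
  rewrite -(jacobian_id x); apply: near_eq_jacobian; last exact: transition_differentiable.
  near=> y; apply: transition_refl; near: y; apply: open_nbhs_nbhs; split=> //.
  exact: chart_img_open.
have H := etrans (esym (jacobian_transition oij oii)) E.
exact: (mulmx1_unit H).1.
Unshelve. all: by end_near. Qed.

End jacobian_facts.

Lemma gram_form (R : realType) m n (c : R) (J : 'M[R]_(m, n)) (v : 'rV[R]_m) :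
  (v *m (c *: (J *m J^T)) *m v^T) 0 0 = c * frob2 (v *m J).
Proof.
rewrite -scalemxAr -scalemxAl [LHS]mxE; congr (_ * _).
rewrite /frob2 trmx_mul !mulmxA; move: (_ *m v^T) => A.
by rewrite {2}[A]mx11_scalar mxtrace_scalar mulr1n.
Qed.

(** The factorization of J is the cocycle identity, available only where the point lies in the chart
    carrying the bump; elsewhere the coefficient is 0 and both sides vanish. *)
Lemma gram_congruence (R : comPzRingType) n (b c : R) (J A B : 'M[R]_n) :
  c = b -> (b != 0 -> J = A *m B) ->
  b *: (J *m J^T) = A *m (c *: (B *m B^T)) *m A^T.
Proof.
move=> -> JE; rewrite -scalemxAr -scalemxAl; have [->|/JE ->] := eqVneq b 0.
  by rewrite !scale0r.
by rewrite trmx_mul !mulmxA.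
Qed.

Lemma compact_finite_cover (T : topologicalType) (f : T -> set T) :
  compact [set: T] -> (forall p, open (f p)) -> (forall p, f p p) ->
  exists D : seq T, forall q, exists2 p, p \in D & f p q.
Proof.
move=> cT of_ fp.
(* The filter of all sufficiently long lists, ordered by inclusion. Near-covering compactness along
   it yields a finite subcover. *)
pose F : set_system (seq T) := fun A =>
  exists s0 : seq T, forall s : seq T, {subset s0 <= s} -> A s.
have FF : Filter F.
  split; first by exists [::].
    move=> A B [s1 sA] [s2 sB]; exists (s1 ++ s2) => s ss; split.
      by apply: sA => x xs; apply: ss; rewrite mem_cat xs.
    by apply: sB => x xs; apply: ss; rewrite mem_cat xs orbT.
  by move=> A B AB [s0 sA]; exists s0 => s /sA /AB.
have cov := (compact_near_coveringP [set: T]).1 cT.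
have [p _|s0 /(_ s0) H] := cov (seq T) F (fun D q => exists2 p, p \in D & f p q) FF.
  exists (f p, [set D : seq T | p \in D]) => /=; last by move=> [q D] [/= pq pD]; exists p.
  split; first exact: open_nbhs_nbhs.
  by exists [:: p] => s; apply; exact: mem_head.
by exists s0 => q; apply: H.
Qed.

(** * Existence of a Riemannian metric *)

Section metric_existence.
Variables (R : realType) (n : nat) (M : closedManifold R n).
Local Notation tr i j := (transition (mfd_chart (c := M) i) (mfd_chart j)).
Local Notation ov i j := (overlap (mfd_chart (c := M) i) (mfd_chart j)).
Local Notation img i := (chart_img (mfd_chart (c := M) i)).
Implicit Types G : mfd_index M -> 'rV[R]_n -> 'M[R]_n.

(* Unlike metrics, these are closed under sums and allow a bump supported in one
   chart. *)
Record semimetric G : Prop := Semimetric {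
  semimetric_smooth : forall i, smooth_on (img i) (G i);
  semimetric_sym : forall i x, img i x -> (G i x)^T = G i x;
  semimetric_ge0 : forall i x, img i x -> forall v : 'rV[R]_n, 0 <= (v *m G i x *m v^T) 0 0;
  semimetric_compat : forall i j x, ov i j x ->
    G i x = jacobian (tr i j) x *m G j (tr i j x) *m (jacobian (tr i j) x)^T }.

Lemma semimetric0 : semimetric (fun _ _ => 0).
Proof.
split=> [i k|i x _|i x _ v|i j x _].
- exact: Ck_on_cst.
- exact: trmx0.
- by rewrite mulmx0 mul0mx mxE.
- by rewrite mulmx0 mul0mx.
Qed.

Lemma semimetricD G H : semimetric G -> semimetric H ->
  semimetric (fun i x => G i x + H i x).
Proof.
move=> mG mH; split=> [i|i x Ix|i x Ix v|i j x ox].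
- have oI : open (img i) by exact: chart_img_open.
  apply/(smooth_on_mxP oI) => a b k.
  have cG := (smooth_on_mxP oI _).1 (semimetric_smooth mG i) a b k.
  have cH := (smooth_on_mxP oI _).1 (semimetric_smooth mH i) a b k.
  by apply: (Ck_on_ext oI _ (Ck_onD oI cG cH)) => x _; rewrite mxE.
- by rewrite linearD/= (semimetric_sym mG)// (semimetric_sym mH).
- by rewrite mulmxDr mulmxDl mxE addr_ge0 ?(semimetric_ge0 mG)// (semimetric_ge0 mH).
- by rewrite mulmxDr mulmxDl -(semimetric_compat mG ox) -(semimetric_compat mH ox).
Qed.

Lemma semimetric_sum (I : Type) (r : seq I) (G : I -> mfd_index M -> 'rV[R]_n -> 'M[R]_n) :
  (forall a, semimetric (G a)) -> semimetric (fun i x => \sum_(a <- r) G a i x).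
Proof.
move=> mG; elim: r => [|a r IH].
  rewrite (_ : (fun _ _ => _) = fun _ _ => 0); first exact: semimetric0.
  by apply/funext => i; apply/funext => x; rewrite big_nil.
rewrite (_ : (fun _ _ => _) = fun i x => G a i x + \sum_(a <- r) G a i x).
  exact: semimetricD.
by apply/funext => i; apply/funext => x; rewrite big_cons.
Qed.

Section bump_semimetric.
Variables (i0 : mfd_index M) (x0 : 'rV[R]_n) (d : R).
Hypothesis d0 : 0 < d.
Local Notation cube := [set x : 'rV[R]_n | forall i, `[x0 0 i - d, x0 0 i + d]%classic (x 0 i)].
Hypothesis cube_img : cube `<=` img i0.

Definition manifold_bump (q : M) : R :=
  if `[< chart_dom (mfd_chart i0) q >]
  then bump_fun x0 d (chart_map (mfd_chart i0) q) else 0.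

Lemma manifold_bump_ge0 q : 0 <= manifold_bump q.
Proof. by rewrite /manifold_bump; case: ifP => // _; exact: bump_fun_ge0. Qed.

Lemma manifold_bump_dom q : manifold_bump q != 0 -> chart_dom (mfd_chart i0) q.
Proof. by rewrite /manifold_bump; case: asboolP => //; rewrite eqxx. Qed.

Let K : set M := chart_inv (mfd_chart i0) @` cube.

(** Compactness of the cube and the Hausdorff property give closedness. The complement of [K] is
    then open, so the extension of the bump by 0 is smooth across the edge of the chart domain. *)
Let closedK : closed K.
Proof.
apply: compact_closed; first exact: mfd_hausdorff.
apply: continuous_compact.
  apply: continuous_in_subspaceT => x /[!inE] xc.
  exact: chart_inv_continuous (cube_img xc).
apply: (@rV_compact R n (fun i => `[x0 0 i - d, x0 0 i + d]%classic)) => i.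
exact: segment_compact.
Qed.

Let subK : K `<=` chart_dom (mfd_chart i0).
Proof. by move=> q [x xc <-]; apply: chart_img_inv; exact: cube_img. Qed.

Let bump_out q : ~ K q -> manifold_bump q = 0.
Proof.
move=> nK; apply/eqP; apply: contra_notT nK => b0.
have dq := manifold_bump_dom b0; exists (chart_map (mfd_chart i0) q); last exact: chart_mapK.
move=> i /=; apply: bump_fun_support => //.
by move: b0; rewrite /manifold_bump asboolT.
Qed.

(** J J^T is the Euclidean metric of chart [i0] read in chart j. Outside chart [i0] the Jacobian is
    meaningless, but the bump vanishes there. *)
Definition bump_semimetric j x : 'M[R]_n :=
  manifold_bump (chart_inv (mfd_chart j) x) *:
    (jacobian (tr j i0) x *m (jacobian (tr j i0) x)^T).

Let outside j : set 'rV[R]_n := [set x | img j x /\ ~ K (chart_inv (mfd_chart j) x)].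

Let open_outside j : open (outside j).
Proof.
rewrite openE => x [Ix nK].
have n1 : nbhs x (img j) by apply: open_nbhs_nbhs; split=> //; exact: chart_img_open.
have n2 : nbhs x (chart_inv (mfd_chart j) @^-1` (~` K)).
  apply: (chart_inv_continuous Ix); apply: open_nbhs_nbhs; split=> //.
  exact: closed_openC.
exact: filterI n1 n2.
Qed.

Lemma bump_semimetricP : semimetric bump_semimetric.
Proof.
split=> [j k|j x Ix|j x Ix v|j l x ox].
(* Around x either the explicit formula on the overlap with [i0] applies, or the function is 0 off
   [K]. These two open sets cover the chart because [K] lies in the domain of [i0]. *)
- apply: Ck_on_cover => x Ix.
  have [dx|ndx] := pselect (chart_dom (mfd_chart i0) (chart_inv (mfd_chart j) x)).
    have oo : open (ov j i0) by exact: overlap_open.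
    apply: (@Ck_on_sub _ _ _ k (ov j i0)) => [_ ->//|].
    have ctr := mfd_smooth j i0.
    have cb := smooth_on_bump_comp x0 d oo ctr.
    have cJ := smooth_on_jacobian oo ctr.
    have cJT : smooth_on (ov j i0) (fun x => (jacobian (tr j i0) x)^T).
      apply/(smooth_on_mxP oo) => a b.
      apply: (smooth_on_ext oo _ ((smooth_on_mxP oo _).1 cJ b a)) => y _.
      by rewrite [RHS]mxE.
    have cJJ := smooth_on_mulmx oo cJ cJT.
    apply/(Ck_on_mxP k _ oo) => a b.
    apply: (Ck_on_ext oo _ (Ck_onM oo (cb k) ((smooth_on_mxP oo _).1 cJJ a b k))) => y oy.
    rewrite /bump_semimetric [RHS]mxE; congr (_ * _).
    by rewrite /manifold_bump asboolT//; exact: oy.2.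
  apply: (@Ck_on_sub _ _ _ k (outside j)) => [_ ->|].
    by split=> // /subK.
  have c0 : Ck_on k (outside j) (fun=> (0 : 'M[R]_n)) by exact: Ck_on_cst.
  apply: (Ck_on_ext (@open_outside j) _ c0) => y [_ nK].
  by rewrite /bump_semimetric bump_out// scale0r.
- by rewrite /bump_semimetric linearZ/= trmx_mul trmxK.
- rewrite (gram_form (manifold_bump _)).
  exact: mulr_ge0 (manifold_bump_ge0 _) (frob2_ge0 _).
- have bE := congr1 manifold_bump (transition_inv ox).
  apply: gram_congruence bE _ => b0.
  apply: (jacobian_transition ox); split; first exact: ox.1.
  exact: manifold_bump_dom.
Qed.

Lemma bump_semimetric_gt0 j x (v : 'rV[R]_n) : img j x ->
  manifold_bump (chart_inv (mfd_chart j) x) != 0 -> v != 0 ->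
  0 < (v *m bump_semimetric j x *m v^T) 0 0.
Proof.
move=> Ix b0 v0; have oji : ov j i0 x by split=> //; exact: manifold_bump_dom.
have uJ := jacobian_transition_unit oji.
rewrite (gram_form (manifold_bump _)); apply: mulr_gt0.
  by rewrite lt_neqAle eq_sym b0; exact: manifold_bump_ge0.
apply: frob2_gt0; move: uJ; move: (jacobian _ _) => J uJ.
by apply: contra v0 => /eqP uE; rewrite -[v](mulmxK uJ) uE mul0mx.
Qed.

Lemma near_manifold_bump q : manifold_bump q != 0 -> \forall p \near q, manifold_bump p != 0.
Proof.
move=> b0; have dq := manifold_bump_dom b0.
have cb : {for chart_map (mfd_chart i0) q, continuous (bump_fun x0 d)}.
  have H := smooth_on_bump_comp x0 d openT (@smooth_on_id R n setT).
  exact: (H 0 _ Logic.I).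
have nb : \forall p \near q, bump_fun x0 d (chart_map (mfd_chart i0) p) != 0.
  move: b0; rewrite {1}/manifold_bump asboolT// => b0.
  have := continuous_comp (chart_map_continuous dq) cb.
  move=> /(_ [set y | y != 0]); apply.
  by apply: open_nbhs_nbhs; split=> //; exact: open_neq.
near=> p; rewrite /manifold_bump asboolT; first by near: p.
by near: p; apply: open_nbhs_nbhs; split=> //; exact: chart_dom_open.
Unshelve. all: by end_near. Qed.

End bump_semimetric.

(** At each point one summand is positive definite and the others are nonnegative. Normalizing the
    bumps to a partition of unity would add nothing, since positive forms are closed under sums. *)
Theorem riemannianMetric_exists : inhabited (riemannianMetric M).
Proof.
have loc (p : M) : exists iG : (set M) * (mfd_index M -> 'rV[R]_n -> 'M[R]_n),
    [/\ open iG.1, iG.1 p, semimetric iG.2 &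
     forall j x (v : 'rV[R]_n), img j x -> iG.1 (chart_inv (mfd_chart j) x) -> v != 0 ->
       0 < (v *m iG.2 j x *m v^T) 0 0].
  have [i0 dp] := mfd_cover p; pose x0 := chart_map (mfd_chart i0) p.
  have Ix0 : img i0 x0 by exists p.
  have oI : open (img i0) by exact: chart_img_open.
  have [d d0 cI] := open_cube oI Ix0.
  have cube_img : [set x : 'rV[R]_n | forall i, `[x0 0 i - d, x0 0 i + d]%classic (x 0 i)]
      `<=` img i0 by move=> x xc; exact: cI.
  exists (interior [set q | manifold_bump i0 x0 d q != 0], bump_semimetric i0 x0 d); split=> /=.
  - exact: open_interior.
  - apply: near_manifold_bump; rewrite /manifold_bump asboolT// gt_eqF//.
    exact: bump_fun_center.
  - exact: bump_semimetricP d0 cube_img.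
  - move=> j x v Ix /interior_subset qb v0; exact: bump_semimetric_gt0.
pose F p := sval (cid (loc p)).
have FP p := svalP (cid (loc p)).
have [D cov] := @compact_finite_cover M (fun p => (F p).1) (mfd_compact (c := M))
  (fun p => let: And4 o _ _ _ := FP p in o) (fun p => let: And4 _ c _ _ := FP p in c).
pose G i x := \sum_(p <- D) (F p).2 i x.
have mG : semimetric G.
  by apply: semimetric_sum => p; have [] := FP p.
have pG i x : img i x -> forall v : 'rV[R]_n, v != 0 -> 0 < (v *m G i x *m v^T) 0 0.
  move=> Ix v v0.
  have [p pD Fq] := cov (chart_inv (mfd_chart i) x).
  have -> : (v *m G i x *m v^T) 0 0 = \sum_(p <- D) (v *m (F p).2 i x *m v^T) 0 0.
    by rewrite /G mulmx_sumr mulmx_suml summxE.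
  rewrite (big_rem p)//= ltr_pwDl//.
    by have [_ _ _] := FP p; apply.
  apply: sumr_ge0 => q _.
  by have [_ _ mq _] := FP q; exact: (semimetric_ge0 mq Ix).
exact: (inhabits (RiemannianMetric (semimetric_smooth mG) (semimetric_sym mG) pG
  (semimetric_compat mG))).
Qed.
End metric_existence.

(** * The product inequality *)

Section scaled_metric.
Variables (R : realType) (n : nat) (M : closedManifold R n) (g : riemannianMetric M).
Variable s : R.
Hypothesis s0 : 0 < s.

Let mx i x := s *: metric_mx g i x.

Let smooth i : smooth_on (chart_img (mfd_chart i)) (mx i).
Proof. by apply: smooth_on_scale_metric; [exact: chart_img_open|exact: metric_smooth]. Qed.

Let sym i x : chart_img (mfd_chart i) x -> (mx i x)^T = mx i x.
Proof. by move=> Ix; rewrite /mx linearZ/= Defs.metric_sym. Qed.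

Let pos i x : chart_img (mfd_chart i) x ->
  forall v : 'rV[R]_n, v != 0 -> 0 < (v *m mx i x *m v^T) 0 0.
Proof.
by move=> Ix v v0; rewrite /mx -scalemxAr -scalemxAl mxE mulr_gt0// (Defs.metric_pos g Ix).
Qed.

Let compat i j x : overlap (mfd_chart i) (mfd_chart j) x ->
  let tau := transition (mfd_chart i) (mfd_chart j) in
  mx i x = jacobian tau x *m mx j (tau x) *m (jacobian tau x)^T.
Proof. by move=> ox; rewrite /= /mx (metric_compat g ox) -scalemxAr -scalemxAl. Qed.

Definition scaled_metric : riemannianMetric M := RiemannianMetric smooth sym pos compat.

End scaled_metric.

Lemma jacobian_row_mx (R : realType) m1 m2 n1 n2 (f1 : 'rV[R]_m1 -> 'rV[R]_n1)
    (f2 : 'rV[R]_m2 -> 'rV[R]_n2) (z : 'rV[R]_(m1 + m2)) :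
  differentiable f1 (lsubmx z) -> differentiable f2 (rsubmx z) ->
  jacobian (fun z : 'rV[R]_(m1 + m2) => row_mx (f1 (lsubmx z)) (f2 (rsubmx z))) z =
  block_mx (jacobian f1 (lsubmx z)) 0 0 (jacobian f2 (rsubmx z)).
Proof.
move=> d1 d2.
have dl : differentiable (fun z : 'rV[R]_(m1 + m2) => f1 (lsubmx z)) z.
  apply: (@differentiable_comp _ _ _ _ (@lsubmx R 1 m1 m2) f1) => //.
  exact: differentiable_lsubmx.
have dr : differentiable (fun z : 'rV[R]_(m1 + m2) => f2 (rsubmx z)) z.
  apply: (@differentiable_comp _ _ _ _ (@rsubmx R 1 m1 m2) f2) => //.
  exact: differentiable_rsubmx.
have [df dE] := differentiable_row_mx dl dr.
apply/row_matrixP => i; apply: etrans (rowE _ _) _.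
apply: etrans (esym (deriveEjacobian _ df)) _; apply: etrans (dE _) _.
rewrite derive_comp_lsubmx derive_comp_rsubmx.
rewrite (deriveEjacobian _ d1) (deriveEjacobian _ d2) [RHS]rowE.
move: (delta_mx 0 i) (jacobian f1 _) (jacobian f2 _) => v J1 J2.
by rewrite -[v in RHS]hsubmxK mul_row_block !mulmx0 addr0 add0r.
Qed.

Lemma bivector_norm0 (R : realType) n (A : 'M[R]_n) : bivector_norm A 0 = 0.
Proof. by rewrite /bivector_norm mulmx0 !mul0mx mxtrace0 mulr0. Qed.

Lemma bivector_eval0 (R : realType) n (T : 'I_n -> 'I_n -> 'I_n -> 'I_n -> R) :
  bivector_eval T 0 0 = 0.
Proof.
rewrite /bivector_eval big1 ?mulr0// => a _; rewrite big1// => b _.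
by rewrite big1// => c _; rewrite big1// => d _; rewrite !mxE mulr0.
Qed.

(** * The product metric and its form Riem_t *)

Section product_metric.
Variables (R : realType) (n1 n2 : nat).
Variables (M1 : closedManifold R n1) (M2 : closedManifold R n2).
Variables (g1 : riemannianMetric M1) (g2 : riemannianMetric M2).
Local Notation M := (product_manifold M1 M2).

Let mx (i : mfd_index M) z := block_metric (metric_mx g1 i.1) (metric_mx g2 i.2) z.

Lemma product_img (i : mfd_index M) : chart_img (mfd_chart i) =
  [set z | chart_img (mfd_chart i.1) (lsubmx z) /\ chart_img (mfd_chart i.2) (rsubmx z)].
Proof. exact: product_chart_imgE. Qed.

Let smooth i : smooth_on (chart_img (mfd_chart i)) (mx i).
Proof.
rewrite product_img; apply: smooth_on_block_metric; try exact: chart_img_open;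
exact: metric_smooth.
Qed.

Let sym i x : chart_img (mfd_chart i) x -> (mx i x)^T = mx i x.
Proof.
rewrite product_img => -[x1 x2].
by rewrite /mx /block_metric tr_block_mx !trmx0 !Defs.metric_sym.
Qed.

Let pos i x : chart_img (mfd_chart i) x ->
  forall v : 'rV[R]_(n1 + n2), v != 0 -> 0 < (v *m mx i x *m v^T) 0 0.
Proof.
rewrite product_img => -[x1 x2] v v0.
have p1 := Defs.metric_pos g1 x1; have p2 := Defs.metric_pos g2 x2.
rewrite /mx /block_metric -[v]hsubmxK in v0 *.
rewrite mul_row_block !mulmx0 addr0 add0r tr_row_mx mul_row_col mxE.
have [l0|l0] := eqVneq (lsubmx v) 0; have [r0|r0] := eqVneq (rsubmx v) 0.
- by rewrite l0 r0 row_mx0 eqxx in v0.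
- by rewrite l0 !mul0mx [X in X + _]mxE add0r p2.
- by rewrite r0 !mul0mx [X in _ + X]mxE addr0 p1.
- by rewrite addr_gt0// ?p1// p2.
Qed.

Let compat i j x : overlap (mfd_chart i) (mfd_chart j) x ->
  let tau := transition (mfd_chart i) (mfd_chart j) in
  mx i x = jacobian tau x *m mx j (tau x) *m (jacobian tau x)^T.
Proof.
have -> : overlap (mfd_chart i) (mfd_chart j) =
   [set z | overlap (mfd_chart i.1) (mfd_chart j.1) (lsubmx z) /\
            overlap (mfd_chart i.2) (mfd_chart j.2) (rsubmx z)] by exact: product_overlapE.
move=> [h1 h2] tau.
have -> : jacobian tau x = _ := jacobian_row_mx (transition_differentiable h1)
  (transition_differentiable h2).
rewrite /mx /block_metric (metric_compat g1 h1) (metric_compat g2 h2).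
rewrite {1}/tau /transition/= row_mxKl row_mxKr.
by rewrite tr_block_mx !trmx0 !mulmx_block !(mulmx0, mul0mx, addr0, add0r).
Qed.

Definition product_metric : riemannianMetric M := RiemannianMetric smooth sym pos compat.

Lemma product_metric_scal i z : chart_img (mfd_chart i) z ->
  scal (metric_mx product_metric i) z =
  scal (metric_mx g1 i.1) (lsubmx z) + scal (metric_mx g2 i.2) (rsubmx z).
Proof.
rewrite product_img => Iz.
exact: (scal_block (chart_img_open (c := mfd_chart i.1)) (chart_img_open (c := mfd_chart i.2))
  (metric_smooth g1 i.1) (metric_smooth g2 i.2)
  (@Defs.metric_sym _ _ _ g1 i.1) (@Defs.metric_sym _ _ _ g2 i.2)
  (@metric_unit _ _ _ g1 i.1) (@metric_unit _ _ _ g2 i.2) Iz).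
Qed.

Lemma product_metric_eval i z w : chart_img (mfd_chart i) z ->
  bivector_eval (curvature (metric_mx product_metric i) z) w w =
  bivector_eval (curvature (metric_mx g1 i.1) (lsubmx z)) (ulsubmx w) (ulsubmx w) +
  bivector_eval (curvature (metric_mx g2 i.2) (rsubmx z)) (drsubmx w) (drsubmx w).
Proof.
rewrite product_img => Iz.
exact: (bivector_eval_curvature_block
  (chart_img_open (c := mfd_chart i.1)) (chart_img_open (c := mfd_chart i.2))
  (metric_smooth g1 i.1) (metric_smooth g2 i.2)
  (@Defs.metric_sym _ _ _ g1 i.1) (@Defs.metric_sym _ _ _ g2 i.2)
  (@metric_unit _ _ _ g1 i.1) (@metric_unit _ _ _ g2 i.2) w Iz).
Qed.

(* Riem_t splits as a form on bivectors of the first factor, one on bivectors of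
   the second factor, and Scal times the norm on mixed bivectors. *)
Lemma product_riem_t_pos t :
  (forall i1 x1 i2 x2, chart_img (mfd_chart i1) x1 -> chart_img (mfd_chart i2) x2 ->
    let S := scal (metric_mx g1 i1) x1 + scal (metric_mx g2 i2) x2 in
    [/\ 0 < S,
     forall w, w^T = - w -> w != 0 -> 0 < S * bivector_norm (metric_mx g1 i1 x1) w
        - 2 * t * bivector_eval (curvature (metric_mx g1 i1) x1) w w &
     forall w, w^T = - w -> w != 0 -> 0 < S * bivector_norm (metric_mx g2 i2 x2) w
        - 2 * t * bivector_eval (curvature (metric_mx g2 i2) x2) w w]) ->
  scal_pos product_metric /\ riem_t_pos t product_metric.
Proof.
move=> H; split=> i z Iz.
  rewrite product_metric_scal//; move: Iz; rewrite product_img => -[I1 I2].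
  by have [] := H _ _ _ _ I1 I2.
move=> w sw w0; rewrite bivector_eval_riem_form// product_metric_scal// product_metric_eval//.
move: Iz; rewrite product_img => -[I1 I2].
have /= [S0 H1 H2] := H _ _ _ _ I1 I2.
have -> : bivector_norm (metric_mx product_metric i z) w = _ :=
  bivector_norm_block (metric_mx g1 i.1 (lsubmx z)) (metric_mx g2 i.2 (rsubmx z)) w.
have s1 := Defs.metric_sym g1 I1; have s2 := Defs.metric_sym g2 I2.
have p1 : posdef_mx _ := Defs.metric_pos g1 I1.
have p2 : posdef_mx _ := Defs.metric_pos g2 I2.
move: S0 H1 H2; set S := _ + _ => S0 H1 H2.
move: H1 H2 s1 s2 p1 p2.
move: (metric_mx g1 i.1 (lsubmx z)) (metric_mx g2 i.2 (rsubmx z)) => A B.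
move: (curvature _ (lsubmx z)) (curvature _ (rsubmx z)) => T1 T2 H1 H2 sA sB pA pB.
pose X1 w := S * bivector_norm A w - 2 * t * bivector_eval T1 w w.
pose X2 w := S * bivector_norm B w - 2 * t * bivector_eval T2 w w.
have sul : (ulsubmx w)^T = - ulsubmx w by rewrite trmx_ulsub sw; apply/matrixP => k l; rewrite !mxE.
have sdr : (drsubmx w)^T = - drsubmx w by rewrite trmx_drsub sw; apply/matrixP => k l; rewrite !mxE.
have X1ge : 0 <= X1 (ulsubmx w).
  have [->|/(H1 _ sul)/ltW//] := eqVneq (ulsubmx w) 0.
  by rewrite /X1 bivector_norm0 bivector_eval0 !mulr0 subr0.
have X2ge : 0 <= X2 (drsubmx w).
  have [->|/(H2 _ sdr)/ltW//] := eqVneq (drsubmx w) 0.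
  by rewrite /X2 bivector_norm0 bivector_eval0 !mulr0 subr0.
have Y1ge := mxtrace_congruence_ge0 (ursubmx w) sA pA sB pB.
have Y2ge := mxtrace_congruence_ge0 (dlsubmx w) sB pB sA pA.
have Y1gt := mxtrace_congruence_gt0 (u := ursubmx w) sA pA sB pB.
have Y2gt := mxtrace_congruence_gt0 (u := dlsubmx w) sB pB sA pA.
have -> : S * (bivector_norm A (ulsubmx w) + bivector_norm B (drsubmx w) +
    2^-1 * (\tr (A *m ursubmx w *m B^T *m (ursubmx w)^T) +
            \tr (B *m dlsubmx w *m A^T *m (dlsubmx w)^T))) -
    2 * t * (bivector_eval T1 (ulsubmx w) (ulsubmx w) + bivector_eval T2 (drsubmx w) (drsubmx w)) =
  X1 (ulsubmx w) + X2 (drsubmx w) +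
    S * (2^-1 * (\tr (A *m ursubmx w *m B^T *m (ursubmx w)^T) +
            \tr (B *m dlsubmx w *m A^T *m (dlsubmx w)^T))).
  by rewrite /X1 /X2; ring.
have Zge : 0 <= S * (2^-1 * (\tr (A *m ursubmx w *m B^T *m (ursubmx w)^T) +
            \tr (B *m dlsubmx w *m A^T *m (dlsubmx w)^T))).
  apply: mulr_ge0 (ltW S0) _; apply: mulr_ge0; last exact: addr_ge0.
  by rewrite invr_ge0.
(* All three summands are nonnegative, so one strict inequality suffices; a nonzero w has a nonzero
   block, and the four blocks are tried in turn. *)
have [ul0|/(H1 _ sul) ul0] := eqVneq (ulsubmx w) 0; last first.
  by rewrite -addrA ltr_pwDl// addr_ge0.
have [dr0|/(H2 _ sdr) dr0] := eqVneq (drsubmx w) 0; last first.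
  by rewrite addrAC ltr_pwDr// addr_ge0.
apply: ltr_wpDl; first exact: addr_ge0.
apply: mulr_gt0 S0 _; apply: mulr_gt0; first by rewrite invr_gt0.
have [ur0|/Y1gt ur0] := eqVneq (ursubmx w) 0; last by rewrite ltr_pwDl.
have [dl0|/Y2gt dl0] := eqVneq (dlsubmx w) 0; last by rewrite ltr_wpDl.
by case/eqP: w0; rewrite -[w]submxK ul0 ur0 dl0 dr0 block_mx0.
Qed.
End product_metric.

(** The sign condition on c covers the empty set, whose supremum is 0 by convention. *)
Lemma ge_sup_ge0 (R : realType) (A : set R) (c : R) : 0 <= c -> ubound A c -> sup A <= c.
Proof.
move=> c0 Ac; have [A0|A0] := pselect (A !=set0); first exact: ge_sup.
by rewrite sup_out// => -[].
Qed.

Lemma sup_ge0 (R : realType) (A : set R) : has_ubound A -> lbound A 0 -> 0 <= sup A.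
Proof.
move=> uA lA; have [[x Ax]|A0] := pselect (A !=set0).
  exact: le_trans (lA _ Ax) (ub_le_sup uA Ax).
by rewrite sup_out// => -[].
Qed.

(** * Bounds for the suprema *)

Section bounds_of_Riem.
Variables (R : realType) (n : nat) (M : closedManifold R n).
Implicit Types g : riemannianMetric M.

Let bound : R := n%:R * (n%:R - 1) / 2.

Let tset g : set R := [set t | 0 < t < n%:R * (n%:R - 1) / 2 /\ riem_t_pos t g].

Let tset_ub g : has_ubound (tset g).
Proof. by exists bound => t [/andP[_ /ltW]]. Qed.

Lemma bound_ge0 : 0 <= bound.
Proof.
rewrite /bound; case: n => [|m]; first by rewrite !mul0r.
by rewrite -addn1 natrD addrK !mulr_ge0// ?addr_ge0.
Qed.

Lemma riem_metric_lower g t : scal_pos g -> 0 < t < n%:R * (n%:R - 1) / 2 ->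
  riem_t_pos t g -> t <= riem_metric g.
Proof.
move=> sg tb pg; rewrite /riem_metric asboolT//.
by apply: ub_le_sup; [exact: tset_ub|].
Qed.

Lemma riem_metric_upper g c : 0 <= c ->
  (scal_pos g -> forall t, 0 < t < n%:R * (n%:R - 1) / 2 -> riem_t_pos t g -> t <= c) ->
  riem_metric g <= c.
Proof.
move=> c0 H; rewrite /riem_metric; case: asboolP => // sg.
by apply: ge_sup_ge0 => // t [tb pt]; exact: H.
Qed.

Lemma riem_metric_ge0 g : 0 <= riem_metric g.
Proof.
rewrite /riem_metric; case: asboolP => // sg.
by apply: sup_ge0 => [|t [/andP[/ltW]]]; first exact: tset_ub.
Qed.

Lemma riem_metric_le_Riem g : riem_metric g <= Riem M.
Proof.
apply: ub_le_sup; last by exists g.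
exists bound => _ [h _ <-]; apply: riem_metric_upper; first exact: bound_ge0.
by move=> _ t /andP[_ /ltW].
Qed.

Lemma Riem_upper c : 0 <= c -> (forall g, riem_metric g <= c) -> Riem M <= c.
Proof.
by move=> c0 H; apply: ge_sup_ge0 => // _ [g _ <-].
Qed.

Lemma Riem_ge0 : 0 <= Riem M.
Proof.
have [g] := riemannianMetric_exists M.
exact: le_trans (riem_metric_ge0 g) (riem_metric_le_Riem g).
Qed.

End bounds_of_Riem.

(** * Choice of the scale *)

Section large_scale.
Variables (R : realType) (n1 n2 : nat).
Variables (M1 : closedManifold R n1) (M2 : closedManifold R n2).
Variables (g1 : riemannianMetric M1) (g2 : riemannianMetric M2).

(** The three conclusions are those consumed by [product_riem_t_pos]: mixed bivectors, first factor,
    second factor. The scale depends only on t, t' and the uniform constants, hence serves all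
    points and charts at once. *)
Lemma large_scale t t' : 0 < t' < t -> scal_pos g1 -> riem_t_pos t g1 ->
  exists s (s0 : 0 < s), forall i1 x1 i2 x2,
    chart_img (mfd_chart i1) x1 -> chart_img (mfd_chart i2) x2 ->
    let S := scal (metric_mx g1 i1) x1 + scal (metric_mx (scaled_metric g2 s0) i2) x2 in
    [/\ 0 < S,
     forall w, w^T = - w -> w != 0 -> 0 < S * bivector_norm (metric_mx g1 i1 x1) w
        - 2 * t' * bivector_eval (curvature (metric_mx g1 i1) x1) w w &
     forall w, w^T = - w -> w != 0 -> 0 < S * bivector_norm (metric_mx (scaled_metric g2 s0) i2 x2) w
        - 2 * t' * bivector_eval (curvature (metric_mx (scaled_metric g2 s0) i2) x2) w w].
Proof.
move=> /andP[t'0 t't] sg pg.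
have t0 := lt_trans t'0 t't.
have [C1 C10 B1] := scal_pos_bound sg.
have [C2 C20 B2] := curvature_bound g2.
pose u := t' / t; have u0 : 0 < u by rewrite divr_gt0.
have u1 : u < 1 by rewrite ltr_pdivrMr// mul1r.
have t'E : t' = u * t by rewrite /u divfK// gt_eqF.
(* With a = Scal(g1) and b = Scal(g2), C1 a >= 1 turns s a into at least C2 times the bracket. Its
   summand 1 absorbs b >= - C2 in s S, its summand 2 t' beats the curvature of the second factor,
   and (1 - u)^-1 makes (1 - u) s a alone absorb b on the first factor. *)
pose s := C1 * C2 * ((1 - u)^-1 + 1 + 2 * t').
have v0 : 0 < 1 - u by rewrite subr_gt0.
have s0 : 0 < s.
  by rewrite /s !mulr_gt0// !addr_gt0// ?invr_gt0// mulr_gt0.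
exists s, s0 => i1 x1 i2 x2 I1 I2 S.
have oI2 : open (chart_img (mfd_chart i2)) by exact: chart_img_open.
have [b2 e2] := B2 i2 x2 I2.
have b1 := B1 i1 x1 I1; have sc1 := sg i1 x1 I1.
have SE : S = scal (metric_mx g1 i1) x1 + s^-1 * scal (metric_mx g2 i2) x2.
  congr (_ + _); exact: (scal_scale oI2 (metric_smooth g2 i2) s0
    (@Defs.metric_sym _ _ _ g2 i2) (@metric_unit _ _ _ g2 i2) I2).
have QE w : bivector_eval (curvature (metric_mx (scaled_metric g2 s0) i2) x2) w w =
    s * bivector_eval (curvature (metric_mx g2 i2) x2) w w.
  exact: (bivector_eval_curvature_scale oI2 (metric_smooth g2 i2) s0
    (@Defs.metric_sym _ _ _ g2 i2) (@metric_unit _ _ _ g2 i2) w I2).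
have NE w : bivector_norm (metric_mx (scaled_metric g2 s0) i2 x2) w =
    s * s * bivector_norm (metric_mx g2 i2 x2) w.
  exact: bivector_norm_scale.
have P1 w (w0 : w != 0) :=
  bivector_norm_gt0 (Defs.metric_sym g1 I1) (Defs.metric_pos g1 I1) w0.
have P2 w (w0 : w != 0) :=
  bivector_norm_gt0 (Defs.metric_sym g2 I2) (Defs.metric_pos g2 I2) w0.
have F1 w (sw : w^T = - w) (w0 : w != 0) :
    0 < scal (metric_mx g1 i1) x1 * bivector_norm (metric_mx g1 i1 x1) w
      - 2 * t * bivector_eval (curvature (metric_mx g1 i1) x1) w w.
  by rewrite -bivector_eval_riem_form//; exact: pg.
have {}F1 w (sw : w^T = - w) (w0 : w != 0) := F1 w sw w0.
pose K := (1 - u)^-1 + 1 + 2 * t'.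
have K0 : 0 < K by rewrite !addr_gt0// ?invr_gt0// mulr_gt0.
move: b2 b1 sc1 SE F1; move: (scal _ x1) (scal _ x2) => a b b2 b1 sc1 SE F1.
have sa : C2 * K <= s * a.
  have -> : s * a = C1 * a * (C2 * K) by rewrite /s -/K; ring.
  by rewrite ler_peMl// mulr_ge0// ltW.
have sS : s * S = s * a + b by rewrite SE mulrDr mulrA divff ?mul1r// gt_eqF.
have bC : - C2 <= b by move: b2; rewrite ler_norml => /andP[].
have v1 : 0 < (1 - u)^-1 by rewrite invr_gt0.
have sS2 : 2 * t' * C2 < s * S.
  rewrite sS; apply: lt_le_trans (lerD sa bC).
  have -> : C2 * K - C2 = C2 * (1 - u)^-1 + 2 * t' * C2 by rewrite /K; ring.
  by rewrite ltrDr mulr_gt0.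
have S0 : 0 < S.
  by rewrite -(pmulr_rgt0 _ s0); apply: le_lt_trans sS2; rewrite !mulr_ge0// ltW.
split=> // w sw w0.
  have -> : S * bivector_norm (metric_mx g1 i1 x1) w
      - 2 * t' * bivector_eval (curvature (metric_mx g1 i1) x1) w w =
     u * (a * bivector_norm (metric_mx g1 i1 x1) w
      - 2 * t * bivector_eval (curvature (metric_mx g1 i1) x1) w w)
     + (S - u * a) * bivector_norm (metric_mx g1 i1 x1) w.
    by rewrite t'E; ring.
  apply: addr_gt0; first exact: mulr_gt0 u0 (F1 w sw w0).
  apply: mulr_gt0 _ (P1 w w0); rewrite -(pmulr_rgt0 _ s0) mulrBr sS.
  have -> : s * a + b - s * (u * a) = (1 - u) * (s * a) + b by ring.
  have h : (1 - u) * (C2 * K) <= (1 - u) * (s * a) by rewrite ler_pM2l.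
  apply: lt_le_trans (lerD h bC).
  have -> : (1 - u) * (C2 * K) - C2 = C2 * ((1 - u) + 2 * t' * (1 - u)).
    by rewrite /K; field; rewrite gt_eqF.
  by rewrite mulr_gt0// addr_gt0// !mulr_gt0.
rewrite NE QE; move: (e2 w) (P2 w w0).
move: (bivector_norm _ w) (bivector_eval _ w w) => N Q.
rewrite ler_norml => /andP[_ QN] N0.
(* After extracting one s, only s S > 2 t' C2 and Q <= C2 N remain to be compared. *)
have -> : S * (s * s * N) - 2 * t' * (s * Q) = s * (s * S * N - 2 * t' * Q) by ring.
rewrite mulr_gt0// subr_gt0.
apply: (@le_lt_trans _ _ (2 * t' * (C2 * N))); first by rewrite ler_pM2l// mulr_gt0.
by rewrite mulrA ltr_pM2r.
Qed.

End large_scale.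

(** * Comparison of the invariants *)

Section max_bound.
Variables (R : realType) (n1 n2 : nat).
Variables (M1 : closedManifold R n1) (M2 : closedManifold R n2).

(** The range allowed for t grows with the dimension, so a parameter admissible on a factor is
    admissible on the product. Dimension 0 is separate because its second factor m - 1 is
    negative. *)
Lemma dim_bound_le (m n : nat) : (m <= n)%N ->
  m%:R * (m%:R - 1) / 2 <= n%:R * (n%:R - 1) / 2 :> R.
Proof.
move=> mn; rewrite ler_pM2r ?invr_gt0//; case: m mn => [_|m mn].
  by have := bound_ge0 R n; rewrite pmulr_lge0 ?invr_gt0// mul0r.
have m1 : 1 <= m.+1%:R :> R by rewrite ler1n.
have mn' : m.+1%:R <= n%:R :> R by rewrite ler_nat.
by apply: ler_pM; rewrite ?subr_ge0// lerD2r.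
Qed.

Lemma le_of_lt_pos (c t : R) : 0 < t -> (forall t', 0 < t' < t -> t' <= c) -> t <= c.
Proof.
move=> t0 H; rewrite leNgt; apply/negP => ct.
(* As c may be negative, it is first raised to t / 2 so that the midpoint with t is an admissible
   positive parameter. *)
have c0 : 0 < Num.max c (t / 2) by rewrite lt_max divr_gt0// orbT.
have ht : Num.max c (t / 2) < t by rewrite gt_max ct/=; lra.
pose m := (Num.max c (t / 2) + t) / 2.
have : m <= c by apply: H; rewrite /m; apply/andP; split; lra.
have : c <= Num.max c (t / 2) by rewrite le_max lexx.
rewrite /m; lra.
Qed.

Lemma Riem_product_fst : Riem M1 <= Riem (product_manifold M1 M2).
Proof.
have c0 := Riem_ge0 (product_manifold M1 M2).
(* Both suprema on the left and their default values 0 are bounded here; what remains is a metric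
   with Scal > 0 and one admissible t. *)
apply: Riem_upper => // g1; apply: riem_metric_upper => // sg t /andP[t0 tb] pg.
apply: le_of_lt_pos => // t' t't; have [g2] := riemannianMetric_exists M2.
have [s [s0 H]] := large_scale g2 t't sg pg.
have [sP tP] := product_riem_t_pos H.
apply: le_trans (riem_metric_le_Riem (product_metric g1 (scaled_metric g2 s0))).
apply: riem_metric_lower => //; case/andP: t't => -> t't /=.
by apply: lt_le_trans (lt_trans t't tb) _; apply: dim_bound_le; exact: leq_addr.
Qed.

(** The roles of the factors are exchanged inside [large_scale], now rescaling the metric on M1,
    rather than by identifying the product with the one in the opposite order. *)
Lemma Riem_product_snd : Riem M2 <= Riem (product_manifold M1 M2).
Proof.
have c0 := Riem_ge0 (product_manifold M1 M2).
apply: Riem_upper => // g2; apply: riem_metric_upper => // sg t /andP[t0 tb] pg.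
apply: le_of_lt_pos => // t' t't; have [g1] := riemannianMetric_exists M1.
have [s [s0 H]] := large_scale g1 t't sg pg.
have [|sP tP] := @product_riem_t_pos _ _ _ _ _ (scaled_metric g1 s0) g2 t'.
  by move=> i1 x1 i2 x2 I1 I2; rewrite addrC; have [] := H i2 x2 i1 x1 I2 I1.
apply: le_trans (riem_metric_le_Riem (product_metric (scaled_metric g1 s0) g2)).
apply: riem_metric_lower => //; case/andP: t't => -> t't /=.
by apply: lt_le_trans (lt_trans t't tb) _; apply: dim_bound_le; exact: leq_addl.
Qed.

End max_bound.

Theorem proposition1p1 (R : realType) (n1 n2 : nat)
    (M1 : closedManifold R n1) (M2 : closedManifold R n2) :
  Num.max (Riem M1) (Riem M2) <= Riem (product_manifold M1 M2).
Proof. by rewrite ge_max Riem_product_fst Riem_product_snd. Qed.
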